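(* Let $\gamma\in(0,1)$ and let $f$ be a measurable real-valued function on $\mathbb{R}^{n+1}$. Then the following statements are mutually equivalent. (i) $f\in\mathrm{BMO}^+(\gamma)$. (ii) $f\in L^1_{\mathrm{loc}}$ and there exist positive constants $A$ and $B$ such that, for any $R\in\mathcal{R}$ and $\lambda\in(0,\infty)$, $$\left|R^-(\gamma)\cap\left\{f-f_{R^+(\gamma)}>\lambda\right\}\right|\leq A e^{-B\lambda}\left|R^-(\gamma)\right|.$$ (iii) $f\in L^1_{\mathrm{loc}}$ and there exist positive constants $\delta$ and $D$ such that $$\sup_{R\in\mathcal{R}}\fint_{R^-(\gamma)}e^{\delta[f-f_{R^+(\gamma)}]_+}\leq D.$$
   Context: Work in $\mathbb{R}^{n+1}$, with points $(x,t)$, $x\in\mathbb{R}^n$, $t\in\mathbb{R}$; $p\in(1,\infty)$ is fixed throughout. $Q(x,L)=\{y\in\mathbb{R}^n: x_i-\frac L2\le y_i<x_i+\frac L2 \text{ for all } i\in\{1,\dots,n\}\}$. A parabolic rectangle centered at $(x,t)$ with edge length $L\in(0,\infty)$ is $R=R(x,t,L)=Q(x,L)\times[t-L^p,t+L^p)$; $\mathcal{R}$ is the set of all parabolic rectangles. For $\gamma\in[0,1)$, $R^-(\gamma)=Q(x,L)\times[t-L^p,t-\gamma L^p)$ and $R^+(\gamma)=Q(x,L)\times[t+\gamma L^p,t+L^p)$. $|A|$ is Lebesgue measure, $f_A=\fint_A f=\frac1{|A|}\int_A f$, $f_+=\max\{f,0\}$. $L^1_{\mathrm{loc}}$ is the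 set of all locally integrable functions on $\mathbb{R}^{n+1}$. $\mathrm{BMO}^+(\gamma)$ is the set of all $f\in L^1_{\mathrm{loc}}$ with $$\|f\|_{\mathrm{BMO}^+(\gamma)}=\sup_{R\in\mathcal{R}}\fint_{R^-(\gamma)}[f-f_{R^+(\gamma)}]_+<\infty.$$ *)

(* Defs.v *)
From HB Require Import structures.
From mathcomp Require Import all_boot all_order all_algebra.
From mathcomp Require Import all_classical all_reals all_analysis.
Set Implicit Arguments.
Unset Strict Implicit.
Unset Printing Implicit Defensive.
Import Order.TTheory GRing.Theory Num.Theory.
Import numFieldNormedType.Exports.
Local Open Scope classical_set_scope.
Local Open Scope ring_scope.

(* Points (x, t) of R^(n+1), with x in R^n and t in R. *)
Definition spacetime (R : realType) (n : nat) : Type := ('rV[R]_n * R)%type.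

HB.instance Definition _ (R : realType) (n : nat) :=
  NormedModule.copy (spacetime R n) ('rV[R]_n * R)%type.

(* The analysis library has Lebesgue measure on R only.  On R^(n+1) it is
   obtained here from the outer measure defined by countable covers with
   half-open boxes, restricted to its Caratheodory-measurable sets, that is, to
   the Lebesgue-measurable sets (not just the Borel ones). *)
Section lebesgue_spacetime.
Context {R : realType} {n : nat}.
Implicit Types (a b : spacetime R n) (X : set (spacetime R n)).

Definition box a b : set (spacetime R n) :=
  [set z : spacetime R n | (forall i, a.1 0 i <= z.1 0 i < b.1 0 i) /\ a.2 <= z.2 < b.2].

Definition box_volume a b : R :=
  (\prod_(i < n) Num.max (b.1 0 i - a.1 0 i) 0) * Num.max (b.2 - a.2) 0.

Local Open Scope ereal_scope.

Definition spacetime_outer X : \bar R :=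
  ereal_inf [set \sum_(k <oo) (box_volume (u k).1 (u k).2)%:E |
    u in [set u : (spacetime R n * spacetime R n)^nat |
            X `<=` \bigcup_k box (u k).1 (u k).2]].

Let vol (c : spacetime R n * spacetime R n) : \bar R :=
  (box_volume c.1 c.2)%:E.

Let vol_ge0 c : 0 <= vol c.
Proof.
rewrite lee_fin mulr_ge0 //; last by rewrite le_max lexx orbT.
by apply: prodr_ge0 => i _; rewrite le_max lexx orbT.
Qed.

Lemma spacetime_outer_ge0 X : 0 <= spacetime_outer X.
Proof.
apply: le_ereal_inf_tmp => _ [u _ <-].
by apply: nneseries_ge0 => k _ _; exact: vol_ge0.
Qed.

Lemma spacetime_outer0 : spacetime_outer set0 = 0.
Proof.
apply/eqP; rewrite eq_le spacetime_outer_ge0 andbT.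
apply: ereal_inf_lbound; exists (fun=> (0%R, 0%R)); first by move=> ? [].
by apply: eseries0 => k _ _; rewrite /box_volume/= subrr maxxx mulr0.
Qed.

Lemma le_spacetime_outer : {homo spacetime_outer : A B / A `<=` B >-> A <= B}.
Proof.
move=> A B AB; apply: le_ereal_inf => _ [u Bu <-]; exists u => //.
exact: subset_trans Bu.
Qed.

Lemma spacetime_outer_sigma_subadditive : sigma_subadditive spacetime_outer.
Proof.
move=> A; have [[i ioo]|] := pselect (exists i, spacetime_outer (A i) = +oo).
  rewrite (eseries_pinfty _ _ ioo) ?leey// => k _.
  by rewrite -ltNye (lt_le_trans _ (spacetime_outer_ge0 _)).
rewrite -forallNE => Aoo.
suff add2e (e : {posnum R}) : spacetime_outer (\bigcup_k A k) <=
    \sum_(i <oo) spacetime_outer (A i) + e%:num%:E.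
  by apply/lee_addgt0Pr => _/posnumP[].
apply: le_trans (epsilon_trick _ _ _) => //; last first.
  by move=> k; exact: spacetime_outer_ge0.
have cover k : exists u : (spacetime R n * spacetime R n)^nat,
    A k `<=` \bigcup_j box (u j).1 (u j).2 /\
    \sum_(j <oo) vol (u j) <=
      spacetime_outer (A k) + (e%:num / (2 ^ k.+1)%:R)%:E.
  have fk : spacetime_outer (A k) \is a fin_num.
    by rewrite ge0_fin_numE ?spacetime_outer_ge0// ltey; exact/eqP/Aoo.
  have ek : (0 < e%:num / (2 ^ k.+1)%:R :> R)%R by [].
  have [_ [u Au <-] ue] := lb_ereal_inf_adherent ek fk.
  by exists u; split => //; exact/ltW.
have [G PG] := choice cover.
have volG_ge0 x : 0 <= (vol \o uncurry G) x by exact: vol_ge0.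
apply: (@le_trans _ _ (\sum_(i <oo) \sum_(j <oo) vol (G i j))); last first.
  by apply: lee_nneseries => k _ *;
    [apply: nneseries_ge0 => *; exact: vol_ge0|exact: (PG k).2].
have /card_esym/ppcard_eqP[h] := card_nat2.
apply: ereal_inf_lbound; exists (uncurry G \o h) => /=.
  move=> z [i _ /(PG i).1[j _ Gz]]; exists (h^-1%FUN (i, j)) => //=.
  by rewrite invK ?inE.
rewrite [LHS]nneseries_esumT; last by move=> k; exact: vol_ge0.
transitivity (\esum_(c in [set: nat * nat]) (vol \o uncurry G) c).
  by rewrite (@reindex_esum _ _ _ setT setT h)//; exact: bijTT.
rewrite nneseries_esumT; last first.
  by move=> k; apply: nneseries_ge0 => j _ _; exact: vol_ge0.
rewrite (eq_esum (b := fun i => \esum_(j in setT) vol (G i j))); last first.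
  by move=> k _; rewrite nneseries_esumT// => j; exact: vol_ge0.
rewrite esum_esum; last by move=> *; exact: vol_ge0.
congr esum; first by apply/seteqP; split.
by apply/funext => -[].
Qed.

HB.instance Definition _ := isOuterMeasure.Build R (spacetime R n)
  spacetime_outer spacetime_outer0 spacetime_outer_ge0 le_spacetime_outer
  spacetime_outer_sigma_subadditive.

HB.instance Definition _ :=
  Measurable.copy (spacetime R n) (caratheodory_type spacetime_outer).

Definition spacetime_lebesgue : set (spacetime R n) -> \bar R :=
  spacetime_outer.

HB.instance Definition _ := isMeasure.Build _ (spacetime R n) R
  spacetime_lebesgue
  (@caratheodory_measure0 _ _ spacetime_outer)
  (@caratheodory_measure_ge0 _ _ spacetime_outer)
  (@caratheodory_measure_sigma_additive _ _ spacetime_outer).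

End lebesgue_spacetime.

Section parabolic_bmo.
Context {R : realType} {n : nat}.
Implicit Types (f : spacetime R n -> R) (A : set (spacetime R n)).

Local Notation mu := (@spacetime_lebesgue R n).

Record parabolic_rectangle := ParabolicRectangle {
  pr_center : 'rV[R]_n ;
  pr_time : R ;
  pr_edge : R ;
  pr_edge_gt0 : 0 < pr_edge }.

Implicit Types (P : parabolic_rectangle) (p gamma : R).

Definition cube (x : 'rV[R]_n) (L : R) : set 'rV[R]_n :=
  [set y | forall i, x 0 i - L / 2 <= y 0 i < x 0 i + L / 2].

(* The lower part R^-(gamma) and the upper part R^+(gamma) of the rectangle
   R = Q(x, L) * [t - L^p, t + L^p). *)
Definition lower_part p gamma P : set (spacetime R n) :=
  let: ParabolicRectangle x t L _ := P in
  cube x L `*` `[t - L `^ p, t - gamma * L `^ p[.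

Definition upper_part p gamma P : set (spacetime R n) :=
  let: ParabolicRectangle x t L _ := P in
  cube x L `*` `[t + gamma * L `^ p, t + L `^ p[.

Definition positive_part (a : R) : R := Num.max a 0.

Local Open Scope ereal_scope.

(* Extended-real integral average, so that the averages of nonnegative
   functions may be +oo. *)
Definition eaverage A (g : spacetime R n -> \bar R) : \bar R :=
  (fine (mu A))^-1%:E * \int[mu]_(z in A) g z.

Definition average A f : R := fine (eaverage A (EFin \o f)).

Definition L1loc f : Prop := measurable_fun [set: spacetime R n] f /\
  forall K, compact K -> mu.-integrable K (EFin \o f).

Definition BMO_plus_norm p gamma f : \bar R :=
  ereal_sup [set eaverage (lower_part p gamma P)
      (fun z => (positive_part (f z - average (upper_part p gamma P) f)%R)%:E)
    | P in [set: parabolic_rectangle]].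

Definition BMO_plus p gamma f : Prop :=
  L1loc f /\ BMO_plus_norm p gamma f < +oo.

End parabolic_bmo.

Arguments parabolic_rectangle : clear implicits.

(* Main.v *)
Require Import Defs.
From HB Require Import structures.
From mathcomp Require Import all_boot all_order all_algebra.
From mathcomp Require Import all_classical all_reals all_analysis.
From mathcomp Require Import measurable_realfun.
From mathcomp Require Import ring lra zify.
Import Order.TTheory GRing.Theory Num.Theory.
Import numFieldNormedType.Exports.
Local Open Scope classical_set_scope.
Local Open Scope ring_scope.

(** (i) => (ii). Write [c_R] for the mean of [f] over [R^+(gamma)]. The norm only
bounds means over subsets of [R^-(gamma)] by [c_R], that is, it compares the
past with means over whole later upper parts.

Local estimate. In a grid of boxes adapted to the parabolic scaling, attach to
every cell [Q] the rectangle [R_Q] with the same edge and the same bottom. Stop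
at the maximal cells [P] inside [Q] with [c_{R_P} > c_{R_Q} + a]. Their upper
parts lie in [R_Q^-] and carry a large mean of [f - c_{R_Q}]; a Vitali selection
of the upper parts shows that, for large [a], the stopped cells fill at most half
of [Q], while outside of them [f] is almost everywhere at most [c_{R_Q}] plus a
constant. Iteration gives exponential decay relative to [c_{R_Q}].

From small cells to [R]. It remains to see that [c_{R_Q}] is at most [c_R] plus a
constant for all small cells [Q] meeting [R^-(gamma)], even at its top. The time
available is the gap of length [2 gamma L^p] below [R^+(gamma)]. Steps at scale [l]
move mass sideways by a distance comparable with [l] in a time comparable with
[l^p]; as [p > 1], the mass of a small cube can be spread evenly over the whole
base cube in a time much shorter than the gap. After that, mass is moved only in
time: [R^+(gamma)] is exhausted by slabs of heights [h 2^(-kp)], [k = k0, k0 + 1, ...],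
and reaching a slab of level [k] costs [O(k)], which is summable against the
heights. *)

(** * Volume of boxes *)

(** The one-sided inequality never compares two places at the same time: constants of small cells
    can only be pushed towards the future, and all pushing has to fit into the gap. Across [2 ^ k0]
    cells of edge [L / 2 ^ k0], a symmetric random walk would need about [4 ^ k0] steps of duration
    about [L^p / 2^(p k0)], which is short only for [p > 2]. But any chosen portion of the mass can
    be sent in one direction, and such a directed transport spreads it evenly within about
    [k0 * 2 ^ k0] steps. The time needed, relative to [L^p], is about [k0 * 2^((1 - p) k0)], hence
    small for every [p > 1], and [k0] depends on [n], [p], [gamma] alone. Moves in time have a rigid
    length, the lag times the height of the slab moved. To arrive at a prescribed position they are
    made with slabs that are finer by a fixed number [j0] of levels, at a bounded cost. *)

Lemma indic_itvcoE (R : realType) (u v : R) :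
  (fun t : R => (u <= t < v)%R%:R) = \1_(`[u, v[%classic) :> (R -> R).
Proof.
apply/funext => t; rewrite indicE; congr (_%:R); congr nat_of_bool.
by apply/idP/idP; rewrite inE /= in_itv.
Qed.

Lemma measurable_itvco_indicator (R : realType) (D : set R) (u v c : R) :
  measurable_fun D (EFin \o (fun t : R => c * (u <= t < v)%R%:R)).
Proof.
apply/measurable_EFinP; apply: measurable_funM => //.
by rewrite indic_itvcoE; exact: measurable_indic.
Qed.

Lemma integral_scaled_itv_le (R : realType) (a b u v c : R) : 0 <= c ->
  (\int[lebesgue_measure]_(t in `[a, b[)
     (c * (u <= (t : R) < v)%R%:R)%:E <= (c * Num.max (v - u) 0)%:E)%E.
Proof.
move=> c0.
under eq_integral => t _ do rewrite EFinM.
rewrite ge0_integralZl_EFin//; last first.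
  have := @measurable_itvco_indicator R `[a, b[ u v 1.
  by congr (measurable_fun _ _); apply/funext => t /=; rewrite mul1r.
under eq_integral => t _ do rewrite -[X in X%:E]/((fun t : R => (u <= t < v)%R%:R) t) indic_itvcoE.
rewrite integral_indic// EFinM lee_wpmul2l// ?lee_fin//.
apply: (@le_trans _ _ (lebesgue_measure (`[u, v[%classic : set R))).
  by apply: le_measure; rewrite ?inE//; apply: measurableI.
rewrite lebesgue_measure_itv/= lte_fin; case: ifPn => uv.
  by rewrite -EFinB lee_fin le_max lexx.
by rewrite lee_fin le_max lexx orbT.
Qed.

(* Slicing by the last coordinate: a cover of a box restricts to a weighted
   cover of each slice, and one-dimensional Lebesgue integration over the slices
   gives the volume bound. The weights keep track of the slices already taken. *)
Lemma volume_le_weighted_cover (R : realType) (d : nat) (A B : nat -> R)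
    (w : nat -> R) (U V : nat -> nat -> R) :
  (forall i, A i <= B i) -> (forall k, 0 <= w k) ->
  (forall x : nat -> R, (forall i, (i < d)%N -> A i <= x i < B i) ->
     (1 <= \sum_(k <oo) (w k * \prod_(i < d) (U k i <= x i < V k i)%R%:R)%:E)%E) ->
  ((\prod_(i < d) (B i - A i))%:E <=
     \sum_(k <oo) (w k * \prod_(i < d) Num.max (V k i - U k i) 0)%:E)%E.
Proof.
elim: d w => [|d IH] w AB w0 cov.
  have := cov A; rewrite big_ord0 => /(_ _)/le_trans; apply=> //.
  by apply: lee_nneseries => k _; rewrite ?lee_fin ?big_ord0 ?mulr1.
have P0 k : 0 <= \prod_(i < d) Num.max (V k i - U k i) 0.
  by apply: prodr_ge0 => i _; rewrite le_max lexx orbT.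
rewrite big_ord_recr/=.
have ext t : t \in `[A d, B d[ -> ((\prod_(i < d) (B i - A i))%:E <=
    \sum_(k <oo) (w k * \prod_(i < d) Num.max (V k i - U k i) 0 *
      (U k d <= t < V k d)%R%:R)%:E)%E.
  move=> tAB; under eq_eseriesr => k _ do rewrite mulrAC.
  apply: IH => //; first by move=> k; rewrite mulr_ge0.
  move=> x xAB; have := cov (fun i => if i == d then t else x i).
  move=> H; apply: (le_trans (H _)) => [i|].
    rewrite ltnS leq_eqVlt; case: eqP => [-> _|_ /= /xAB//].
    by move: tAB; rewrite in_itv.
  apply: lee_nneseries => k _.
    by rewrite lee_fin mulr_ge0// prodr_ge0.
  rewrite lee_fin big_ord_recr/= eqxx mulrA mulrAC le_eqVlt; apply/orP; left; apply/eqP.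
  congr (_ * _ * _); apply: eq_bigr => i _.
  by rewrite ltn_eqF.
have -> : (\prod_(i < d) (B i - A i) * (B d - A d))%:E =
    (\int[lebesgue_measure]_(t in `[A d, B d[) (\prod_(i < d) (B i - A i))%:E)%E.
  have AdBd : lebesgue_measure (`[A d, B d[%classic : set R) = (B d - A d)%:E.
    rewrite lebesgue_measure_itv/= lte_fin.
    case: ltP => [//|BA]; have -> : B d = A d by apply/eqP; rewrite eq_le BA AB.
    by rewrite subrr.
  by rewrite integral_cst// EFinM; congr (_ * _)%E; exact/esym.
apply: (@le_trans _ _ (\int[lebesgue_measure]_(t in `[A d, B d[)
   \sum_(k <oo) (w k * \prod_(i < d) Num.max (V k i - U k i) 0 *
      (U k d <= (t : R) < V k d)%R%:R)%:E)%E).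
  apply: ge0_le_integral => //.
  - by move=> t _; rewrite lee_fin prodr_ge0// => i _; rewrite subr_ge0.
  apply: ge0_emeasurable_sum => // [k t _ _|k _].
    by rewrite lee_fin !mulr_ge0.
  exact: measurable_itvco_indicator.
rewrite integral_nneseries//; last 2 first.
- by move=> k; exact: measurable_itvco_indicator.
- by move=> k t _; rewrite lee_fin !mulr_ge0.
apply: lee_nneseries => k _.
  by move=> _; apply: integral_ge0 => t _; rewrite lee_fin !mulr_ge0.
rewrite big_ord_recr/= mulrA; apply: integral_scaled_itv_le.
by rewrite mulr_ge0.
Qed.

Section boxes.
Context {R : realType} {n : nat}.
Local Notation mu := (@spacetime_lebesgue R n).
Implicit Types (a b : spacetime R n) (X : set (spacetime R n)).

Lemma box_volume_ge0 a b : 0 <= box_volume a b.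
Proof.
rewrite mulr_ge0 //; last by rewrite le_max lexx orbT.
by apply: prodr_ge0 => i _; rewrite le_max lexx orbT.
Qed.

Definition upd (v : 'rV[R]_n) (i : 'I_n) (c : R) : 'rV[R]_n :=
  \row_j (if j == i then c else v 0 j).

Lemma updE v i c j : upd v i c 0 j = if j == i then c else v 0 j.
Proof. by rewrite mxE. Qed.

Lemma box_volume_cut_space a b i c :
  box_volume a (upd b.1 i (Num.min (b.1 0 i) c), b.2) +
  box_volume (upd a.1 i (Num.max (a.1 0 i) c), a.2) b = box_volume a b.
Proof.
rewrite /box_volume/= -mulrDl; congr (_ * _).
rewrite (bigD1 i)//= [X in _ + X](bigD1 i)//= [RHS](bigD1 i)//=.
rewrite !updE eqxx.
under eq_bigr => j /negbTE ji do rewrite updE ji.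
under [in X in _ + X]eq_bigr => j /negbTE ji do rewrite updE ji.
rewrite -mulrDl; congr (_ * _); rewrite /Num.max /Num.min.
by repeat case: ifPn; rewrite -?leNgt => *; lra.
Qed.

Lemma box_volume_cut_time a b c :
  box_volume a (b.1, Num.min b.2 c) + box_volume (a.1, Num.max a.2 c) b =
  box_volume a b.
Proof.
rewrite /box_volume/= -mulrDr; congr (_ * _); rewrite /Num.max /Num.min.
by repeat case: ifPn; rewrite -?leNgt => *; lra.
Qed.

(** Caratheodory's criterion is tested on covers: once [X] splits every box into pieces that lie in
    two boxes of the same total volume, a cover of a test set yields covers of both of its parts at
    no extra cost. *)
Lemma measurable_box_splitter X (B1 B2 : spacetime R n * spacetime R n ->
    spacetime R n * spacetime R n) :
  (forall c, box c.1 c.2 `&` X `<=` box (B1 c).1 (B1 c).2) ->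
  (forall c, box c.1 c.2 `&` ~` X `<=` box (B2 c).1 (B2 c).2) ->
  (forall c, box_volume (B1 c).1 (B1 c).2 + box_volume (B2 c).1 (B2 c).2 =
     box_volume c.1 c.2) ->
  measurable X.
Proof.
move=> B1P B2P BV; apply: le_caratheodory_measurable => Y /=.
apply: le_ereal_inf_tmp => _ [u Yu <-].
have -> : (\sum_(k <oo) (box_volume (u k).1 (u k).2)%:E =
   \sum_(k <oo) (box_volume (B1 (u k)).1 (B1 (u k)).2)%:E +
   \sum_(k <oo) (box_volume (B2 (u k)).1 (B2 (u k)).2)%:E)%E.
  rewrite -nneseriesD; last 2 first.
  - by move=> k _ _; rewrite lee_fin box_volume_ge0.
  - by move=> k _ _; rewrite lee_fin box_volume_ge0.
  by apply: eq_eseriesr => k _; rewrite -EFinD BV.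
apply: leeD; apply: ereal_inf_lbound.
- exists (B1 \o u) => // z [/Yu [k _ zk] Xz].
  by exists k => //; apply: B1P.
- exists (B2 \o u) => // z [/Yu [k _ zk] Xz].
  by exists k => //; apply: B2P.
Qed.

Lemma measurable_spacelt (i : 'I_n) (c : R) :
  measurable [set z : spacetime R n | z.1 0 i < c].
Proof.
apply: (@measurable_box_splitter _
  (fun u => (u.1, (upd u.2.1 i (Num.min (u.2.1 0 i) c), u.2.2)))
  (fun u => ((upd u.1.1 i (Num.max (u.1.1 0 i) c), u.1.2), u.2))).
- move=> [u v] z [[zuv tz] /= zc]; split=> //= j; rewrite updE.
  have /andP[-> /=] := zuv j; case: eqP => // -> zv.
  by rewrite lt_min zc zv.
- move=> [u v] z [[zuv tz] /= /negP]; rewrite -leNgt => zc; split=> //= j; rewrite updE.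
  have /andP[+ ->] := zuv j; rewrite andbT; case: eqP => // -> zv.
  by rewrite ge_max zc zv.
- by move=> [u v]; exact: box_volume_cut_space.
Qed.

Lemma measurable_timelt (c : R) :
  measurable [set z : spacetime R n | z.2 < c].
Proof.
apply: (@measurable_box_splitter _
  (fun u => (u.1, (u.2.1, Num.min u.2.2 c)))
  (fun u => ((u.1.1, Num.max u.1.2 c), u.2))).
- by move=> [u v] z [[zuv /andP[zu zv]] /= zc]; split=> //=; rewrite lt_min zu zc zv.
- move=> [u v] z [[zuv /andP[zu zv]] /= /negP]; rewrite -leNgt => zc; split=> //=.
  by rewrite ge_max zu zc zv.
- by move=> [u v]; exact: box_volume_cut_time.
Qed.

Lemma measurable_box a b : measurable (box a b).
Proof.
rewrite (_ : box a b =
  (\bigcap_(i in [set: 'I_n]) ([set z : spacetime R n | z.1 0 i < b.1 0 i] `\`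
     [set z : spacetime R n | z.1 0 i < a.1 0 i])) `&`
  ([set z : spacetime R n | z.2 < b.2] `\` [set z : spacetime R n | z.2 < a.2])).
  apply: measurableI; last by apply: measurableD; exact: measurable_timelt.
  apply: fin_bigcap_measurable => // i _.
  by apply: measurableD; exact: measurable_spacelt.
apply/seteqP; split => z.
  move=> [zi /andP[az zb]]; split.
    move=> i _ /=; have /andP[? ?] := zi i; split=> //.
    by apply/negP; rewrite -leNgt.
  by split => //=; apply/negP; rewrite -leNgt.
move=> [zi [/= zb /negP]]; rewrite -leNgt => az; split; last by rewrite az.
by move=> i; have [/= -> /negP] := zi i I; rewrite -leNgt => ->.
Qed.

Lemma mu_box a b : mu (box a b) = (box_volume a b)%:E.
Proof.
apply/eqP; rewrite eq_le; apply/andP; split.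
  apply: ereal_inf_lbound; exists (fun k => if k is 0%N then (a, b) else (a, a)).
    by move=> z abz; exists 0%N.
  rewrite (nneseries_split 0 1)//; last first.
    by move=> k _; rewrite lee_fin box_volume_ge0.
  rewrite eseries0; last first.
    case=> // k _ _ /=; rewrite /box_volume subrr maxxx mulr0//.
  by rewrite big_nat1 adde0.
apply: le_ereal_inf_tmp => _ [u bu <-].
(* Space and time are merged into [n.+1] coordinates numbered by [nat], as the induction on the
   dimension requires; time is the value at [n] and at every larger index. *)
pose co (v : spacetime R n) (i : nat) : R :=
  if insub i is Some j then v.1 0 j else v.2.
have coS v (i : 'I_n) : co v i = v.1 0 i by rewrite /co insubT// => ?; congr (v.1 0 _); exact: val_inj.
have coT v : co v n = v.2 by rewrite /co insubF ?ltnn.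
have [ab|nab] := pselect (forall i, co a i <= co b i); last first.
  suff -> : box_volume a b = 0.
    by apply: nneseries_ge0 => k _ _; rewrite lee_fin box_volume_ge0.
  apply/eqP; move/existsNP: nab => [i /negP]; rewrite -ltNge.
  rewrite /co /box_volume; case: insubP => [j _ _ ba|_ ba].
    by rewrite (bigD1 j)//= max_r ?mul0r// subr_le0 ltW.
  by rewrite [X in _ * X]max_r ?mulr0// subr_le0 ltW.
have volE v w : box_volume v w = \prod_(i < n.+1) Num.max (co w i - co v i) 0.
  rewrite big_ord_recr/= !coT; congr (_ * _); apply: eq_bigr => i _.
  by rewrite !coS.
have -> : box_volume a b = \prod_(i < n.+1) (co b i - co a i).
  by rewrite volE; apply: eq_bigr => i _; rewrite max_l// subr_ge0.
under eq_eseriesr => k _ do rewrite volE -[\prod_(_ < _) _]mul1r.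
apply: (@volume_le_weighted_cover R n.+1 (co a) (co b) (fun=> 1)
  (fun k => co (u k).1) (fun k => co (u k).2)) => //.
move=> x xab; pose z : spacetime R n := (\row_i x i, x n).
have : box a b z.
  split=> [i|]; last by have := xab n; rewrite !coT; apply.
  by have := xab i; rewrite !coS mxE; apply; rewrite ltnS ltnW.
move=> /bu[k _ [zk tk]].
rewrite (nneseries_split 0 k.+1); last by move=> j _; rewrite lee_fin mul1r prodr_ge0.
rewrite add0n big_nat_recr//= [X in (_ + X + _)%E](_ : _ = 1%E).
  apply: (@le_trans _ _ (0 + 1 + 0)%E); first by rewrite add0e adde0.
  apply: leeD; last first.
    by apply: nneseries_ge0 => j _ _; rewrite lee_fin mul1r prodr_ge0.
  by apply: leeD => //; apply: sume_ge0 => j _; rewrite lee_fin mul1r prodr_ge0.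
congr EFin; rewrite mul1r big_ord_recr/= !coT tk mulr1 big1// => i _.
by rewrite !coS; have := zk i; rewrite mxE => ->.
Qed.

End boxes.

(** * Integrals over boxes *)

Section box_integrals.
Context {R : realType} {n : nat}.
Local Notation mu := (@spacetime_lebesgue R n).
Implicit Types (f g : spacetime R n -> R) (a b v : 'rV[R]_n) (s e : R).

Definition box_integral f a s b e : R := \int[mu]_(z in box (a, s) (b, e)) f z.

Lemma integrable_box f (a b : spacetime R n) : L1loc f -> mu.-integrable (box a b) (EFin \o f).
Proof.
move=> [mf fK].
pose K : set (spacetime R n) :=
  [set v : 'rV[R]_n | forall i, `[a.1 0 i, b.1 0 i]%classic (v 0 i)] `*` `[a.2, b.2]%classic.
have cK : compact K.
  apply: compact_setX; last exact: segment_compact.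
  by apply: (@rV_compact R n (fun i => `[a.1 0 i, b.1 0 i]%classic)) => i; exact: segment_compact.
(* Closed half-spaces are obtained as countable intersections of the open ones bounded by
   [b + 1 / k.+1]. *)
have mK : measurable K.
  rewrite (_ : K =
    (\bigcap_(i in [set: 'I_n]) (~` [set z : spacetime R n | z.1 0 i < a.1 0 i] `&`
       \bigcap_(k in [set: nat]) [set z : spacetime R n | z.1 0 i < b.1 0 i + k.+1%:R^-1])) `&`
    (~` [set z : spacetime R n | z.2 < a.2] `&`
       \bigcap_(k in [set: nat]) [set z : spacetime R n | z.2 < b.2 + k.+1%:R^-1])).
    apply: measurableI; last first.
      apply: measurableI; first by apply: measurableC; exact: measurable_timelt.
      by apply: bigcap_measurable => // k _; exact: measurable_timelt.
    apply: fin_bigcap_measurable => // i _.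
    apply: measurableI; first by apply: measurableC; exact: measurable_spacelt.
    by apply: bigcap_measurable => // k _; exact: measurable_spacelt.
  have lim (x y : R) : (forall k : nat, x < y + k.+1%:R^-1) -> x <= y.
    move=> H; rewrite leNgt; apply/negP => xy.
    have /= := H (Num.truncn (x - y)^-1); apply/negP; rewrite -leNgt -lerBrDl.
    rewrite -[leRHS]invrK lef_pV2 ?posrE ?invr_gt0 ?subr_gt0//.
    by rewrite ltW// truncnS_gt.
  apply/seteqP; split => z /=.
    move=> [zi]; rewrite /= in_itv/= => /andP[az zb]; split.
      move=> i _; have := zi i; rewrite /= in_itv/= => /andP[az' zb']; split => /=.
        by apply/negP; rewrite -leNgt.
      by move=> k _ /=; rewrite (le_lt_trans zb')// ltrDl.
    split => /=; first by apply/negP; rewrite -leNgt.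
    by move=> k _ /=; rewrite (le_lt_trans zb)// ltrDl.
  move=> [zi [/negP]]; rewrite -leNgt => az zb; split; last first.
    by rewrite /= in_itv/= az/= lim// => k; exact: zb.
  move=> i; have [/negP] := zi i I; rewrite -leNgt => azi zbi.
  by rewrite /= in_itv/= azi/= lim// => k; exact: zbi.
apply: integrableS (fK _ cK) => //; first exact: measurable_box.
move=> z [zi /andP[az zb]]; split; last by rewrite /= in_itv/= az ltW.
by move=> i; have /andP[? ?] := zi i; rewrite /= in_itv/=; apply/andP; split=> //; exact: ltW.
Qed.

Lemma box_split_space a s b e i c : a 0 i <= c <= b 0 i ->
  (box (a, s) (b, e) =
    (box (a, s) (upd b i c, e) `|` box (upd a i c, s) (b, e)) :> set (spacetime R n)) /\
  [disjoint box (a, s) (upd b i c, e) & (box (upd a i c, s) (b, e) : set (spacetime R n))].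
Proof.
move=> /andP[ac cb]; split; last first.
  rewrite disj_set2E; apply/eqP; rewrite -subset0 => z [[/(_ i)/= + _] [/(_ i)/= + _]].
  by rewrite !updE eqxx => /andP[_ h1] /andP[h2 _]; have := lt_le_trans h1 h2; rewrite ltxx.
apply/seteqP; split => z.
  move=> [zi tz]; have [zc|zc] := ltP (z.1 0 i) c; [left|right].
    split => // j /=; rewrite updE; have /andP[-> h] := zi j.
    by case: eqP => [->|_] //=; rewrite zc.
  split => // j /=; rewrite updE; have /andP[h ->] := zi j; rewrite andbT.
  by case: eqP => [->|_].
move=> [] [zi tz]; split => // j; have := zi j; rewrite /= updE; case: eqP => // -> /andP[h1 h2].
  by rewrite h1 (lt_le_trans h2).
by rewrite h2 (le_trans _ h1).
Qed.

Lemma box_split_time a s b e c : s <= c <= e ->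
  (box (a, s) (b, e) = (box (a, s) (b, c) `|` box (a, c) (b, e)) :> set (spacetime R n)) /\
  [disjoint box (a, s) (b, c) & (box (a, c) (b, e) : set (spacetime R n))].
Proof.
move=> /andP[ac cb]; split; last first.
  rewrite disj_set2E; apply/eqP; rewrite -subset0 => z [[_ /=/andP[_ h1]] [_ /=/andP[h2 _]]].
  by have := lt_le_trans h1 h2; rewrite ltxx.
apply/seteqP; split => z.
  move=> [zi /=/andP[h1 h2]]; have [zc|zc] := ltP z.2 c; [left|right].
    by split => //=; rewrite h1.
  by split => //=; rewrite zc.
move=> [] [zi /=/andP[h1 h2]]; split => //=.
  by rewrite h1 (lt_le_trans h2).
by rewrite h2 (le_trans _ h1).
Qed.

Lemma box_integral_cut_space f a s b e i c : L1loc f -> a 0 i <= c <= b 0 i ->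
  box_integral f a s b e =
  box_integral f a s (upd b i c) e + box_integral f (upd a i c) s b e.
Proof.
move=> fL /(box_split_space a s b e)[E D]; rewrite /box_integral E Rintegral_setU//.
- exact: measurable_box.
- exact: measurable_box.
- by rewrite -E; exact: integrable_box.
Qed.

Lemma box_integral_cut_time f a s b e c : L1loc f -> s <= c <= e ->
  box_integral f a s b e = box_integral f a s b c + box_integral f a c b e.
Proof.
move=> fL /(box_split_time a s b)[E D]; rewrite /box_integral E Rintegral_setU//.
- exact: measurable_box.
- exact: measurable_box.
- by rewrite -E; exact: integrable_box.
Qed.

Lemma L1loc_norm f : L1loc f -> L1loc (fun z => `|f z|).
Proof.
move=> [mf fK]; split; first exact: measurableT_comp.
by move=> K /fK; exact: integrable_norm.
Qed.

(** Absolute continuity in time: by monotone convergence for [|f|] on the boxes ending at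
    [e - (e - s) / k.+1], the integral of [|f|] over some top slab is at most [eps], and thinner
    slabs lie in it. *)
Lemma box_integral_thin f a s b e (eps : R) : L1loc f -> s < e -> 0 < eps ->
  exists2 d, 0 < d & forall y, s <= y <= e -> e - y <= d -> `|box_integral f a y b e| <= eps.
Proof.
move=> fL se eps0; have gL := L1loc_norm _ fL.
pose g : spacetime R n -> R := fun z => `|f z|; pose F (k : nat) : set (spacetime R n) := box (a, s) (b, e - (e - s) / k.+1%:R).
have es0 : 0 < e - s by rewrite subr_gt0.
have FU : \bigcup_k F k = box (a, s) (b, e).
  apply/seteqP; split => z.
    move=> [k _ [zi /=/andP[h1 h2]]]; split => //=; rewrite h1 (lt_le_trans h2)//.
    by rewrite lerBlDr lerDl divr_ge0// ltW.
  move=> [zi /=/andP[h1 h2]]; have ez : 0 < e - z.2 by rewrite subr_gt0.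
  exists (Num.truncn ((e - s) / (e - z.2))) => //; split => //=; rewrite h1/=.
  rewrite ltrBrDl -ltrBrDr ltr_pdivrMr// mulrC -ltr_pdivrMr//.
  exact: truncnS_gt.
have mono : nondecreasing_seq F.
  move=> k l kl; rewrite subsetEset => z [zi /=/andP[h1 h2]]; split => //=.
  rewrite h1 (lt_le_trans h2)// lerD2l lerN2 ler_wpM2l ?(ltW es0)//.
  by rewrite lef_pV2 ?posrE// ler_nat.
have cv := @ge0_nondecreasing_set_cvg_integral _ _ _ F (EFin \o g) mu mono
  (fun k => measurable_box _ _).
have cvF : (fun k => \int[mu]_(z in F k) (g z)%:E)%E @ \oo -->
    (\int[mu]_(z in box (a, s) (b, e)) (g z)%:E)%E.
  rewrite -FU; apply: cv => [k|k z _]; last by rewrite lee_fin normr_ge0.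
  by apply: (measurable_int mu); exact: (integrable_box g _ _ gL).
have fn (c d : spacetime R n) : (\int[mu]_(z in box c d) (g z)%:E)%E \is a fin_num.
  by apply: integrable_fin_num; [exact: measurable_box|]; exact: (integrable_box g c d gL).
move: cvF; rewrite -(fineK (fn _ _)) => /fine_cvgP[_ /cvgrPdist_le /(_ _ eps0)].
move=> [k _ /(_ k (leqnn _))/=]; rewrite -/(Rintegral _ _ _) -/(Rintegral _ _ _) => kP.
exists ((e - s) / k.+1%:R); first by rewrite divr_gt0.
move=> y /andP[sy ye] yd.
have le_y : e - (e - s) / k.+1%:R <= y by rewrite lerBlDr -lerBlDl.
have s_le : s <= e - (e - s) / k.+1%:R.
  by rewrite lerBrDl -lerBrDr ler_pdivrMr// ler_peMr ?(ltW es0) ?ler1n//.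
apply: (le_trans (le_normr_Rintegral _ _)); first exact: measurable_box.
  exact: integrable_box.
apply: le_trans kP; rewrite -/(box_integral g a y b e).
have -> : \int[mu]_(z in box (a, s) (b, e)) g z = box_integral g a s b e by [].
have -> : \int[mu]_(z in F k) g z = box_integral g a s b (e - (e - s) / k.+1%:R) by [].
rewrite (@box_integral_cut_time g a s b e (e - (e - s) / k.+1%:R))//; last first.
  by rewrite s_le (le_trans le_y).
rewrite addrC addKr.
rewrite (@box_integral_cut_time g a (e - (e - s) / k.+1%:R) b e y)//; last by rewrite le_y.
by rewrite ger0_norm ?addr_ge0 ?lerDr// ?Rintegral_ge0// => *; rewrite normr_ge0.
Qed.

End box_integrals.

(** * Mixing along a chain of cells *)

Section chain.
Context {R : realType}.
(** [W j t] stands for the mean over the [j]-th of adjacent cells after [t] steps, and [K] for the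
    cost of a step. Mass means the weights with which later means bound an earlier one. *)
Variables (W : nat -> nat -> R) (K : R) (m r : nat).
Hypothesis K0 : 0 <= K.
Hypothesis stay : forall j t, W j t <= W j t.+1 + K.
Hypothesis right : forall j t, W j t <= 3 / 4 * W j t.+1 + 1 / 4 * W j.+1 t.+1 + K.
Hypothesis left : forall j t, W j.+1 t <= 3 / 4 * W j.+1 t.+1 + 1 / 4 * W j t.+1 + K.
Hypothesis rm : (3 / 4) ^+ r <= m%:R^-1 :> R.

Lemma chain_stay j t q : W j t <= W j (t + q)%N + q%:R * K.
Proof.
elim: q => [|q IH]; first by rewrite addn0 mul0r addr0.
rewrite addnS; have := stay j (t + q)%N; rewrite -natr1; lra.
Qed.

(* Repeating the elementary step, and using only a part of the last one, any
   proportion of the mass at [i] can be moved to [j]. *)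
Lemma chain_split (i j : nat) (b : R) t q :
  (forall t, W i t <= 3 / 4 * W i t.+1 + 1 / 4 * W j t.+1 + K) ->
  (forall t, W j t <= W j t.+1 + K) ->
  (3 / 4) ^+ q <= b <= 1 ->
  W i t <= b * W i (t + q)%N + (1 - b) * W j (t + q)%N + q%:R * K.
Proof.
move=> step stayj; elim: q b => [|q IH] b.
  rewrite expr0 => /andP[b1 b2]; have -> : b = 1 by lra.
  by rewrite addn0 subrr !mul0r mul1r !addr0.
rewrite exprS => /andP[qb b1].
have q1 : (3 / 4 : R) ^+ q <= 1 by rewrite exprn_ile1//; lra.
have q0 : (0 : R) < (3 / 4) ^+ q by rewrite exprn_gt0//; lra.
rewrite addnS -natr1.
set s := (t + q)%N.
have st := step s; have sti := stay i s; have stj := stayj s.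
have [qb'|bq] := leP ((3 / 4) ^+ q) b.
  have := IH b; rewrite qb' b1 => /(_ isT).
  have : b * W i s <= b * (W i s.+1 + K) by rewrite ler_wpM2l//; lra.
  have : (1 - b) * W j s <= (1 - b) * (W j s.+1 + K) by rewrite ler_wpM2l//; lra.
  rewrite -/s; lra.
pose c := (3 / 4 : R) ^+ q.
have := IH c; rewrite lexx q1 -/s => /(_ isT) IHc.
(* The portion of the last step to be used: [al] solves [c * (1 - al / 4) = b], and [al <= 1]
   because [3 / 4 * c <= b]. *)
pose al := 4 * (c - b) / c.
have al0 : 0 <= al by rewrite divr_ge0// ?ltW// -/c in q0 *; rewrite /c; lra.
have al1 : al <= 1 by rewrite ler_pdivrMr// mul1r /c; lra.
have cal : c * al = 4 * (c - b) by rewrite mulrC divfK// gt_eqF.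
have h1 : W i s <= (1 - al) * (W i s.+1 + K) + al * (3 / 4 * W i s.+1 + 1 / 4 * W j s.+1 + K).
  have -> : W i s = (1 - al) * W i s + al * W i s by lra.
  by rewrite lerD// ler_wpM2l//; lra.
have h2 : c * W i s <= c * (W i s.+1 + K) - c * al * (1 / 4) * W i s.+1 + c * al * (1 / 4) * W j s.+1.
  by rewrite (le_trans (ler_wpM2l (ltW q0) h1))// -/c; lra.
have : (1 - c) * W j s <= (1 - c) * (W j s.+1 + K) by rewrite ler_wpM2l// /c; lra.
move: h2; rewrite cal; lra.
Qed.

Lemma chain_inverse_ge q : (0 < q <= m)%N -> (3 / 4) ^+ r <= q%:R^-1 :> R.
Proof.
move=> /andP[q0 qm]; apply: (le_trans rm).
by rewrite lef_pV2 ?posrE ?ltr0n ?ler_nat// (leq_trans q0).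
Qed.

(** Keep the share [1 / q.+2] at [j], pass the rest to [j.+1] and spread it from there. Every split
    takes [r] steps, since all shares kept are at least [1 / m]. *)
Lemma chain_right j t q : (q < m)%N ->
  W j t <= q.+1%:R^-1 * (\sum_(i < q.+1) W (j + i)%N (t + r * q)%N) + (r * q)%:R * K.
Proof.
elim: q j t => [|q IH] j t qm.
  by rewrite big_ord_recl big_ord0 muln0 !addn0 invr1 mul1r mul0r !addr0.
have q20 : (0 : R) < q.+2%:R by rewrite ltr0n.
have q10 : (0 : R) < q.+1%:R by rewrite ltr0n.
have b1 : ((3 / 4) ^+ r <= q.+2%:R^-1 :> R) && (q.+2%:R^-1 <= 1 :> R).
  by apply/andP; split; [apply: chain_inverse_ge|rewrite invf_le1 ?ler1n ?ltr0n].
have := @chain_split j j.+1 _ t r (right j) (stay j.+1) b1.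
have := chain_stay j (t + r) (r * q).
have := IH j.+1 (t + r)%N (ltnW qm).
rewrite -addnA -mulnS => h1 h2 h3.
rewrite big_ord_recl addn0.
under eq_bigr => i _ do rewrite lift0 addnS -addSn.
set S := \sum_(i < q.+1) _ in h1 *.
have b0 : 0 <= 1 - q.+2%:R^-1 :> R by rewrite subr_ge0; case/andP: b1.
have := ler_wpM2l (x := q.+2%:R^-1) _ h2; rewrite invr_ge0 ltW// => /(_ isT) h2'.
have h1' := ler_wpM2l b0 h1.
have e1 : (1 - q.+2%:R^-1) * (q.+1%:R^-1 * S) = q.+2%:R^-1 * S.
  by rewrite mulrA; congr (_ * _); rewrite -[q.+2%:R]natr1; field; rewrite !gt_eqF//=; lra.
have e2 : (r * q.+1)%:R = r%:R + (r * q)%:R :> R by rewrite mulnS natrD.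
move: h1'; rewrite mulrDr e1 => h1'.
rewrite e2; move: h3 h2' h1'; move: (q.+2%:R^-1) (r * q)%:R => b c; lra.
Qed.

Lemma chain_left j t q : (q < m)%N -> (q <= j)%N ->
  W j t <= q.+1%:R^-1 * (\sum_(i < q.+1) W (j - i)%N (t + r * q)%N) + (r * q)%:R * K.
Proof.
elim: q j t => [|q IH] j t qm qj.
  by rewrite big_ord_recl big_ord0 muln0 subn0 addn0 invr1 mul1r mul0r !addr0.
case: j qj => // j; rewrite ltnS => qj.
have q20 : (0 : R) < q.+2%:R by rewrite ltr0n.
have q10 : (0 : R) < q.+1%:R by rewrite ltr0n.
have b1 : ((3 / 4) ^+ r <= q.+2%:R^-1 :> R) && (q.+2%:R^-1 <= 1 :> R).
  by apply/andP; split; [apply: chain_inverse_ge|rewrite invf_le1 ?ler1n ?ltr0n].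
have := @chain_split j.+1 j _ t r (left j) (stay j) b1.
have := chain_stay j.+1 (t + r) (r * q).
have := IH j (t + r)%N (ltnW qm) qj.
rewrite -addnA -mulnS => h1 h2 h3.
rewrite big_ord_recl subn0.
under eq_bigr => i _ do rewrite lift0 subSS.
set S := \sum_(i < q.+1) _ in h1 *.
have b0 : 0 <= 1 - q.+2%:R^-1 :> R by rewrite subr_ge0; case/andP: b1.
have := ler_wpM2l (x := q.+2%:R^-1) _ h2; rewrite invr_ge0 ltW// => /(_ isT) h2'.
have h1' := ler_wpM2l b0 h1.
have e1 : (1 - q.+2%:R^-1) * (q.+1%:R^-1 * S) = q.+2%:R^-1 * S.
  by rewrite mulrA; congr (_ * _); rewrite -[q.+2%:R]natr1; field; rewrite !gt_eqF//=; lra.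
have e2 : (r * q.+1)%:R = r%:R + (r * q)%:R :> R by rewrite mulnS natrD.
move: h1'; rewrite mulrDr e1 => h1'.
rewrite e2; move: h3 h2' h1'; move: (q.+2%:R^-1) (r * q)%:R => b c; lra.
Qed.

Lemma average_stay (j : nat -> nat) q t s :
  q.+1%:R^-1 * (\sum_(i < q.+1) W (j i) t) <=
  q.+1%:R^-1 * (\sum_(i < q.+1) W (j i) (t + s)%N) + s%:R * K.
Proof.
have q0 : (0 : R) < q.+1%:R by rewrite ltr0n.
rewrite -(ler_pM2l q0) mulrDr !mulrA divff ?gt_eqF// !mul1r.
apply: (le_trans (y := \sum_(i < q.+1) (W (j i) (t + s)%N + s%:R * K))).
  by apply: ler_sum => i _; exact: chain_stay.
by rewrite big_split/= sumr_const card_ord -[X in _ + X]mulr_natl mulrA.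
Qed.

(** Waiting until the common time [r * m] allows spreads of different widths to be added. *)
Lemma chain_right_until j t q : (q < m)%N ->
  W j t <= q.+1%:R^-1 * (\sum_(i < q.+1) W (j + i)%N (t + r * m)%N) + (r * m)%:R * K.
Proof.
move=> qm; have h := chain_right j t q qm.
have := average_stay (addn j) q (t + r * q) (r * (m - q)).
rewrite -addnA -mulnDr (subnKC (ltnW qm)).
have -> : (r * m)%:R = (r * q)%:R + (r * (m - q))%:R :> R.
  by rewrite -natrD -mulnDr (subnKC (ltnW qm)).
move: h; move: (q.+1%:R^-1) => b; lra.
Qed.

Lemma chain_left_until j t q : (q < m)%N -> (q <= j)%N ->
  W j t <= q.+1%:R^-1 * (\sum_(i < q.+1) W (j - i)%N (t + r * m)%N) + (r * m)%:R * K.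
Proof.
move=> qm qj; have h := chain_left j t q qm qj.
have := average_stay (subn j) q (t + r * q) (r * (m - q)).
rewrite -addnA -mulnDr (subnKC (ltnW qm)).
have -> : (r * m)%:R = (r * q)%:R + (r * (m - q))%:R :> R.
  by rewrite -natrD -mulnDr (subnKC (ltnW qm)).
move: h; move: (q.+1%:R^-1) => b; lra.
Qed.

Lemma chain_mix j t : (j < m)%N ->
  W j t <= m%:R^-1 * (\sum_(y < m) W y (t + (r + r * m))%N) + (r + r * m)%:R * K.
Proof.
move=> jm; have m0 : (0 < m)%N by apply: leq_ltn_trans jm.
have m0R : (0 : R) < m%:R by rewrite ltr0n.
rewrite addnA natrD.
case: j => [|j] in jm *.
  have h1 := chain_stay 0 t r.
  have := chain_right_until 0 (t + r) m.-1; rewrite prednK// => /(_ (leqnn _)).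
  under eq_bigr => i _ do rewrite add0n.
  by move: h1; move: (m%:R^-1) => mi; lra.
(* The share [b], due to the [m - j.+1] cells from [j.+1] on, stays and is spread to the right; the
   rest goes to [j] and is spread to the left over [j.+1] cells. Every cell ends up with weight
   [1 / m]. *)
set b : R := 1 - j.+1%:R / m%:R.
have bE : b = (m - j.+1)%:R / m%:R.
  by rewrite /b natrB 1?ltnW// mulrBl divff ?gt_eqF.
have b1 : ((3 / 4) ^+ r <= b) && (b <= 1).
  apply/andP; split; last by rewrite gerBl divr_ge0.
  by apply: (le_trans rm); rewrite bE -[leLHS]mul1r ler_wpM2r ?invr_ge0// ler1n subn_gt0.
have h1 := @chain_split j.+1 j b t r (left j) (stay j) b1.
have jm2 : (m - j.+2 < m)%N by lia.
have := @chain_right_until j.+1 (t + r) (m - j.+2) jm2.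
have -> : ((m - j.+2).+1 = m - j.+1)%N by lia.
have := @chain_left_until j (t + r) j (ltnW jm) (leqnn _).
set S1 := \sum_(i < j.+1) _; set S2 := \sum_(i < m - j.+1) _; set S := \sum_(y < m) _.
have -> : S = S1 + S2.
  rewrite /S -(big_mkord xpredT (fun y => W y (t + r + r * m)%N)).
  rewrite (@big_cat_nat _ _ _ j.+1)//=; last exact: ltnW.
  congr (_ + _).
    rewrite big_mkord /S1 (reindex_inj rev_ord_inj)/=.
    by apply: eq_bigr => i _; rewrite subSS.
  rewrite /S2 -{1}[j.+1]add0n big_addn big_mkord.
  by apply: eq_bigr => i _; rewrite addnC.
move=> h2 h3.
have b0 : 0 <= b by rewrite bE divr_ge0.
have b10 : 0 <= 1 - b by rewrite subr_ge0; case/andP: b1.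
have j0 : (j.+1%:R : R) != 0 by rewrite pnatr_eq0.
have mj0 : ((m - j.+1)%:R : R) != 0 by rewrite pnatr_eq0 subn_eq0 -ltnNge.
have e1 : b * ((m - j.+1)%:R^-1 * S2) = m%:R^-1 * S2.
  by rewrite mulrA bE; congr (_ * _); rewrite mulrAC divff// mul1r.
have e2 : (1 - b) * (j.+1%:R^-1 * S1) = m%:R^-1 * S1.
  by rewrite mulrA /b subKr; congr (_ * _); rewrite mulrAC divff// mul1r.
have := ler_wpM2l b0 h3; have := ler_wpM2l b10 h2.
rewrite !mulrDr e1 e2; move: h1; move: (m%:R^-1) => mi; lra.
Qed.

End chain.

(** * Mixing in time *)

Section time_mixing.
Context {R : realType}.
(** [G s e] will be the integral over the base cube times [[s, e)], divided by the volume of the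
    base, and [h k] the height of a lower part at level [k]. A slab of level [k + j0] together with
    its lag fits into one of level [k]; [P] bounds the quotient of the two heights, and [m] fine
    slabs fill even a slab of height [rho * h k]. *)
Variables (G : R -> R -> R) (h : nat -> R) (N kappa rho P : R) (j0 m : nat).
Hypothesis N0 : 0 <= N.
Hypothesis kappa1 : 1 <= kappa.
Hypothesis rho1 : 1 <= rho.
Hypothesis P0 : 0 <= P.
Hypothesis h0 : forall k, 0 < h k.
Hypothesis h_half : forall k, 2 * h k.+1 <= h k.
Hypothesis h_rho : forall k, h k <= rho * h k.+1.
Hypothesis h_fine : forall k, (kappa + 1) * h (k + j0)%N <= h k.
Hypothesis h_P : forall k, h k <= P * h (k + j0)%N.
Hypothesis h_m : forall k, rho * h k <= m%:R * h (k + j0)%N.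
Hypothesis G_cut : forall s c e, s <= c <= e -> G s e = G s c + G c e.
Hypothesis G_slab : forall k w s e, w <= s -> s <= e -> e <= w + h k ->
  G s e <= (e - s) / h k * G (w + kappa * h k) (w + kappa * h k + h k) + N * h k.
Hypothesis G_thin : forall s e eps, s < e -> 0 < eps ->
  exists2 d, 0 < d & forall y, s <= y <= e -> e - y <= d -> `|G y e| <= eps.

Definition window k z : R := G z (z + h k) / h k.

Lemma windowE k z : G z (z + h k) = h k * window k z.
Proof. by rewrite /window mulrC divfK// gt_eqF. Qed.

Lemma slab_le_window k w s e : w <= s -> s <= e -> e <= w + h k ->
  G s e <= (e - s) * window k (w + kappa * h k) + N * h k.
Proof.
move=> ws se ew; apply: (le_trans (G_slab k w s e ws se ew)).
by rewrite windowE mulrA divfK ?gt_eqF.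
Qed.

Lemma window_steps i z t : window i z <= window i (z + t%:R * (kappa * h i)) + t%:R * N.
Proof.
elim: t => [|t IH]; first by rewrite !mul0r !addr0.
set z' := z + t%:R * _ in IH.
have := slab_le_window i z' z' (z' + h i) (lexx _) _ (lexx _).
rewrite lerDl (ltW (h0 i)) windowE addrAC subrr add0r => /(_ isT).
rewrite [N * _]mulrC -mulrDr ler_pM2l// => st.
have -> : z + t.+1%:R * (kappa * h i) = z' + kappa * h i.
  by rewrite /z' -natr1; lra.
rewrite -natr1; lra.
Qed.

(** Fine steps of length [kappa * h i] overshoot [w] by at most one step, so by [h_fine] the fine
    window ends up inside [[w, w + h k)], and a single step of level [k] finishes. That step costs
    [N * h k], which is at most [P * N] relative to the fine height. *)
Lemma window_to_window k z w : z <= w ->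
  window (k + j0) z <= window k (w + kappa * h k) +
    ((w - z) / h (k + j0)%N + 1 + P) * N.
Proof.
move=> zw; set i := (k + j0)%N.
have hi := h0 i; have hk := h0 k.
have khi : 0 < kappa * h i by rewrite mulr_gt0// (lt_le_trans ltr01).
pose t := (Num.truncn ((w - z) / (kappa * h i))).+1.
have t1 : w - z < t%:R * (kappa * h i) by rewrite -ltr_pdivrMr// truncnS_gt.
have wz0 : 0 <= (w - z) / (kappa * h i) by rewrite divr_ge0 ?subr_ge0// ltW.
have t2' : t%:R <= (w - z) / (kappa * h i) + 1.
  by rewrite /t -natr1 lerD2r truncn_le.
have t2 : t%:R * (kappa * h i) <= w - z + kappa * h i.
  by have := ler_wpM2r (ltW khi) t2'; rewrite mulrDl divfK ?gt_eqF// mul1r.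
have t3 : t%:R <= (w - z) / h i + 1.
  apply: (le_trans t2'); rewrite lerD2r ler_wpM2l ?subr_ge0//.
  by rewrite lef_pV2 ?posrE// ler_peMl// ltW.
have st := window_steps i z t; set z' := z + t%:R * _ in st.
have wz' : w <= z' by rewrite /z'; lra.
have hf := h_fine k; rewrite -/i in hf.
have sl : G z' (z' + h i) <= (z' + h i - z') * window k (w + kappa * h k) + N * h k.
  by apply: slab_le_window => //; [rewrite lerDl ltW|rewrite /z'; lra].
rewrite windowE addrAC subrr add0r in sl.
have hP : h k <= P * h i by exact: h_P.
have NhP : N * h k <= h i * (P * N) by have := ler_wpM2l N0 hP; lra.
have : h i * window i z' <= h i * (window k (w + kappa * h k) + P * N).
  by rewrite mulrDr; lra.
rewrite ler_pM2l// => st2.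
have t3N := ler_wpM2r N0 t3; lra.
Qed.

Lemma uniform_slices a v q B : 0 <= v ->
  (forall z, a <= z -> z + v <= a + q%:R * v -> G z (z + v) <= B) ->
  G a (a + q%:R * v) <= q%:R * B.
Proof.
move=> v0; elim: q => [|q IH] H.
  have := @G_cut a a a; rewrite lexx => /(_ isT) E.
  by rewrite !mul0r addr0; lra.
have qv : q.+1%:R * v = q%:R * v + v by rewrite -natr1; lra.
have qv0 : 0 <= q%:R * v by rewrite mulr_ge0.
rewrite (@G_cut a (a + q%:R * v)); last by apply/andP; split; lra.
have -> : q.+1%:R * B = q%:R * B + B by rewrite -natr1; lra.
apply: lerD.
  by apply: IH => z az zv; apply: H => //; lra.
by rewrite qv addrA; apply: H; lra.
Qed.

(** [m] pays for cutting a slab into [m] slices, [X * P + 1] for the fine steps over a distance of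
    at most [X] coarse heights, and the last [P] for the closing coarse step. *)
Definition transport_cost (X : R) : R := m%:R + (X * P + 1 + P).

Lemma slab_to_window k a D y X : h k <= D <= rho * h k -> y - a <= X * h k ->
  a + D + kappa * h (k + j0)%N <= y - kappa * h k ->
  G a (a + D) <= D * (window k y + transport_cost X * N).
Proof.
move=> /andP[hD Drho] yX ady; set i := (k + j0)%N in ady *.
have hi := h0 i; have hk := h0 k; have D0 : 0 < D by lra.
have Dm : D <= m%:R * h i by apply: le_trans (h_m k).
have m0 : 0 < m%:R :> R.
  by rewrite ltNge; apply/negP => m0; have := mulr_le0_ge0 m0 (ltW hi); lra.
pose v := D / m%:R; have Dv : D = m%:R * v by rewrite mulrC divfK// gt_eqF.
have v0 : 0 <= v by rewrite divr_ge0// ltW.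
have vhi : v <= h i by rewrite ler_pdivrMr// mulrC.
have khi : 0 < kappa * h i by rewrite mulr_gt0// (lt_le_trans ltr01).
have khk : 0 < kappa * h k by rewrite mulr_gt0// (lt_le_trans ltr01).
rewrite {1}Dv.
apply: (le_trans (y := m%:R * (v * (window k y + (X * P + 1 + P) * N) + N * h i))).
  apply: uniform_slices => // z az; rewrite -Dv => zD.
  have := slab_le_window i z z (z + v) (lexx _) _ _.
  rewrite lerDl v0 lerD2l vhi => /(_ isT isT) h1.
  apply: (le_trans h1); rewrite lerD2r addrAC subrr add0r ler_wpM2l//.
  have := window_to_window k (z + kappa * h i) (y - kappa * h k) _.
  rewrite subrK -/i => /(_ _)/le_trans; apply; first by lra.
  rewrite lerD2l ler_wpM2r// lerD2r lerD2r ler_pdivrMr//.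
  have hP : h k <= P * h i by exact: h_P.
  have X0 : 0 <= X.
    rewrite leNgt; apply/negP => X0; have : X * h k < 0 by rewrite nmulr_rlt0.
    by lra.
  have := ler_wpM2l X0 hP; lra.
have := ler_wpM2l N0 (_ : h i <= D); have hiD : h i <= D.
  by have := h_fine k; rewrite -/i; lra.
move=> /(_ hiD) NhD.
have := ler_wpM2l (ltW m0) NhD.
rewrite /transport_cost [D in leRHS]Dv; rewrite {1}Dv; lra.
Qed.

Lemma h_pow k q : h (k + q)%N <= h k / 2 ^+ q.
Proof.
elim: q => [|q IH]; first by rewrite addn0 expr0 divr1.
rewrite addnS exprS invfM mulrCA; apply: (le_trans (y := 2^-1 * h (k + q)%N)).
  by have := h_half (k + q)%N; lra.
by rewrite ler_pM2l.
Qed.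

(** The time for a passage from level [k] to level [k.+1], in units of [h k.+1]: at most [rho] for
    the slab itself, at most [kappa] for a fine step, and [kappa] for the closing step. *)
Definition drift : R := rho + 2 * kappa.

Definition base_cost (X : R) : R := transport_cost X + transport_cost drift.

Lemma transport_cost_ge0 X : 0 <= X -> 0 <= transport_cost X.
Proof. by move=> X0; rewrite !addr_ge0// mulr_ge0. Qed.

(* Passing from level [k] to level [k.+1] costs a bounded amount, hence a cost
   linear in the level although the windows shrink geometrically. *)
Lemma window_lower_bound k0 (s1 X : R) q (y : R) : 0 <= X ->
  s1 + (2 * kappa + 1) * h k0 + drift * (h k0 - h (k0 + q)%N) <= y ->
  y - s1 <= X * h k0 ->
  window k0 s1 <= window (k0 + q)%N y + q.+1%:R * base_cost X * N.
Proof.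
move=> X0; have dr0 : 0 <= drift by rewrite /drift; have := rho1; have := kappa1; lra.
have cX0 := transport_cost_ge0 _ X0; have cd0 := transport_cost_ge0 _ dr0.
have hk0 := h0 k0.
have hj k : kappa * h (k + j0)%N <= kappa * h k.
  have kp : 0 <= kappa by apply: le_trans kappa1.
  by rewrite ler_wpM2l//; have := h_fine k; have := mulr_ge0 kp (ltW (h0 (k + j0)%N)); lra.
elim: q y => [|q IH] y ys yX.
  rewrite addn0 subrr mulr0 addr0 in ys *.
  have : h k0 * window k0 s1 <= h k0 * (window k0 y + transport_cost X * N).
    rewrite -windowE; apply: slab_to_window => //.
      by rewrite lexx ler_peMl ?(ltW hk0).
    by have := hj k0; lra.
  rewrite ler_pM2l// mulr1n mul1r /base_cost.
  have := mulr_ge0 cd0 N0; lra.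
set k := (k0 + q)%N in IH; rewrite addnS -/k in ys *.
have hk := h0 k; have hk1 := h0 k.+1.
(* Since [h k.+1 <= h k - h k.+1], the times of all passages telescope to at most [drift * h k0],
   whatever [q] is. *)
pose y' := y - drift * h k.+1.
have dh : drift * (2 * h k.+1) <= drift * h k by rewrite ler_wpM2l.
have dh1 : 0 <= drift * h k.+1 by rewrite mulr_ge0// ltW.
have IH1 : window k0 s1 <= window k y' + q.+1%:R * base_cost X * N.
  by apply: IH; rewrite /y'; lra.
have hkk : h k.+1 <= h k <= rho * h k.+1.
  by rewrite h_rho andbT; have := h_half k; lra.
have : G y' (y' + h k) <= h k * (window k.+1 y + transport_cost drift * N).
  apply: slab_to_window => //; rewrite /y'; first by lra.
  have := hj k.+1; move: hkk => /andP[_]; rewrite /drift; lra.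
rewrite windowE ler_pM2l// => H.
have : 0 <= transport_cost X * N by rewrite mulr_ge0.
rewrite -[q.+2%:R]natr1 /base_cost in IH1 *; lra.
Qed.

(** Windows are put one after another from [y] on as long as they fit, leaving less than one height.
    In the cost term the filled length is estimated by all of [e - y]. *)
Lemma fill_windows k (u e c alpha y : R) : 0 <= c -> u <= y -> y <= e ->
  (forall z, u <= z -> z + h k <= e -> alpha <= window k z + c) ->
  exists y', [/\ y <= y', y' <= e, e - y' <= h k &
    (y' - y) * alpha - (e - y) * c <= G y y'].
Proof.
move=> c0 uy ye H; have hk := h0 k.
pose d := Num.truncn ((e - y) / h k).
have ey0 : 0 <= (e - y) / h k by rewrite divr_ge0 ?subr_ge0// ltW.
have d1 : d%:R * h k <= e - y by rewrite -ler_pdivlMr// truncn_le.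
have d2 : e - y < d%:R * h k + h k.
  by have := truncnS_gt ((e - y) / h k); rewrite ltr_pdivrMr// -natr1; lra.
have dh0 : 0 <= d%:R * h k by rewrite mulr_ge0// ltW.
exists (y + d%:R * h k); split; [lra..|].
have : d%:R * (h k * (alpha - c)) <= G y (y + d%:R * h k).
  elim: (d) d1 {d2 dh0} => [|r IH] rd.
    have := @G_cut y y y; rewrite lexx => /(_ isT) E.
    by rewrite !mul0r addr0; lra.
  have rE : r.+1%:R * h k = r%:R * h k + h k by rewrite -natr1; lra.
  have r0 : 0 <= r%:R * h k by rewrite mulr_ge0// ltW.
  rewrite (@G_cut y (y + r%:R * h k)); last by apply/andP; split; lra.
  have -> : r.+1%:R * (h k * (alpha - c)) =
    r%:R * (h k * (alpha - c)) + h k * (alpha - c) by rewrite -natr1; lra.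
  apply: lerD; first by apply: IH; lra.
  rewrite rE addrA windowE ler_pM2l//.
  suff : alpha <= window k (y + r%:R * h k) + c by lra.
  by apply: H; lra.
apply: le_trans; have := ler_wpM2r c0 d1; lra.
Qed.

(* Windows of the levels [k0], [k0.+1], ... chosen greedily exhaust [u, u + v). *)
Lemma time_mixing k0 (s1 X u v : R) : 0 <= X -> 0 < v ->
  s1 + (2 * kappa + 1 + drift) * h k0 <= u -> u + v - s1 <= X * h k0 ->
  v * window k0 s1 <= G u (u + v) + base_cost X * N * (v + 6 * h k0).
Proof.
move=> X0 v0 su uX; set alpha := window k0 s1; set C := base_cost X.
have dr0 : 0 <= drift by rewrite /drift; have := rho1; have := kappa1; lra.
have C0 : 0 <= C by rewrite addr_ge0// transport_cost_ge0.
have CN0 : 0 <= C * N by rewrite mulr_ge0.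
have hk0 := h0 k0; have [e eE] : exists e, e = u + v by exists (u + v).
rewrite -eE in uX *.
have low q z : u <= z -> z + h (k0 + q)%N <= e -> alpha <= window (k0 + q)%N z + q.+1%:R * C * N.
  move=> uz ze; apply: window_lower_bound => //; last first.
    by have := h0 (k0 + q)%N; lra.
  have : 0 <= drift * h (k0 + q)%N by rewrite mulr_ge0// ltW.
  by lra.
(* Level [q.+1] costs [q.+2] units on a remainder no longer than [h k0 / 2 ^ q]. The number
   [6 - (q + 3) * 2 / 2 ^ q] is the sum of [(i + 2) / 2 ^ i] over [i < q], whose limit is 6. *)
have fill q : exists y, [/\ u <= y, y <= e, e - y <= h (k0 + q)%N &
    (y - u) * alpha - C * N * (v + h k0 * (6 - (q + 3)%:R * 2 / 2 ^+ q)) <= G u y].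
  elim: q => [|q [y [uy ye yh yG]]].
    have := @fill_windows k0 u e (1%:R * C * N) alpha u; rewrite lexx.
    have ue : u <= e by lra.
    rewrite ue => /(_ _ isT isT) [|z uz|y [uy ye yh yG]].
    - by rewrite mul1r.
    - by have := low 0%N z uz; rewrite addn0; apply.
    exists y; split => //; first by rewrite addn0.
    by rewrite expr0 add0n; move: yG; rewrite eE; lra.
  have cq0 : 0 <= q.+2%:R * C * N by rewrite -mulrA mulr_ge0.
  have [y' [yy' ye' yh' yG']] := @fill_windows (k0 + q.+1)%N u e _ alpha y cq0 uy ye (low q.+1).
  exists y'; split => //; first exact: le_trans yy'.
  rewrite (@G_cut u y y'); last by rewrite uy.
  have hq := h_pow k0 q.
  have : (e - y) * (q.+2%:R * C * N) <= h k0 / 2 ^+ q * (q.+2%:R * C * N).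
    by rewrite ler_wpM2r//; lra.
  have -> : (q.+1 + 3)%:R * 2 / 2 ^+ q.+1 = (q + 4)%:R / 2 ^+ q :> R.
    by rewrite exprS invfM addSnnS; field; rewrite expf_eq0 pnatr_eq0 andbF.
  have -> : q.+2%:R = q%:R + 2 :> R by rewrite -[in LHS]addn2 natrD.
  have -> : (q + 4)%:R = q%:R + 4 :> R by rewrite natrD.
  have e2 : q.+2%:R = q%:R + 2 :> R by rewrite -[in LHS]addn2 natrD.
  have e3 : (q + 3)%:R = q%:R + 3 :> R by rewrite natrD.
  rewrite e2 e3 in yG yG'.
  move: yG yG'; move: ((2 : R) ^+ q)^-1 (q%:R : R) => x z; lra.
have hlim (d : R) : 0 < d -> exists q, h (k0 + q)%N <= d.
  move=> d0; exists (Num.truncn (h k0 / d)).+1.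
  apply: (le_trans (h_pow _ _)); rewrite ler_pdivrMr ?exprn_gt0// mulrC -ler_pdivrMr//.
  set r := (Num.truncn _).+1; apply: (le_trans (y := r%:R)); first by rewrite ltW ?truncnS_gt.
  by rewrite -natrX ler_nat ltnW// ltn_expl.
(* The unfilled end [[y, e)] enters through [G y e] and [(e - y) * alpha]; at a late level each
   contributes at most [eps / 2]. *)
rewrite -lerBlDr; apply/ler_addgt0Pr => eps eps0.
have eps20 : 0 < eps / 2 by lra.
have [|d d0 dP] := G_thin u e (eps / 2) _ eps20.
  by rewrite eE; lra.
have al1 : 0 < `|alpha| + 1 by rewrite ltr_wpDl.
have [|q] := hlim (Num.min d (eps / 2 / (`|alpha| + 1))).
  by rewrite lt_min d0 divr_gt0.
rewrite le_min ler_pdivlMr// => /andP[hd ha].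
have [y [uy ye yh yG]] := fill q.
have := dP y; rewrite uy ye => /(_ isT (le_trans yh hd)); rewrite ler_norml => /andP[G1 _].
have ea : (e - y) * alpha <= eps / 2.
  have hq := h0 (k0 + q)%N.
  have h1 : (e - y) * alpha <= (e - y) * `|alpha|.
    by rewrite ler_wpM2l ?subr_ge0// ler_norm.
  have h2 : (e - y) * `|alpha| <= h (k0 + q)%N * `|alpha| by rewrite ler_wpM2r.
  by lra.
have q0 : 0 <= (q + 3)%:R * 2 / (2 : R) ^+ q by rewrite divr_ge0 ?exprn_ge0// mulr_ge0.
have hq0 : C * N * (v + h k0 * (6 - (q + 3)%:R * 2 / 2 ^+ q)) <= C * N * (v + 6 * h k0).
  rewrite ler_wpM2l// lerD2l mulrC ler_pM2r//; lra.
rewrite (@G_cut u y e); last by rewrite uy.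
have : v * alpha = (y - u) * alpha + (e - y) * alpha by rewrite eE; lra.
by lra.
Qed.

End time_mixing.

(** * Mixing in space *)

Section spatial_mixing.
Context {R : realType} {n : nat}.
Implicit Types (a b : 'rV[R]_n) (i : 'I_n).

Definition vol a b : R := \prod_i (b 0 i - a 0 i).

Lemma upd_id a i : upd a i (a 0 i) = a.
Proof. by apply/rowP => j; rewrite updE; case: eqP => // ->. Qed.

Lemma upd_upd a i c d : upd (upd a i c) i d = upd a i d.
Proof. by apply/rowP => j; rewrite !updE; case: eqP. Qed.

Lemma vol_upd a b i c d :
  vol (upd a i c) (upd b i d) = (d - c) * \prod_(j | j != i) (b 0 j - a 0 j).
Proof.
rewrite /vol (bigD1 i)//= !updE eqxx; congr (_ * _).
by apply: eq_bigr => j /negbTE ji; rewrite !updE ji.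
Qed.

Lemma vol_cut a b i c : vol a b = vol a (upd b i c) + vol (upd a i c) b.
Proof.
rewrite -{1 2}(upd_id a i) -{1 3}(upd_id b i) !vol_upd -mulrDl.
by congr (_ * _); lra.
Qed.

Variables (J : 'rV[R]_n -> R -> 'rV[R]_n -> R -> R) (N l H kappa : R).
Hypothesis N0 : 0 <= N.
Hypothesis l0 : 0 < l.
Hypothesis H0 : 0 < H.
Hypothesis J_cut : forall a s b e i c, a 0 i <= c <= b 0 i ->
  J a s b e = J a s (upd b i c) e + J (upd a i c) s b e.
Hypothesis J_cube : forall a s a' s' b' e',
  (forall i, [/\ a 0 i <= a' 0 i, a' 0 i <= b' 0 i & b' 0 i <= a 0 i + l]) ->
  s <= s' -> s' <= e' -> e' <= s + H ->
  J a' s' b' e' <= vol a' b' * (e' - s') / (l ^+ n * H) *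
    J a (s + kappa * H) (a + const_mx l) (s + kappa * H + H) + N * (l ^+ n * H).

(* The inequality for cubes extends to boxes [a, b) whose sides are multiples of
   [l], as long as [a', b') occupies the same proportion of every cube of edge
   [l] in [a, b); this holds if [a', b') is smaller than [a, b) only in
   directions (outside of [A]) where [a, b) is one cube thick. *)
Lemma cuboid_upper_bound (A : {set 'I_n}) a b a' b' (k : 'I_n -> nat) s s' e' rho :
  (forall i, i \in A -> [/\ a' 0 i = a 0 i, b' 0 i = b 0 i &
     b 0 i = a 0 i + (k i).+1%:R * l]) ->
  (forall i, i \notin A -> [/\ b 0 i = a 0 i + l, a 0 i <= a' 0 i,
     a' 0 i <= b' 0 i & b' 0 i <= b 0 i]) ->
  \prod_(i | i \notin A) ((b' 0 i - a' 0 i) / l) * (e' - s') = rho * H ->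
  s <= s' -> s' <= e' -> e' <= s + H ->
  J a' s' b' e' <= rho * J a (s + kappa * H) b (s + kappa * H + H) + N * (vol a b * H).
Proof.
move=> + + + ss' se' eH.
have [m] := ubnP #|A|; elim: m A a b a' b' k => // m IH A a b a' b' k.
have [->|[i iA]] := set_0Vmem A.
  move=> _ _ cube prodE.
  have bE : b = a + const_mx l.
    by apply/rowP => i; rewrite !mxE; have [] := cube i; rewrite ?inE.
  have volE : vol a b = l ^+ n.
    rewrite /vol; under eq_bigr => i _ do rewrite bE !mxE addrAC subrr add0r.
    by rewrite prodr_const card_ord.
  have := @J_cube a s a' s' b' e' _ ss' se' eH; rewrite -bE volE.
  have -> : vol a' b' * (e' - s') / (l ^+ n * H) = rho.
    apply: (mulIf (lt0r_neq0 H0)); rewrite -prodE.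
    under eq_bigl => j do rewrite inE.
    rewrite big_split/= prodr_const card_ord exprVn /vol.
    by field; rewrite !gt_eqF// exprn_gt0.
  by apply=> i; have [] := cube i; rewrite ?inE// => ->.
rewrite ltnS => Am; have ltA : (#|A :\ i| < m)%N.
  by rewrite (leq_trans _ Am)// [ltnRHS](cardsD1 i) iA.
(* If [k1 i = 0], the box is one cube thick in direction [i], so [i] can leave [A]. Thicker boxes
   are reduced to this case by cutting off one cube at a time. *)
have one a1 b1 a1' b1' k1 :
    (forall j, j \in A -> [/\ a1' 0 j = a1 0 j, b1' 0 j = b1 0 j &
       b1 0 j = a1 0 j + (k1 j).+1%:R * l]) ->
    (forall j, j \notin A -> [/\ b1 0 j = a1 0 j + l, a1 0 j <= a1' 0 j,
       a1' 0 j <= b1' 0 j & b1' 0 j <= b1 0 j]) ->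
    \prod_(j | j \notin A) ((b1' 0 j - a1' 0 j) / l) * (e' - s') = rho * H ->
    k1 i = 0%N ->
    J a1' s' b1' e' <=
      rho * J a1 (s + kappa * H) b1 (s + kappa * H + H) + N * (vol a1 b1 * H).
  move=> inA notinA prodE ki; apply: (IH (A :\ i) _ _ _ _ k1 ltA).
  - by move=> j /setD1P[_ /inA].
  - move=> j; rewrite !inE negb_and negbK => /predU1P[->|/notinA//].
    have [-> -> ->] := inA i iA; rewrite ki mul1r; split => //.
    by rewrite lerDl ltW.
  - rewrite (bigD1 i) /=; last by rewrite !inE eqxx.
    have [-> -> ->] := inA i iA; rewrite ki mul1r addrAC subrr add0r divff ?gt_eqF//.
    rewrite mul1r -prodE; congr (_ * _); apply: eq_bigl => j.
    by rewrite !inE; case: eqP => [->|]; rewrite ?iA ?andbT ?andbF//= andbT.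
have [q kq] : exists q, q = k i by exists (k i).
elim: q k a b a' b' kq => [|q IHq] k a b a' b' kq inA notinA prodE.
  by apply: (one a b a' b' k).
have [a'i b'i bi] := inA i iA.
have kq0 : 0 <= (k i)%:R * l by rewrite mulr_ge0// ltW.
have kqE : (k i).+1%:R * l = (k i)%:R * l + l by rewrite -natr1; lra.
set c := a 0 i + l; have cab : a 0 i <= c <= b 0 i.
  by have := l0; rewrite bi kqE /c => lp; apply/andP; split; lra.
rewrite (J_cut a' s' b' e' i c) ?a'i ?b'i//.
rewrite (J_cut a (s + kappa * H) b (s + kappa * H + H) i c)//.
rewrite (vol_cut a b i c) mulrDl !mulrDr addrACA.
have prodU u v u' v' : (forall j, j \notin A -> u 0 j = u' 0 j /\ v 0 j = v' 0 j) ->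
    \prod_(j | j \notin A) ((v 0 j - u 0 j) / l) =
    \prod_(j | j \notin A) ((v' 0 j - u' 0 j) / l) :> R.
  by move=> uv; apply: eq_bigr => j /uv[-> ->].
have ni j : j \notin A -> (j == i) = false.
  by apply: contraNF => /eqP ->.
apply: lerD.
  apply: (one _ _ _ _ (fun j => if j == i then 0%N else k j)); last by rewrite eqxx.
  - move=> j jA; rewrite !updE; have [h1 h2 h3] := inA j jA.
    by case: eqP => // ->; rewrite mul1r a'i.
  - move=> j jA; rewrite !updE ni//; exact: notinA.
  - rewrite -prodE; congr (_ * _); apply: prodU => j jA.
    by rewrite updE ni.
apply: (IHq (fun j => if j == i then q else k j)).
- by rewrite eqxx.
- move=> j jA; rewrite !updE; have [h1 h2 h3] := inA j jA.
  case: eqP => // ->; split => //; rewrite bi kqE kq /c; lra.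
- move=> j jA; rewrite !updE ni//; exact: notinA.
- rewrite -prodE; congr (_ * _); apply: prodU => j jA.
  by rewrite updE ni.
Qed.

Definition cuboid_average a b s : R := J a s b (s + H) / (vol a b * H).
Local Notation av := cuboid_average.

Lemma vol_gt0 a b : (forall i, a 0 i < b 0 i) -> 0 < vol a b.
Proof. by move=> ab; apply: prodr_gt0 => i _; rewrite subr_gt0. Qed.

Lemma cuboid_average_stay a b (k : 'I_n -> nat) s :
  (forall j, b 0 j = a 0 j + (k j).+1%:R * l) ->
  av a b s <= av a b (s + kappa * H) + N.
Proof.
move=> ab.
have V0 : 0 < vol a b * H.
  by rewrite mulr_gt0// vol_gt0// => i; rewrite ab ltrDl mulr_gt0.
rewrite /av ler_pdivrMr// mulrDl divfK ?gt_eqF//.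
have := @cuboid_upper_bound [set: 'I_n]%SET a b a b k s s (s + H) 1.
rewrite !mul1r; apply => //.
- by move=> i; rewrite inE.
- rewrite big_pred0; last by move=> i; rewrite inE.
  by rewrite addrAC subrr add0r mul1r.
- by rewrite lerDl ltW.
Qed.

(** * Transport in one coordinate direction *)

Section direction.
Variables (a b : 'rV[R]_n) (i : 'I_n) (k : 'I_n -> nat).
Hypothesis ab : forall j, j != i -> b 0 j = a 0 j + (k j).+1%:R * l.

Let U y s := av (upd a i y) (upd b i (y + l)) s.
Let V : R := \prod_(j | j != i) (b 0 j - a 0 j).

Let V_gt0 : 0 < V.
Proof.
by apply: prodr_gt0 => j ji; rewrite ab// addrAC subrr add0r mulr_gt0.
Qed.

Let vol_slab y d : vol (upd a i y) (upd b i (y + d)) = d * V.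
Proof. by rewrite vol_upd addrAC subrr add0r. Qed.

Let half_bound y z s : y <= z -> z + l / 2 <= y + l ->
  J (upd a i z) s (upd b i (z + l / 2)) (s + H) <=
  (U y (s + kappa * H) / 2 + N) * (l * V * H).
Proof.
move=> yz zy; have hl := l0.
have := @cuboid_upper_bound [set~ i]%SET (upd a i y) (upd b i (y + l))
  (upd a i z) (upd b i (z + l / 2)) k s s (s + H) (1 / 2) _ _ _ (lexx _) _ (lexx _).
rewrite vol_slab lerDl (ltW H0).
move=> /(_ _ _ _ isT) h; apply: le_trans (h _ _ _) _.
- by move=> j; rewrite !inE !updE => /[dup] /ab ? /negbTE ->.
- by move=> j; rewrite !inE negbK !updE => /eqP ->; rewrite eqxx; split; lra.
- rewrite (big_pred1 i); last by move=> j; rewrite /= !inE negbK.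
  by rewrite !updE eqxx; field; rewrite gt_eqF.
rewrite /U /av vol_slab [X in _ <= X]mulrDl.
rewrite lerD2r le_eqVlt; apply/orP; left; apply/eqP.
by field; rewrite !gt_eqF.
Qed.

(** The lower half of the slab at [y] lies in the slab at [y'] and makes up half of it; likewise the
    upper half and the slab at [y'']. The freedom in [y'] and [y''] is what moves mass sideways. *)
Lemma half_step y y' y'' s : y' <= y <= y' + l / 2 -> y'' <= y + l / 2 <= y'' + l / 2 ->
  U y s <= U y' (s + kappa * H) / 2 + U y'' (s + kappa * H) / 2 + 2 * N.
Proof.
move=> /andP[h1 h2] /andP[h3 h4]; have hl := l0.
have c1 := half_bound y' y s h1; have c2 := half_bound y'' (y + l / 2) s h3.
rewrite {1}/U /av vol_slab ler_pdivrMr ?mulr_gt0//.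
rewrite (J_cut _ _ _ _ i (y + l / 2)); last first.
  by rewrite !updE eqxx; apply/andP; split; lra.
rewrite !upd_upd.
have -> : y + l = y + l / 2 + l / 2 by lra.
apply: (le_trans (lerD (c1 _) (c2 _))); [lra|lra|].
have P0 : 0 <= l * V * H by rewrite ltW// !mulr_gt0.
by rewrite -mulrDl ler_wpM2r//; lra.
Qed.

Let step_stay y s : U y s <= U y (s + kappa * H) + N.
Proof.
apply: (cuboid_average_stay _ _ (fun j => if j == i then 0%N else k j)) => j.
by rewrite !updE; case: eqP => [_|/eqP/ab//]; rewrite mul1r.
Qed.

(** Two half steps: one half stays at [y], the other reaches [y + l / 2], whence half of it returns
    to [y] and half goes on to [y + l]. The weights are [1/2 + 1/4] and [1/4]; the cost
    [2 N + N + N / 2] is rounded up to [4 N]. *)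
Let step_right y s : U y s <=
  3 / 4 * U y (s + 2 * (kappa * H)) + 1 / 4 * U (y + l) (s + 2 * (kappa * H)) + 4 * N.
Proof.
have hl := l0; have hN := N0.
have h1 := half_step y y (y + l / 2) s _ _.
have h2 := half_step (y + l / 2) y (y + l) (s + kappa * H) _ _.
have h3 := step_stay y (s + kappa * H).
have e : s + 2 * (kappa * H) = s + kappa * H + kappa * H by lra.
have {}h1 : U y s <= U y (s + kappa * H) / 2 + U (y + l / 2) (s + kappa * H) / 2 + 2 * N.
  by apply: h1; apply/andP; split; lra.
have : U (y + l / 2) (s + kappa * H) <=
    U y (s + kappa * H + kappa * H) / 2 + U (y + l) (s + kappa * H + kappa * H) / 2 + 2 * N.
  by apply: h2; apply/andP; split; lra.
rewrite e; lra.
Qed.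

Let step_left y s : U (y + l) s <=
  3 / 4 * U (y + l) (s + 2 * (kappa * H)) + 1 / 4 * U y (s + 2 * (kappa * H)) + 4 * N.
Proof.
have hl := l0; have hN := N0.
have h1 := half_step (y + l) (y + l / 2) (y + l) s _ _.
have h2 := half_step (y + l / 2) y (y + l) (s + kappa * H) _ _.
have h3 := step_stay (y + l) (s + kappa * H).
have e : s + 2 * (kappa * H) = s + kappa * H + kappa * H by lra.
have {}h1 : U (y + l) s <= U (y + l / 2) (s + kappa * H) / 2 + U (y + l) (s + kappa * H) / 2 + 2 * N.
  by apply: h1; apply/andP; split; lra.
have : U (y + l / 2) (s + kappa * H) <=
    U y (s + kappa * H + kappa * H) / 2 + U (y + l) (s + kappa * H + kappa * H) / 2 + 2 * N.
  by apply: h2; apply/andP; split; lra.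
rewrite e; lra.
Qed.

Let tile x s e q : J (upd a i x) s (upd b i (x + q.+1%:R * l)) e =
  \sum_(y < q.+1) J (upd a i (x + y%:R * l)) s (upd b i (x + y%:R * l + l)) e.
Proof.
elim: q => [|q IH].
  by rewrite big_ord_recr big_ord0/= add0r mul0r addr0 mul1r.
rewrite big_ord_recr/= -IH.
have hl := l0; have : 0 <= q.+1%:R * l by rewrite mulr_ge0// ltW.
have -> : q.+2%:R * l = q.+1%:R * l + l by rewrite -natr1; lra.
move=> ql; rewrite (J_cut _ _ _ _ i (x + q.+1%:R * l)); last first.
  by rewrite !updE eqxx; apply/andP; split; lra.
by rewrite !upd_upd addrA.
Qed.

Lemma mix_direction (m r j0 : nat) x s : (j0 < m)%N -> (3 / 4) ^+ r <= m%:R^-1 :> R ->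
  a 0 i = x + j0%:R * l -> b 0 i = a 0 i + l ->
  av a b s <= av (upd a i x) (upd b i (x + m%:R * l))
      (s + (r + r * m)%:R * (2 * (kappa * H))) + (r + r * m)%:R * (4 * N).
Proof.
move=> jm rm ai bi.
(* One tick of the chain is a double step, hence the duration [2 * (kappa * H)]. *)
pose W (y t : nat) := U (x + y%:R * l) (s + t%:R * (2 * (kappa * H))).
have tE t : s + t.+1%:R * (2 * (kappa * H)) = s + t%:R * (2 * (kappa * H)) + 2 * (kappa * H).
  by rewrite -natr1; lra.
have yE y : x + y.+1%:R * l = x + y%:R * l + l by rewrite -natr1; lra.
have hN := N0.
have N40 : 0 <= 4 * N by lra.
have stay y t : W y t <= W y t.+1 + 4 * N.
  rewrite /W tE.
  have h1 := step_stay (x + y%:R * l) (s + t%:R * (2 * (kappa * H))).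
  have := step_stay (x + y%:R * l) (s + t%:R * (2 * (kappa * H)) + kappa * H).
  set s' := s + _ in h1 *; have -> : s' + kappa * H + kappa * H = s' + 2 * (kappa * H) by lra.
  lra.
have right y t : W y t <= 3 / 4 * W y t.+1 + 1 / 4 * W y.+1 t.+1 + 4 * N.
  by rewrite /W tE yE; exact: step_right.
have left y t : W y.+1 t <= 3 / 4 * W y.+1 t.+1 + 1 / 4 * W y t.+1 + 4 * N.
  by rewrite /W tE yE; exact: step_left.
have := @chain_mix R W (4 * N) m r N40 stay right left rm j0 0 jm.
have -> : W j0 0%N = av a b s.
  by rewrite /W mul0r addr0 -ai /U -bi !upd_id.
rewrite add0n => /le_trans; apply; rewrite lerD2r.
set s' := s + _; have m0 : (0 < m)%N by apply: leq_ltn_trans jm.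
have mR : (m%:R : R) != 0 by rewrite pnatr_eq0 -lt0n.
rewrite le_eqVlt; apply/orP; left; apply/eqP.
rewrite /av -[X in X%:R * l](prednK m0) tile vol_slab prednK//.
rewrite /W -/s' mulr_sumr mulr_suml; apply: eq_bigr => y _.
rewrite /U /av vol_slab.
by field; rewrite mR !gt_eqF.
Qed.

End direction.

Lemma mix_space (m r : nat) (x : 'rV[R]_n) (j : 'I_n -> nat) s :
  (forall i, (j i < m)%N) -> (3 / 4) ^+ r <= m%:R^-1 :> R ->
  av (\row_i (x 0 i + (j i)%:R * l)) (\row_i (x 0 i + (j i)%:R * l + l)) s <=
  av x (x + const_mx (m%:R * l)) (s + n%:R * ((r + r * m)%:R * (2 * (kappa * H)))) +
    n%:R * ((r + r * m)%:R * (4 * N)).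
Proof.
move=> jm rm; set T := (r + r * m)%:R * (2 * _); set K := (r + r * m)%:R * (4 * N).
(* The directions are treated in turn: [A q] and [B q] bound a box that is [m] cubes wide in the
   first [q] directions and one cube wide in the others. *)
pose A q : 'rV[R]_n := \row_i (if (i < q)%N then x 0 i else x 0 i + (j i)%:R * l).
pose B q : 'rV[R]_n := \row_i (if (i < q)%N then x 0 i + m%:R * l else x 0 i + (j i)%:R * l + l).
suff H' q : (q <= n)%N -> av (A 0%N) (B 0%N) s <= av (A q) (B q) (s + q%:R * T) + q%:R * K.
  have := H' n (leqnn _).
  have -> : A n = x by apply/rowP => i; rewrite mxE ltn_ord.
  have -> : B n = x + const_mx (m%:R * l) by apply/rowP => i; rewrite !mxE ltn_ord.
  by congr (av _ _ _ <= _); apply/rowP => i; rewrite !mxE.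
elim: q => [_|q IH qn]; first by rewrite !mul0r !addr0.
apply: (le_trans (IH (ltnW qn))); pose i := Ordinal qn.
have m0 : (0 < m)%N by apply: leq_ltn_trans (jm i).
have := @mix_direction (A q) (B q) i
  (fun j => if (j < q)%N then m.-1 else 0%N) _ m r (j i) (x 0 i) (s + q%:R * T) (jm i) rm.
rewrite !mxE ltnn -/T -/K => /(_ _ erefl erefl) h.
have -> : s + q.+1%:R * T = s + q%:R * T + T by rewrite -natr1; lra.
have -> : q.+1%:R * K = q%:R * K + K by rewrite -natr1; lra.
rewrite addrCA addrC lerD2r.
have -> : A q.+1 = upd (A q) i (x 0 i).
  apply/rowP => u; rewrite !mxE ltnS leq_eqVlt -(inj_eq val_inj)/=.
  by case: eqP => // uq; congr (x 0 _); exact: val_inj.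
have -> : B q.+1 = upd (B q) i (x 0 i + m%:R * l).
  apply/rowP => u; rewrite !mxE ltnS leq_eqVlt -(inj_eq val_inj)/=.
  by case: eqP => // uq; congr (x 0 _ + _); exact: val_inj.
apply: h => u ui; rewrite !mxE; case: ifP => _; first by rewrite prednK.
by rewrite mul1r.
Qed.

End spatial_mixing.

(** * Comparison of the constants of small and large rectangles *)

Lemma two_lt_powR (R : realType) (p : R) : 1 < p -> 2 < 2 `^ p :> R.
Proof.
move=> p1; rewrite -[X in X < _]powRr1// /powR gt_eqF// ltr_expR ltr_pM2r//.
by rewrite ln_gt0// ltr1n.
Qed.

Lemma powR_div_pow2 (R : realType) (L p : R) k : 0 < L ->
  (L / 2 ^+ k) `^ p = L `^ p / (2 `^ p) ^+ k.
Proof.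
move=> L0; have k20 : (0 : R) < 2 ^+ k by rewrite exprn_gt0.
have -> : L `^ p = (L / 2 ^+ k) `^ p * (2 ^+ k) `^ p.
  by rewrite -powRM ?divr_ge0 ?ltW// divfK// gt_eqF.
by rewrite -(@powR_mulrn _ 2%:R k)// powRAC !powR_mulrn ?powR_ge0// mulfK.
Qed.

Section lag.
Context {R : realType} {n : nat}.
Implicit Types (a b x : 'rV[R]_n).

Definition height (p gamma l : R) : R := (1 - gamma) * l `^ p.

(** The bottom of [R^+] lies [(1 + gamma) l^p] above the bottom of [R]. Measured in units of
    [height], this distance is the same at every scale. *)
Definition lag (gamma : R) : R := (1 + gamma) / (1 - gamma).

(* [J a s b e] stands for the integral of a function over [a, b) x [s, e). *)
Record lag_controlled (p gamma N : R) (J : 'rV[R]_n -> R -> 'rV[R]_n -> R -> R) : Prop := {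
  lag_cut_space : forall a s b e i c, a 0 i <= c <= b 0 i ->
    J a s b e = J a s (upd b i c) e + J (upd a i c) s b e ;
  lag_cut_time : forall a s b e c, s <= c <= e -> J a s b e = J a s b c + J a c b e ;
  lag_thin : forall a b s e eps, s < e -> 0 < eps ->
    exists2 d, 0 < d & forall y, s <= y <= e -> e - y <= d -> `|J a y b e| <= eps ;
  lag_cube : forall l, 0 < l -> forall a s a' s' b' e',
    (forall i, [/\ a 0 i <= a' 0 i, a' 0 i <= b' 0 i & b' 0 i <= a 0 i + l]) ->
    s <= s' -> s' <= e' -> e' <= s + height p gamma l ->
    J a' s' b' e' <= vol a' b' * (e' - s') / (l ^+ n * height p gamma l) *
      J a (s + lag gamma * height p gamma l) (a + const_mx l)
        (s + lag gamma * height p gamma l + height p gamma l) +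
      N * (l ^+ n * height p gamma l) }.

(** With [z] the square root of [y] and [d = 1 / z - 1], Bernoulli's inequality gives
    [k * d * z ^ k <= 1]; squaring yields [k * y ^ k <= 1 / (k * d ^ 2)], from which [k] is read
    off. *)
Lemma mulr_expr_small (y A eps : R) : 0 < y < 1 -> 0 < eps ->
  exists2 k : nat, (0 < k)%N & A * (k%:R * y ^+ k) <= eps.
Proof.
move=> /andP[y0 y1] eps0; pose z := Num.sqrt y.
have z0 : 0 < z by rewrite sqrtr_gt0.
have zz : z ^+ 2 = y by rewrite sqr_sqrtr// ltW.
have z1 : z < 1 by rewrite -sqrtr1 ltr_sqrt.
pose d := z^-1 - 1; have d0 : 0 < d by rewrite subr_gt0 invf_gt1.
have zk k : k%:R * d * z ^+ k <= 1.
  rewrite -[z]invrK exprVn ler_pdivrMr ?exprn_gt0 ?invr_gt0// mul1r.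
  have -> : z^-1 = 1 + d by rewrite /d addrC subrK.
  elim: k => [|k IH]; first by rewrite mul0r expr0.
  rewrite exprS -natr1; have : 1 <= (1 + d) ^+ k by rewrite exprn_ege1// lerDl ltW.
  by move=> h1; have := ler_wpM2l (ltW d0) h1; lra.
have yk (k : nat) : (0 < k)%N -> k%:R * y ^+ k <= (k%:R * d ^+ 2)^-1.
  move=> k0; have kR : (0 : R) < k%:R by rewrite ltr0n.
  rewrite -[leRHS]mul1r ler_pdivlMr ?mulr_gt0 ?exprn_gt0//.
  have -> : k%:R * y ^+ k * (k%:R * d ^+ 2) = (k%:R * d * z ^+ k) ^+ 2.
    by rewrite -zz -exprM mulnC exprM; lra.
  by rewrite exprn_ile1// ?mulr_ge0 ?exprn_ge0 ?ltW.
pose A' := Num.max A 0.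
have A'0 : 0 <= A' by rewrite le_max lexx orbT.
pose k := (Num.truncn (A' / d ^+ 2 / eps)).+1; exists k => //.
have kR : (0 : R) < k%:R by rewrite ltr0n.
apply: (le_trans (y := A' * (k%:R * y ^+ k))).
  have AA' : A <= A' by rewrite le_max lexx.
  by rewrite ler_wpM2r// mulr_ge0// exprn_ge0// ltW.
apply: (le_trans (ler_wpM2l A'0 (yk k _))) => //.
rewrite invfM mulrCA ler_pdivrMl// -ler_pdivrMr// ltW//.
exact: truncnS_gt.
Qed.

End lag.

(** [k0] and [C] are fixed before [N], [J] and the rectangle. The upper part of the small cell
    starts at [s0]; by the time [s1] its mass is spread over the base cube, and [time_mixing] leads
    from there to [R^+]. *)
Lemma lag_upper_average_le (R : realType) (n : nat) (p gamma : R) :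
  1 < p -> 0 < gamma -> gamma < 1 ->
  exists (k0 : nat) (C : R), 0 <= C /\
  forall (N : R) (J : 'rV[R]_n -> R -> 'rV[R]_n -> R -> R), 0 <= N ->
    lag_controlled p gamma N J ->
  forall (L : R) (x : 'rV[R]_n) (t s : R) (j : 'I_n -> nat), 0 < L ->
    (forall i, (j i < 2 ^ k0)%N) -> t - L `^ p <= s <= t - gamma * L `^ p ->
  forall l H : R, l = L / (2 ^ k0)%:R -> H = height p gamma l ->
    J (\row_i (x 0 i + (j i)%:R * l)) (s + lag gamma * H)
      (\row_i (x 0 i + (j i)%:R * l + l)) (s + lag gamma * H + H) / (l ^+ n * H) <=
    J x (t + gamma * L `^ p) (x + const_mx L) (t + L `^ p) / (L ^+ n * height p gamma L) +
    C * N.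
Proof.
move=> p1 g0 g1.
have [kappa kE] : exists kappa, kappa = lag gamma by exists (lag gamma).
have [z zE] : exists z : R, z = (2 `^ p)^-1 by exists (2 `^ p)^-1.
have tp0 : 0 < 2 `^ p :> R by rewrite powR_gt0.
have tp2 : 2 < 2 `^ p :> R by exact: two_lt_powR.
have z0 : 0 < z by rewrite zE invr_gt0.
have z2 : 2 * z < 1 by rewrite zE ltr_pdivrMr// mul1r.
have z1 : z <= 1 by lra.
have g10 : 0 < 1 - gamma by lra.
have kap1 : 1 <= kappa by rewrite kE /lag ler_pdivlMr//; lra.
have [rho rhoE] : exists rho : R, rho = 2 `^ p by exists (2 `^ p).
have rho1 : 1 <= rho by rewrite rhoE; lra.
pose j0 := (Num.truncn (kappa + 1)).+1.
have j0P : (kappa + 1) * z ^+ j0 <= 1.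
  have h1 : kappa + 1 <= 2 ^+ j0.
    apply: (le_trans (ltW (truncnS_gt _))); rewrite -natrX ler_nat ltnW// ltn_expl//.
  have h2 : (2 * z) ^+ j0 <= 1 by rewrite exprn_ile1 ?mulr_ge0 ?ltW.
  apply: le_trans h2; rewrite exprMn ler_wpM2r// exprn_ge0// ltW//.
pose P := (z ^+ j0)^-1.
have P0 : 0 <= P by rewrite invr_ge0 exprn_ge0// ltW.
pose m := (Num.truncn (rho * P)).+1.
have mP : rho * P <= m%:R by rewrite ltW// truncnS_gt.
have n0 : 0 <= n%:R :> R by [].
pose dr := drift kappa rho.
(* Times in units of [H]: [c1] is the first lag plus the time that [time_mixing] requires before
   [u]. Spreading in [n] directions takes [c2 * (k0 * (1 + 2 ^ k0))]; its 6 comes from [r = 3 * k0]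
   and the double steps. *)
pose c1 := 3 * kappa + 1 + dr; pose c2 := n%:R * 6 * kappa.
have dr0 : 0 <= dr by rewrite /dr /drift; lra.
have kap0 : 0 <= kappa by lra.
have c10 : 0 <= c1 by rewrite /c1; lra.
have c20 : 0 <= c2 by rewrite /c2 mulr_ge0// mulr_ge0.
(* The number of steps grows like [k0 * 2 ^ k0] and their length shrinks like [z ^ k0]. As
   [2 * z < 1], by [p > 1], the total can be brought below the gap, which is [2 * gamma] in units of
   [L^p]. *)
have [k0 k00 k0P] : exists2 k : nat, (0 < k)%N &
    (1 - gamma) * (c1 + 2 * c2) * (k%:R * (2 * z) ^+ k) <= 2 * gamma.
  by apply: mulr_expr_small; [rewrite mulr_gt0|rewrite mulr_gt0].
(* Three steps suffice for each factor 2, since [(3 / 4) ^ 3 <= 1 / 2]. *)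
pose r := (3 * k0)%N; pose M := (2 ^ k0)%N.
(* Chosen so that [X * h k0] is [2 L^p], the duration of the whole rectangle. *)
pose X := 2 / ((1 - gamma) * z ^+ k0).
have zk0 : 0 < z ^+ k0 by rewrite exprn_gt0.
have X0 : 0 <= X by rewrite divr_ge0// mulr_ge0// ltW.
pose bc := base_cost kappa rho P m X.
have bc0 : 0 <= bc by rewrite addr_ge0// transport_cost_ge0.
pose C := n%:R * ((r + r * M)%:R * 4) + 7 * bc.
exists k0, C; split.
  by rewrite addr_ge0// ?mulr_ge0.
move=> N J N0 [cutS cutT thin cube] L x t s j L0 jM /andP[ts st] l H lE HE.
rewrite -kE in cube *.
pose Lam := L `^ p; have Lam0 : 0 < Lam by rewrite powR_gt0.
have powE k : (L / (2 ^ k)%:R) `^ p = Lam * z ^+ k.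
  by rewrite natrX powR_div_pow2// zE exprVn.
pose h k := height p gamma (L / (2 ^ k)%:R).
have hE k : h k = (1 - gamma) * Lam * z ^+ k by rewrite /h /height powE mulrA.
have h0 k : 0 < h k by rewrite hE !mulr_gt0// exprn_gt0.
have {}HE : H = h k0 by rewrite HE lE.
have k20 k : (0 : R) < (2 ^ k)%:R by rewrite ltr0n expn_gt0.
have l0 : 0 < l by rewrite lE divr_gt0.
have LM : (2 ^ k0)%:R * l = L by rewrite lE mulrC divfK// gt_eqF.
have cubel := cube l l0; rewrite lE -/(h k0) -HE -lE in cubel.
have H0 : 0 < H by rewrite HE.
have Ln0 : 0 < L ^+ n by rewrite exprn_gt0.
pose s0 := s + kappa * H.
pose s1 := s0 + n%:R * ((r + r * M)%:R * (2 * (kappa * H))).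
have rM : (3 / 4) ^+ r <= (2 ^ k0)%:R^-1 :> R.
  rewrite /r exprM natrX -exprVn lerXn2r// ?nnegrE ?exprn_ge0//; clear; lra.
have volx : vol x (x + const_mx L) = L ^+ n.
  rewrite /vol; under eq_bigr => i _ do rewrite !mxE addrAC subrr add0r.
  by rewrite prodr_const card_ord.
have vol_small : vol (\row_i (x 0 i + (j i)%:R * l)) (\row_i (x 0 i + (j i)%:R * l + l)) = l ^+ n.
  rewrite /vol; under eq_bigr => i _ do rewrite !mxE addrAC subrr add0r.
  by rewrite prodr_const card_ord.
have mix := @mix_space R n J N l H kappa N0 l0 H0 cutS cubel M r x j s0 jM rM.
rewrite /cuboid_average vol_small LM volx -/s1 in mix.
pose G s e := J x s (x + const_mx L) e / L ^+ n.
have Gcut s' c e : s' <= c <= e -> G s' e = G s' c + G c e.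
  by move=> sce; rewrite /G (cutT _ _ _ _ c)// mulrDl.
have Gthin s' e eps : s' < e -> 0 < eps ->
    exists2 d, 0 < d & forall y, s' <= y <= e -> e - y <= d -> `|G y e| <= eps.
  move=> se eps0; have eL : 0 < eps * L ^+ n by rewrite mulr_gt0.
  have [d d0 dP] := thin x (x + const_mx L) s' e _ se eL.
  exists d => // y sye yd.
  by rewrite /G normrM normfV (ger0_norm (ltW Ln0)) ler_pdivrMr// dP.
have Gslab k w s' e : w <= s' -> s' <= e -> e <= w + h k ->
    G s' e <= (e - s') / h k * G (w + kappa * h k) (w + kappa * h k + h k) + N * h k.
  move=> ws se ew; pose lk := L / (2 ^ k)%:R.
  have lk0 : 0 < lk by rewrite divr_gt0.
  have := @cuboid_upper_bound R n J N lk (h k) kappa lk0 (h0 k) cutS (cube lk lk0)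
    [set: 'I_n]%SET x (x + const_mx L) x (x + const_mx L) (fun=> (2 ^ k).-1) w s' e
    ((e - s') / h k) _ _ _ ws se ew.
  rewrite volx => hc; rewrite /G ler_pdivrMr//.
  apply: le_trans (hc _ _ _) _.
  - move=> i _; split=> //; rewrite !mxE prednK ?expn_gt0//; congr (_ + _).
    by rewrite mulrC divfK// gt_eqF.
  - by move=> i; rewrite inE.
  - rewrite big_pred0; last by move=> i; rewrite inE.
    by rewrite mul1r divfK// gt_eqF.
  - rewrite le_eqVlt; apply/orP; left; apply/eqP; field.
    by rewrite !gt_eqF.
have h_half k : 2 * h k.+1 <= h k.
  have -> : 2 * h k.+1 = (2 * z) * h k by rewrite !hE exprS; ring.
  by rewrite ger_pMl// ltW.
have h_rho k : h k <= rho * h k.+1.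
  rewrite !hE exprS (_ : rho * _ = (rho * z) * ((1 - gamma) * Lam * z ^+ k)); last by ring.
  by rewrite rhoE zE divff ?mul1r// gt_eqF.
have h_fine k : (kappa + 1) * h (k + j0)%N <= h k.
  rewrite !hE exprD.
  have -> : (kappa + 1) * ((1 - gamma) * Lam * (z ^+ k * z ^+ j0)) =
    ((kappa + 1) * z ^+ j0) * ((1 - gamma) * Lam * z ^+ k) by ring.
  by rewrite ger_pMl// -hE.
have zj0 : z ^+ j0 != 0 by rewrite gt_eqF// exprn_gt0.
have h_P k : h k <= P * h (k + j0)%N.
  rewrite !hE exprD (_ : P * _ = (P * z ^+ j0) * ((1 - gamma) * Lam * z ^+ k)); last by ring.
  by rewrite /P mulVf// mul1r.
have h_m k : rho * h k <= m%:R * h (k + j0)%N.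
  have := ler_wpM2l (_ : 0 <= rho) (h_P k) => hr.
  apply: (le_trans (hr _)); first exact: le_trans rho1.
  by rewrite mulrA ler_wpM2r// ltW.
pose u := t + gamma * Lam; pose v := (1 - gamma) * Lam.
have v0 : 0 < v by rewrite mulr_gt0.
have uv : u + v = t + Lam by rewrite /u /v; ring.
have hv : h k0 <= v.
  by rewrite hE /v ger_pMr ?mulr_gt0// exprn_ile1 ?(ltW z0).
have rME : (r + r * M)%:R = 3 * (k0%:R * (1 + M%:R)) :> R.
  by rewrite -mulnS natrM /r natrM -natr1; ring.
have HL : H = (1 - gamma) * Lam * z ^+ k0 by rewrite HE hE.
have su : s1 + (2 * kappa + 1 + drift kappa rho) * h k0 <= u.
  rewrite -HE -/dr.
  have yM : (2 * z) ^+ k0 = z ^+ k0 * M%:R by rewrite exprMn mulrC natrX.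
  have M1 : (1 : R) <= M%:R by rewrite ler1n expn_gt0.
  have k1 : (1 : R) <= k0%:R by rewrite ler1n.
  have zM : z ^+ k0 <= z ^+ k0 * M%:R by rewrite ler_peMr// ltW.
  have zk : z ^+ k0 * M%:R <= k0%:R * (z ^+ k0 * M%:R).
    by rewrite ler_peMl// mulr_ge0// ltW.
  have e1 : c1 * z ^+ k0 <= c1 * (k0%:R * (z ^+ k0 * M%:R)).
    by rewrite ler_wpM2l// (le_trans zM).
  have e2 : c2 * (k0%:R * z ^+ k0) <= c2 * (k0%:R * (z ^+ k0 * M%:R)).
    by rewrite ler_wpM2l// ler_wpM2l.
  have e3 : (1 - gamma) * Lam * (z ^+ k0 * (c1 + c2 * (k0%:R * (1 + M%:R)))) <=
      2 * gamma * Lam.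
    have -> : (1 - gamma) * Lam * (z ^+ k0 * (c1 + c2 * (k0%:R * (1 + M%:R)))) =
      (1 - gamma) * (c1 * z ^+ k0 + c2 * (k0%:R * z ^+ k0) +
        c2 * (k0%:R * (z ^+ k0 * M%:R))) * Lam by ring.
    rewrite ler_wpM2r ?(ltW Lam0)//; apply: le_trans k0P.
    by rewrite yM -mulrA ler_wpM2l ?(ltW g10)//; clear -e1 e2; lra.
  rewrite -(lerD2l (- s)).
  have -> : - s + (s1 + (2 * kappa + 1 + dr) * H) =
    (1 - gamma) * Lam * (z ^+ k0 * (c1 + c2 * (k0%:R * (1 + M%:R)))).
    by rewrite /s1 /s0 rME HL /c1 /c2; ring.
  by apply: (le_trans e3); rewrite /u; move: st; rewrite -/Lam; clear; lra.
have kH0 : 0 <= kappa * H by rewrite mulr_ge0// ltW.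
have ss1 : s <= s1.
  by rewrite /s1 /s0 -addrA lerDl addr_ge0// mulr_ge0// mulr_ge0// mulr_ge0.
have uX : u + v - s1 <= X * h k0.
  have -> : X * h k0 = 2 * Lam.
    by rewrite hE /X; field; rewrite !gt_eqF.
  by rewrite uv; move: ts; rewrite -/Lam; clear -ss1; lra.
have tm := @time_mixing R G h N kappa rho P j0 m N0 kap1 rho1 P0 h0 h_half h_rho h_fine
  h_P h_m Gcut Gslab Gthin k0 s1 X u v X0 v0 su uX.
rewrite uv -/bc in tm.
have wE : J x s1 (x + const_mx L) (s1 + H) / (L ^+ n * H) = window G h k0 s1.
  by rewrite /window /G -HE invfM mulrA.
rewrite -/s0 -[t + gamma * _]/u; apply: (le_trans mix); rewrite wE.
have -> : J x u (x + const_mx L) (t + Lam) / (L ^+ n * height p gamma L) = G u (t + Lam) / v.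
  by rewrite /G invfM mulrA.
have bcN : 0 <= bc * N by rewrite mulr_ge0.
have hv' : bc * N * (v + 6 * h k0) <= bc * N * (7 * v).
  by rewrite ler_wpM2l//; clear -hv; lra.
have : window G h k0 s1 <= G u (t + Lam) / v + 7 * (bc * N).
  have vG : v * (G u (t + Lam) / v) = G u (t + Lam) by rewrite mulrC divfK ?gt_eqF.
  rewrite -(ler_pM2l v0) [leRHS]mulrDr vG; clear -tm hv'; lra.
rewrite /C -/r -/M; move: (n%:R : R) ((r + r * M)%:R : R) => y w; clear; lra.
Qed.

(** * Consequences of the BMO condition *)

Section oscillation.
Context {R : realType} {n : nat}.
Local Notation mu := (@spacetime_lebesgue R n).
Implicit Types (f : spacetime R n -> R) (a x : 'rV[R]_n) (p gamma l s t : R).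

Definition upper_average p gamma f a s l : R :=
  box_integral f a (s + lag gamma * height p gamma l) (a + const_mx l)
    (s + lag gamma * height p gamma l + height p gamma l) /
  (l ^+ n * height p gamma l).

Lemma box_volume_edge a s l e : 0 <= l -> s <= e ->
  box_volume ((a, s) : spacetime R n) (a + const_mx l, e) = l ^+ n * (e - s).
Proof.
move=> l0 se; rewrite /box_volume/= max_l ?subr_ge0//; congr (_ * _).
under eq_bigr => i _ do rewrite !mxE addrAC subrr add0r max_l//.
by rewrite prodr_const card_ord.
Qed.

Lemma cube_itvE x l s e :
  (cube x l `*` `[s, e[%classic) =
  box (x - const_mx (l / 2), s) (x - const_mx (l / 2) + const_mx l, e) :> set (spacetime R n).
Proof.
apply/seteqP; split => z [zi tz]; split => //=.
- by move=> i; have := zi i; rewrite !mxE => /andP[? ?]; apply/andP; split; lra.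
- by move=> i; have := zi i; rewrite /= !mxE => /andP[? ?]; apply/andP; split; lra.
Qed.

Lemma height_gt0 p gamma l : gamma < 1 -> 0 < l -> 0 < height p gamma l.
Proof. by move=> g1 l0; rewrite mulr_gt0 ?subr_gt0// powR_gt0. Qed.

Lemma lag_height p gamma l : gamma < 1 ->
  lag gamma * height p gamma l = (1 + gamma) * l `^ p.
Proof. by move=> g1; rewrite /lag /height mulrA divfK// gt_eqF// subr_gt0. Qed.

Lemma measure_box (a b : spacetime R n) :
  (mu : {measure set (spacetime R n) -> \bar R}) (box a b) = (box_volume a b)%:E.
Proof. exact: mu_box. Qed.

Lemma integrable_cst_box (a b : spacetime R n) (c : R) :
  mu.-integrable (box a b) (EFin \o cst c).
Proof.
apply/integrableP; split; first exact/measurable_EFinP.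
have mD := measurable_box a b.
under eq_integral do rewrite /=.
by rewrite integral_cst// measure_box -EFinM ltry.
Qed.

Lemma integrable_positive_part f c (a b : spacetime R n) : L1loc f ->
  mu.-integrable (box a b) (EFin \o (fun z => positive_part (f z - c))).
Proof.
move=> fL; have mD := measurable_box a b; have fi := integrable_box f a b fL.
have ci := integrable_cst_box a b c.
apply: (@le_integrable _ _ _ mu _ mD _ (EFin \o (f \- cst c))).
- apply/measurable_EFinP; apply: measurable_funrpos.
  by apply: measurable_funB => //; apply: measurable_funS fL.1.
- move=> z _ /=; rewrite lee_fin /positive_part.
  by case: (leP (f z - c) 0) => h; rewrite ?normr0 ?normr_ge0.
- exact: (integrableB mD fi ci).
Qed.

Lemma average_boxE f a b s e : L1loc f ->
  average (box (a, s) (b, e)) f =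
  (fine (mu (box (a, s) (b, e))))^-1 * box_integral f a s b e.
Proof.
move=> fL; rewrite /average /eaverage fineM//; last first.
by apply: integrable_fin_num; [exact: measurable_box|exact: integrable_box].
Qed.

Lemma average_upper_part f p gamma x t l (l0 : 0 < l) : gamma < 1 -> L1loc f ->
  average (upper_part p gamma (ParabolicRectangle x t l0)) f =
  upper_average p gamma f (x - const_mx (l / 2)) (t - l `^ p) l.
Proof.
move=> g1 fL; have H0 := height_gt0 p gamma l g1 l0.
have e1 : t - l `^ p + lag gamma * height p gamma l = t + gamma * l `^ p.
  by rewrite lag_height//; lra.
have e2 : t + gamma * l `^ p + height p gamma l = t + l `^ p by rewrite /height; lra.
have e3 : t + l `^ p - (t + gamma * l `^ p) = height p gamma l by rewrite -e2; lra.
rewrite /upper_part cube_itvE average_boxE// mu_box box_volume_edge ?ltW//=; last first.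
  by rewrite -subr_gt0 e3.
by rewrite e3 /upper_average e1 e2 mulrC.
Qed.

(** The box is [R^-] for the rectangle with bottom corner [(a, s)] and edge [l]. The integrated
    form, without a mean, passes to subsets of [R^-] at once. *)
Definition oscillation_bound p gamma f N := forall a s l, 0 < l ->
  (\int[mu]_(z in box (a, s) (a + const_mx l, s + height p gamma l)%R)
     (positive_part (f z - upper_average p gamma f a s l))%:E <=
   (N * (l ^+ n * height p gamma l))%:E)%E.

Lemma BMO_plus_oscillation p gamma f : gamma < 1 -> BMO_plus p gamma f ->
  exists2 N, 0 < N & oscillation_bound p gamma f N.
Proof.
move=> g1 [fL fn].
pose N := fine (BMO_plus_norm p gamma f) + 1.
have bound P : (eaverage (lower_part p gamma P)
      (fun z => (positive_part (f z - average (upper_part p gamma P) f)%R)%:E) <=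
   BMO_plus_norm p gamma f)%E.
  by apply: ereal_sup_ubound; exists P.
have n0 : (0 <= BMO_plus_norm p gamma f)%E.
  apply: le_trans (bound (ParabolicRectangle 0 0 ltr01)).
  rewrite mule_ge0 ?lee_fin ?invr_ge0 ?fine_ge0//.
  by apply: integral_ge0 => z _; rewrite lee_fin /positive_part le_max lexx orbT.
have fin : BMO_plus_norm p gamma f \is a fin_num by rewrite ge0_fin_numE.
have N0 : 0 < N by rewrite ltr_wpDl// fine_ge0.
exists N => // a s l l0.
have := bound (ParabolicRectangle (a + const_mx (l / 2)) (s + l `^ p) l0).
have H0 := height_gt0 p gamma l g1 l0.
rewrite average_upper_part//.
have -> : a + const_mx (l / 2) - const_mx (l / 2) = a by rewrite addrK.
rewrite addrK /lower_part cube_itvE addrK addrK.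
have -> : s + l `^ p - gamma * l `^ p = s + height p gamma l by rewrite /height; lra.
have sH : s <= s + height p gamma l by rewrite lerDl ltW.
rewrite /eaverage mu_box box_volume_edge ?(ltW l0)//= addrAC subrr add0r.
have V0 : 0 < l ^+ n * height p gamma l by rewrite mulr_gt0// exprn_gt0.
rewrite -[X in (_ <= X)%E -> _](fineK fin) => /(lee_wpmul2l (ltW _)) h.
have {}h := h (l ^+ n * height p gamma l)%:E; rewrite lte_fin in h.
have {h} := h V0; rewrite muleA -EFinM divff ?gt_eqF// mul1e => /le_trans; apply.
by rewrite -EFinM lee_fin mulrC ler_pM2r// /N lerDl.
Qed.

Lemma box_le_oscillation p gamma f N a s l (X : set (spacetime R n)) : L1loc f -> gamma < 1 ->
  oscillation_bound p gamma f N -> 0 < l -> measurable X ->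
  X `<=` box (a, s) (a + const_mx l, s + height p gamma l) ->
  (\int[mu]_(z in X) (positive_part (f z - upper_average p gamma f a s l))%:E <=
   (N * (l ^+ n * height p gamma l))%:E)%E.
Proof.
move=> fL g1 osc l0 mX XR; apply: le_trans (osc a s l l0).
apply: ge0_subset_integral => //.
- exact: measurable_box.
- by apply: (measurable_int mu); exact: integrable_positive_part.
- by move=> z _; rewrite lee_fin /positive_part le_max lexx orbT.
Qed.

(** On a piece of [R^-], [f] is at most [c] plus the positive part of [f - c]. The constant
    contributes the proportional share of the integral over [R^+], the positive part at most its
    integral over all of [R^-]. *)
Lemma oscillation_lag_controlled p gamma f N : L1loc f -> gamma < 1 ->
  oscillation_bound p gamma f N -> lag_controlled p gamma N (box_integral f).
Proof.
move=> fL g1 osc; split.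
- by move=> *; exact: box_integral_cut_space.
- by move=> *; exact: box_integral_cut_time.
- by move=> *; exact: box_integral_thin.
move=> l l0 a s a' s' b' e' ab ss' se' eH.
have H0 := height_gt0 p gamma l g1 l0.
set c := upper_average p gamma f a s l.
have YR : (box (a', s') (b', e') : set (spacetime R n)) `<=`
    box (a, s) (a + const_mx l, s + height p gamma l).
  move=> z [zi /=/andP[tz1 tz2]]; split => /=.
    move=> i; have [h1 h2 h3] := ab i; have /=/andP[h4 h5] := zi i.
    by rewrite !mxE (le_trans h1)//= (lt_le_trans h5).
  by rewrite (le_trans ss')//= (lt_le_trans tz2).
have mY := measurable_box (a', s') (b', e').
have := box_le_oscillation _ _ _ _ _ _ _ _ fL g1 osc l0 mY YR; rewrite -/c.
have pI := integrable_positive_part f c (a', s') (b', e') fL.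
have -> : (\int[mu]_(z in box (a', s') (b', e')) (positive_part (f z - c))%:E =
   (\int[mu]_(z in box (a', s') (b', e')) positive_part (f z - c))%R%:E)%E.
  by rewrite /Rintegral fineK// integrable_fin_num.
rewrite lee_fin => hosc.
have cI := integrable_cst_box (a', s') (b', e') c.
have fI := integrable_box f (a', s') (b', e') fL.
apply: (le_trans (y := \int[mu]_(z in box (a', s') (b', e')) (cst c z + positive_part (f z - c)))).
  apply: le_Rintegral => //; first exact: (integrableD mY cI pI).
  move=> z _ /=; rewrite -lerBlDl /positive_part le_max lexx//.
rewrite RintegralD// lerD//.
rewrite Rintegral_cst// measure_box /=.
have -> : box_volume ((a', s') : spacetime R n) (b', e') = vol a' b' * (e' - s').
  rewrite /box_volume /vol /= max_l ?subr_ge0//; congr (_ * _).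
  by apply: eq_bigr => i _; rewrite max_l// subr_ge0; have [] := ab i.
rewrite /c /upper_average le_eqVlt; apply/orP; left; apply/eqP.
by field; rewrite !gt_eqF// exprn_gt0.
Qed.

End oscillation.

(** * Stopping-time argument on a grid *)

Section grid.
Context {R : realType} {n : nat}.
Local Notation mu := (@spacetime_lebesgue R n).
Variables (p gamma : R) (f : spacetime R n -> R).
Hypothesis g0 : 0 < gamma.
Hypothesis g1 : gamma < 1.
Variables (l tau : nat -> R) (x0 : 'rV[R]_n) (t0 : R).
Hypothesis l_gt0 : forall i, 0 < l i.
Hypothesis l_nested : forall i j, (i <= j)%N -> exists2 m : nat, (0 < m)%N & l i = m%:R * l j.
Hypothesis tau_nested : forall i j, (i <= j)%N -> exists2 m : nat, (0 < m)%N & tau i = m%:R * tau j.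
Local Notation H i := (height p gamma (l i)).
Local Notation kappa := (lag gamma).
Hypothesis tau_le : forall i, 2 * tau i <= H i.
Hypothesis tau_ge : forall i, H i <= 4 * tau i.
Hypothesis H_shrink : forall i j, (i < j)%N -> 2 * ((kappa + 1) * H j) <= H i.

(** * Cells, their rectangles and their nesting *)

Definition cell_index : Type := (nat * 'rV[int]_n * int)%type.
HB.instance Definition _ := Countable.on cell_index.

Implicit Types (P Q : cell_index) (z : spacetime R n).

Definition gen P : nat := P.1.1.
Definition corner P : 'rV[R]_n := \row_a (x0 0 a + (P.1.2 0 a)%:~R * l (gen P)).
Definition cell_bottom P : R := t0 + P.2%:~R * tau (gen P).
Definition top_corner P : 'rV[R]_n := corner P + const_mx (l (gen P)).
(** The height is [tau] and not [H]: quotients of the [tau i] are integers, so that cells of all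
    generations are nested in time as well. *)
Definition cell P : set (spacetime R n) :=
  box (corner P, cell_bottom P) (top_corner P, cell_bottom P + tau (gen P)).
Definition cell_lower P : set (spacetime R n) :=
  box (corner P, cell_bottom P) (top_corner P, cell_bottom P + H (gen P)).
Definition cell_upper P : set (spacetime R n) :=
  box (corner P, cell_bottom P + kappa * H (gen P))
    (top_corner P, cell_bottom P + kappa * H (gen P) + H (gen P)).
Definition cell_cst P : R := upper_average p gamma f (corner P) (cell_bottom P) (l (gen P)).
Definition cell_vol P : R := l (gen P) ^+ n * tau (gen P).

Lemma grid_H_gt0 i : 0 < H i. Proof. exact: height_gt0. Qed.

Lemma tau_gt0 i : 0 < tau i.
Proof. by have := tau_ge i; have := grid_H_gt0 i; lra. Qed.

Lemma kappa_gt1 : 1 < kappa.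
Proof. by rewrite /lag ltr_pdivlMr ?subr_gt0//; have := g0; lra. Qed.

Lemma cell_measure P : mu (cell P) = (cell_vol P)%:E.
Proof.
rewrite mu_box box_volume_edge ?(ltW (l_gt0 _))// ?lerDl ?(ltW (tau_gt0 _))//.
by rewrite addrAC subrr add0r.
Qed.

Lemma cell_upper_measure P : mu (cell_upper P) = (l (gen P) ^+ n * H (gen P))%:E.
Proof.
rewrite mu_box box_volume_edge ?(ltW (l_gt0 _))// ?lerDl ?(ltW (grid_H_gt0 _))//.
by rewrite addrAC subrr add0r.
Qed.

Lemma grid_interval_nested (d x y : R) (m : nat) (k k' : int) : 0 < d -> (0 < m)%N ->
  x + k%:~R * (m%:R * d) <= y < x + k%:~R * (m%:R * d) + m%:R * d ->
  x + k'%:~R * d <= y < x + k'%:~R * d + d ->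
  x + k%:~R * (m%:R * d) <= x + k'%:~R * d /\
  x + k'%:~R * d + d <= x + k%:~R * (m%:R * d) + m%:R * d.
Proof.
move=> d0 m0 /andP[h1 h2] /andP[h3 h4].
have e1 : k%:~R * (m%:R * d) = (k * m%:Z)%:~R * d by rewrite intrM mulrA.
have e2 : k%:~R * (m%:R * d) + m%:R * d = ((k + 1) * m%:Z)%:~R * d.
  by rewrite intrM rmorphD/= -[(m%:Z)%:~R]/(m%:R : R); ring.
have e3 : k'%:~R * d + d = (k' + 1)%:~R * d by rewrite rmorphD/=; ring.
rewrite -!addrA e2 e3 e1 in h1 h2 h4 *; rewrite !lerD2l !ler_pM2r// !ler_int.
split.
  rewrite -ltzD1 -(ltr_int R) -(ltr_pM2r d0); lra.
rewrite lezD1 -(ltr_int R) -(ltr_pM2r d0); lra.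
Qed.

Lemma corner_nested P Q a (y : R) : (gen Q <= gen P)%N ->
  corner P 0 a <= y < top_corner P 0 a -> corner Q 0 a <= y < top_corner Q 0 a ->
  corner Q 0 a <= corner P 0 a /\ top_corner P 0 a <= top_corner Q 0 a.
Proof.
move=> QP; rewrite !mxE => hP hQ.
have [m m0 e] := l_nested _ _ QP; rewrite e in hQ *.
exact: (grid_interval_nested _ _ _ _ _ _ (l_gt0 _) m0 hQ hP).
Qed.

Lemma bottom_nested P Q (y : R) : (gen Q <= gen P)%N ->
  cell_bottom P <= y < cell_bottom P + tau (gen P) -> cell_bottom Q <= y < cell_bottom Q + tau (gen Q) ->
  cell_bottom Q <= cell_bottom P /\ cell_bottom P + tau (gen P) <= cell_bottom Q + tau (gen Q).
Proof.
move=> QP; rewrite /cell_bottom => hP hQ.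
have [m m0 e] := tau_nested _ _ QP; rewrite e in hQ *.
exact: (grid_interval_nested _ _ _ _ _ _ (tau_gt0 _) m0 hQ hP).
Qed.

Lemma cell_nested P Q z : (gen Q <= gen P)%N -> cell P z -> cell Q z ->
  [/\ forall a, corner Q 0 a <= corner P 0 a /\ top_corner P 0 a <= top_corner Q 0 a,
    cell_bottom Q <= cell_bottom P & cell_bottom P + tau (gen P) <= cell_bottom Q + tau (gen Q)].
Proof.
move=> QP [Pz Pt] [Qz Qt]; have [h1 h2] := bottom_nested _ _ _ QP Pt Qt; split=> // a.
exact: (corner_nested _ _ _ _ QP (Pz a) (Qz a)).
Qed.

Lemma cell_subset P Q z : (gen Q <= gen P)%N -> cell P z -> cell Q z ->
  cell P `<=` cell Q.
Proof.
move=> QP Pz Qz; have [h1 h2 h3] := cell_nested _ _ _ QP Pz Qz.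
move=> y [yP /andP[yt1 yt2]]; split.
  move=> a; have [k1 k2] := h1 a; have /andP[k3 k4] := yP a.
  by rewrite (le_trans k1)//= (lt_le_trans k4).
by rewrite /= (le_trans h2)//= (lt_le_trans yt2).
Qed.

Lemma cell_corner P : cell P (corner P, cell_bottom P).
Proof.
split=> [a|] /=; last by rewrite lexx ltrDl tau_gt0.
by rewrite lexx !mxE ltrDl l_gt0.
Qed.

Lemma cell_inj P Q z : gen P = gen Q -> cell P z -> cell Q z -> P = Q.
Proof.
move=> e Pz Qz; have PQ : (gen Q <= gen P)%N by rewrite e.
have QP : (gen P <= gen Q)%N by rewrite e.
have [h1 h2 _] := cell_nested _ _ _ PQ Pz Qz.
have [k1 k2 _] := cell_nested _ _ _ QP Qz Pz.
have E3 : P.2 = Q.2.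
  have : cell_bottom P = cell_bottom Q by apply/eqP; rewrite eq_le h2 k2.
  rewrite /cell_bottom e => /addrI /(mulIf (lt0r_neq0 (tau_gt0 _))).
  exact: intr_inj.
have E2 : P.1.2 = Q.1.2.
  apply/rowP => a; have : corner P 0 a = corner Q 0 a.
    by apply/eqP; rewrite eq_le (h1 a).1 (k1 a).1.
  rewrite !mxE e => /addrI /(mulIf (lt0r_neq0 (l_gt0 _))).
  exact: intr_inj.
by case: P Q e E3 E2 {Pz Qz PQ QP h1 h2 k1 k2} => [[? ?] ?] [[? ?] ?]; rewrite /gen /= => -> -> ->.
Qed.

Lemma cell_exists i z : exists2 P, gen P = i & cell P z.
Proof.
exists ((i, \row_a Num.floor ((z.1 0 a - x0 0 a) / l i)), Num.floor ((z.2 - t0) / tau i)) => //.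
have fl (d x y : R) : 0 < d ->
    x + (Num.floor ((y - x) / d))%:~R * d <= y < x + (Num.floor ((y - x) / d))%:~R * d + d.
  move=> d0; have /andP[] := floor_itv ((y - x) / d).
  by rewrite intrD ler_pdivlMr// ltr_pdivrMr// => h1 h2; apply/andP; split; lra.
by split=> [a|]; rewrite /cell_bottom /= ?mxE; apply: fl; rewrite ?tau_gt0.
Qed.

(** By [tau_le] the cell [Q] stays in the lower half of [cell_lower Q]; by [H_shrink] the lag and
    the height of a strictly finer cell fit together into the other half. *)
Lemma cell_upper_subset P Q z : (gen Q < gen P)%N -> cell P z -> cell Q z ->
  cell_upper P `<=` cell_lower Q.
Proof.
move=> QP Pz Qz; have [h1 h2 h3] := cell_nested _ _ _ (ltnW QP) Pz Qz.
move=> y [yP /= /andP[yt1 yt2]]; split => /=.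
  move=> a; have [k1 k2] := h1 a; have /andP[k3 k4] := yP a.
  by rewrite (le_trans k1)//= (lt_le_trans k4).
have hs := H_shrink _ _ QP; have ht := tau_le (gen Q).
have tP := tau_gt0 (gen P).
have kH : 0 < kappa * H (gen P) by rewrite mulr_gt0 ?grid_H_gt0// (lt_trans _ kappa_gt1).
by apply/andP; split; lra.
Qed.

(** In space the finer cell lies over the coarser one by nesting, so only time has to be enlarged.
    The resulting height, [2 * kappa + 3] times that of [cell_upper Q], gives the constant of the
    covering argument. *)
Lemma cell_upper_meet P Q z : (gen Q <= gen P)%N -> cell_upper P z -> cell_upper Q z ->
  cell P `<=` box (corner Q, cell_bottom Q - (kappa + 1) * H (gen Q))
    (top_corner Q, cell_bottom Q + (kappa + 2) * H (gen Q)).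
Proof.
move=> QP [Pz /= /andP[Pt1 Pt2]] [Qz /= /andP[Qt1 Qt2]].
have kp := kappa_gt1.
have HPQ : H (gen P) <= H (gen Q).
  move: QP; rewrite leq_eqVlt => /predU1P[->//|/H_shrink h].
  have hp := grid_H_gt0 (gen P).
  by have : 0 <= kappa * H (gen P); [rewrite mulr_ge0 ?ltW// (lt_trans ltr01)|lra].
have kHPQ : kappa * H (gen P) <= kappa * H (gen Q).
  by rewrite ler_wpM2l// (le_trans ler01)// ltW.
have hp := grid_H_gt0 (gen P); have hq := grid_H_gt0 (gen Q).
have kq : 0 < kappa * H (gen Q) by rewrite mulr_gt0// (lt_trans ltr01).
have kpp : 0 < kappa * H (gen P) by rewrite mulr_gt0// (lt_trans ltr01).
have tP := tau_le (gen P).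
move=> y [yP /= /andP[yt1 yt2]]; split => /=.
  move=> a; have [k1 k2] := corner_nested _ _ _ _ QP (Pz a) (Qz a).
  have /andP[k3 k4] := yP a.
  by rewrite (le_trans k1)//= (lt_le_trans k4).
by apply/andP; split; lra.
Qed.

Variables (N D : R).
Hypothesis N_gt0 : 0 < N.
Hypothesis f_L1loc : L1loc f.
Hypothesis f_osc : oscillation_bound p gamma f N.
Hypothesis volume_ratio : forall i, l i ^+ n * H i <= D * (l i.+1 ^+ n * H i.+1).

Definition excess Q z : \bar R := (positive_part (f z - cell_cst Q))%:E.

Lemma excess_ge0 Q z : (0 <= excess Q z)%E.
Proof. by rewrite lee_fin /positive_part le_max lexx orbT. Qed.

Lemma measurable_excess Q (X : set (spacetime R n)) : measurable_fun X (excess Q).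
Proof.
apply/measurable_EFinP; apply: measurable_funrpos.
by apply: measurable_funB => //; apply: measurable_funS f_L1loc.1.
Qed.

Lemma grid_volume_gt0 i : 0 < l i ^+ n * H i.
Proof. by rewrite mulr_gt0 ?grid_H_gt0// exprn_gt0. Qed.

Lemma excess_le Q (X : set (spacetime R n)) : measurable X -> X `<=` cell_lower Q ->
  (\int[mu]_(z in X) excess Q z <= (N * (l (gen Q) ^+ n * H (gen Q)))%:E)%E.
Proof.
move=> mX XQ.
exact: (box_le_oscillation p gamma f N _ _ _ X f_L1loc g1 f_osc (l_gt0 _) mX XQ).
Qed.

Lemma cell_sub_lower P : cell P `<=` cell_lower P.
Proof.
move=> z [zi /= /andP[h1 h2]]; split => //=; rewrite h1/= (lt_le_trans h2)//.
by rewrite lerD2l; have := tau_le (gen P); have := tau_gt0 (gen P); lra.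
Qed.

(** The upper part of a child lies in the lower part of its parent and is smaller by a factor of at
    most [D]. *)
Lemma child_cst_le P Q z : gen P = (gen Q).+1 -> cell P z -> cell Q z ->
  cell_cst P <= cell_cst Q + D * N.
Proof.
move=> PQ Pz Qz; have QP : (gen Q < gen P)%N by rewrite PQ.
have [h1 h2 h3] := cell_nested _ _ _ (ltnW QP) Pz Qz.
have hs := H_shrink _ _ QP; have ht := tau_le (gen Q); have tP := tau_gt0 (gen P).
have HP := grid_H_gt0 (gen P).
have kH : 0 < kappa * H (gen P) by rewrite mulr_gt0// (lt_trans _ kappa_gt1).
have b1 : cell_bottom Q <= cell_bottom P + kappa * H (gen P) by lra.
have b2 : cell_bottom P + kappa * H (gen P) + H (gen P) <= cell_bottom Q + H (gen Q) by lra.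
have [_ _ _ cube] := oscillation_lag_controlled p gamma f N f_L1loc g1 f_osc.
have h : box_integral f (corner P) (cell_bottom P + kappa * H (gen P)) (top_corner P)
     (cell_bottom P + kappa * H (gen P) + H (gen P)) <=
   vol (corner P) (top_corner P) * (cell_bottom P + kappa * H (gen P) + H (gen P) -
      (cell_bottom P + kappa * H (gen P))) * cell_cst Q + N * (l (gen Q) ^+ n * H (gen Q)).
  apply: (le_trans (cube (l (gen Q)) (l_gt0 _) (corner Q) (cell_bottom Q) (corner P)
    (cell_bottom P + kappa * H (gen P)) (top_corner P)
    (cell_bottom P + kappa * H (gen P) + H (gen P)) _ _ _ _)).
  - move=> i; have [k1 k2] := h1 i; split=> //.
      by rewrite /top_corner !mxE lerDl ltW.
    by move: k2; rewrite /top_corner !mxE.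
  - exact: b1.
  - by rewrite lerDl ltW.
  - exact: b2.
  rewrite /cell_cst /upper_average lerD2r le_eqVlt; apply/orP; left; apply/eqP.
  by field; rewrite !gt_eqF ?exprn_gt0 ?grid_H_gt0.
have volP : vol (corner P) (top_corner P) = l (gen P) ^+ n.
  rewrite /vol; under eq_bigr => i _ do rewrite /top_corner mxE addrAC subrr add0r mxE.
  by rewrite prodr_const card_ord.
have V := grid_volume_gt0 (gen P).
rewrite {1}/cell_cst /upper_average -/(top_corner P) ler_pdivrMr//; apply: (le_trans h).
rewrite volP addrAC subrr add0r mulrDl mulrC lerD2l.
have := volume_ratio (gen Q); rewrite -PQ => r.
by have := ler_wpM2l (ltW N_gt0) r; lra.
Qed.

(** * From bounds on cells to bounds on sets *)

Hypothesis cells_shrink : forall eps, 0 < eps ->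
  exists i0, forall i, (i0 <= i)%N -> l i <= eps /\ tau i <= eps.

(** The cells of generation [i] that meet [Y] are disjoint, cover [Y] and stay in [X]; [F] lists
    them by the codes of their integer coordinates, with empty sets at all other codes. Small cells
    serve differentiation; cells of generation 0 reassemble [R^-] in the end. *)
Lemma integral_le_cells (Y X : set (spacetime R n)) (g : spacetime R n -> \bar R) (A : R) i :
  measurable Y -> measurable X -> measurable_fun setT g -> (forall z, 0 <= g z)%E -> 0 <= A ->
  (forall P z, gen P = i -> cell P z -> Y z -> cell P `<=` X) ->
  (forall P z, gen P = i -> cell P z -> Y z ->
     (\int[mu]_(z in cell P) g z <= (A * cell_vol P)%:E)%E) ->
  (\int[mu]_(z in Y) g z <= A%:E * mu X)%E.
Proof.
move=> mY mX mg g0' A0 PX Pg.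
pose meets P := `[< exists2 z, cell P z & Y z >].
pose F (k : nat) : set (spacetime R n) :=
  if (pickle_inv k : option ('rV[int]_n * int)) is Some j then
    let P : cell_index := (i, j.1, j.2) in if meets P then cell P else set0
  else set0.
have FP k z : F k z -> exists P, [/\ gen P = i, meets P, F k = cell P & pickle (P.1.2, P.2) = k].
  rewrite /F; have := pickle_invK (T := ('rV[int]_n * int)%type) k.
  case: (pickle_inv k) => [[j1 j2] jk|//] /=; case: ifP => // mj _.
  by exists (i, j1, j2); split.
have mF k : measurable (F k).
  have [->|/set0P[z /FP[P [_ _ -> _]]]] := eqVneq (F k) set0 => //.
  exact: measurable_box.
have tF : trivIset setT F.
  move=> k k' _ _ [z [Fz F'z]]; have [P [gP _ FE <-]] := FP _ _ Fz.
  have [P' [gP' _ FE' <-]] := FP _ _ F'z; rewrite FE in Fz; rewrite FE' in F'z.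
  by rewrite (cell_inj _ _ _ (etrans gP (esym gP')) Fz F'z).
have YF : Y `<=` \bigcup_k F k.
  move=> z Yz; have [P gP Pz] := cell_exists i z.
  exists (pickle (P.1.2, P.2)) => //; rewrite /F pickleK_inv /=.
  have -> : ((i, P.1.2, P.2) : cell_index) = P.
    by rewrite -gP; case: (P) => -[].
  by rewrite ifT//; apply/asboolP; exists z.
have mU : measurable (\bigcup_k F k) by exact: bigcup_measurable.
have mgS (S : set (spacetime R n)) : measurable_fun S g by apply: measurable_funS mg.
have FX : \bigcup_k F k `<=` X.
  move=> z [k _ Fz]; have [P [gP /asboolP[y Py Yy] FE _]] := FP _ _ Fz.
  by apply: (PX P y gP Py Yy); rewrite -FE.
apply: (@le_trans _ _ (\int[mu]_(z in \bigcup_k F k) g z)%E).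
  by apply: ge0_subset_integral.
rewrite ge0_integral_bigcup//.
apply: (@le_trans _ _ (\sum_(k <oo) (A%:E * mu (F k)))%E).
  apply: lee_nneseries => [k _ _|k _]; first exact: integral_ge0.
  have [->|/set0P[z Fz]] := eqVneq (F k) set0; first by rewrite integral_set0 mule_ge0.
  have [P [gP /asboolP[y Py Yy] -> _]] := FP _ _ Fz.
  by rewrite cell_measure -EFinM; exact: Pg Py Yy.
rewrite nneseriesZl//; apply: lee_wpmul2l; first by rewrite lee_fin.
have <- : mu (\bigcup_k F k) = (\sum_(k <oo) mu (F k))%E.
  exact: (measure_semi_bigcup (mu : {measure set _ -> \bar R})).
by apply: (@le_measure _ _ _ (mu : {measure set _ -> \bar R})) => //; rewrite inE.
Qed.

(** The left side is a polynomial in [d] with nonnegative coefficients, hence convex, and lies below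
    its chord over [[0, 1]]. This makes the volume of an enlarged box grow at most linearly. *)
Lemma prod_shift_le (I : Type) (r : seq I) (c : I -> R) (d : R) :
  0 <= d <= 1 -> (forall i, 0 <= c i) ->
  \prod_(i <- r) (c i + d) <=
  (1 - d) * \prod_(i <- r) c i + d * \prod_(i <- r) (c i + 1).
Proof.
move=> /andP[d0 d1] c0; elim: r => [|i r IH]; first by rewrite !big_nil; lra.
rewrite !big_cons; set X0 := \prod_(j <- r) c j in IH *.
set X1 := \prod_(j <- r) (c j + 1) in IH *; set X := \prod_(j <- r) (c j + d) in IH *.
have X01 : X0 <= X1.
  by apply: ler_prod => j _; rewrite c0 lerDl ler01.
have ci := c0 i; have cd0 : 0 <= c i + d by rewrite addr_ge0.
apply: (le_trans (ler_wpM2l cd0 IH)).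
have : 0 <= d * (1 - d) * (X1 - X0) by rewrite !mulr_ge0 ?subr_ge0.
lra.
Qed.

Definition enlarged (b c : spacetime R n) (d : R) : set (spacetime R n) :=
  box (b.1 - const_mx d, b.2 - d) (c.1 + const_mx d, c.2 + d).

Lemma enlarged_volume_le (b c : spacetime R n) :
  exists2 V1, 0 <= V1 & forall d, 0 <= 2 * d <= 1 ->
    (mu (enlarged b c d) <= (box_volume b c + 2 * d * V1)%:E)%E.
Proof.
pose w (i : option 'I_n) : R := if i is Some i then Num.max (c.1 0 i - b.1 0 i) 0
  else Num.max (c.2 - b.2) 0.
have w0 i : 0 <= w i by case: i => [i|]; rewrite /w le_max lexx orbT.
pose r := rcons [seq Some i | i <- enum 'I_n] None.
have bigE (F : option 'I_n -> R) : \prod_(i <- r) F i = (\prod_(i < n) F (Some i)) * F None.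
  by rewrite big_rcons/= big_map big_enum/=.
have V0E : box_volume b c = \prod_(i <- r) w i by rewrite bigE.
exists (\prod_(i <- r) (w i + 1)); first by apply: prodr_ge0 => i _; rewrite addr_ge0.
move=> d /andP[d0 d1]; rewrite mu_box lee_fin.
have := @prod_shift_le _ r w (2 * d) _ w0; rewrite d0 d1 => /(_ isT); rewrite -V0E => le.
have V00 : 0 <= box_volume b c by exact: box_volume_ge0.
have dV : 0 <= 2 * d * box_volume b c by rewrite mulr_ge0.
apply: (@le_trans _ _ (\prod_(i <- r) (w i + 2 * d))); last by lra.
have maxle (u v : R) : Num.max (v + d - (u - d)) 0 <= Num.max (v - u) 0 + 2 * d.
  rewrite ge_max; apply/andP; split; last by rewrite addr_ge0// le_max lexx orbT.
  have : v - u <= Num.max (v - u) 0 by rewrite le_max lexx.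
  lra.
rewrite bigE /box_volume /= ler_pM//.
- by apply: prodr_ge0 => i _; rewrite le_max lexx orbT.
- by rewrite le_max lexx orbT.
- by apply: ler_prod => i _; rewrite le_max lexx orbT/= !mxE maxle.
Qed.

Lemma cell_sub_enlarged (b c : spacetime R n) d P z : l (gen P) <= d -> tau (gen P) <= d ->
  cell P z -> box b c z -> cell P `<=` enlarged b c d.
Proof.
move=> ld td [Pz /=/andP[Pt1 Pt2]] [bz /andP[bt1 bt2]] y [Py /=/andP[y1 y2]].
split=> [i|] /=; last by apply/andP; split; lra.
have /andP[p1 p2] := Pz i; have /andP[p3 p4] := bz i; have /andP[p5 p6] := Py i.
by move: p1 p2 p5 p6; rewrite /= !mxE => *; apply/andP; split; lra.
Qed.

Section differentiation.
Variables (E : set (spacetime R n)) (g : spacetime R n -> \bar R) (A : R) (i0 : nat).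
Hypothesis mE : measurable E.
Hypothesis mg : measurable_fun setT g.
Hypothesis g_ge0 : forall z, (0 <= g z)%E.
Hypothesis A_gt0 : 0 < A.
Hypothesis cell_bound : forall P z, (i0 <= gen P)%N -> cell P z -> E z ->
  (\int[mu]_(z in cell P) g z <= (A * cell_vol P)%:E)%E.

(** Cells of a late generation that meet the box stay in its enlargement by [d], whose volume tends
    to that of the box. *)
Lemma box_bound (b c : spacetime R n) :
  (\int[mu]_(z in E `&` box b c) g z <= (A * box_volume b c)%:E)%E.
Proof.
have [V1 V10 VP] := enlarged_volume_le b c.
have A0 := A_gt0; have AV1 : 0 <= A * V1 by rewrite mulr_ge0// ltW.
apply/lee_addgt0Pr => e e0.
pose d := Num.min (1 / 2) (e / (2 * (A * V1 + 1))).
have d0 : 0 < d by rewrite lt_min divr_gt0// divr_gt0// mulr_gt0//; lra.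
have d1 : 2 * d <= 1.
  have : d <= 1 / 2 by rewrite ge_min lexx.
  lra.
have dE : 2 * d * (A * V1) <= e.
  have h : d <= e / (2 * (A * V1 + 1)) by rewrite ge_min lexx orbT.
  rewrite ler_pdivlMr in h; last by rewrite mulr_gt0//; lra.
  lra.
have [i1 i1P] := cells_shrink _ d0.
have [ld td] := i1P (maxn i0 i1) (leq_maxr _ _).
have mEB : measurable (E `&` box b c) by apply: measurableI => //; exact: measurable_box.
apply: (le_trans (@integral_le_cells _ (enlarged b c d) g A (maxn i0 i1) mEB _ mg g_ge0 (ltW A0) _ _)).
- exact: measurable_box.
- by move=> P z gP Pz [_ Bz]; apply: (cell_sub_enlarged _ _ _ _ _ _ _ Pz Bz); rewrite gP.
- by move=> P z gP Pz [Ez _]; apply: (cell_bound P z) => //; rewrite gP leq_maxl.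
apply: (@le_trans _ _ (A%:E * (box_volume b c + 2 * d * V1)%:E)%E).
  by rewrite lee_wpmul2l ?lee_fin ?(ltW A0)//; apply: VP; rewrite d1 mulr_ge0// ltW.
by rewrite -EFinM -EFinD lee_fin; lra.
Qed.

(* The substitute for Lebesgue's differentiation theorem: bounds on the averages
   of [g] over all small cells meeting [E] pass to boxes, and then, by definition
   of the outer measure, to [E] itself. *)
Lemma cell_differentiation : (forall z, E z -> ((A + 1)%:E <= g z)%E) ->
  (mu E < +oo)%E -> mu E = 0%E.
Proof.
move=> gE Efin; have A0 := A_gt0.
have A1 : 0 < A + 1 by lra.
have Ef : mu E \is a fin_num by rewrite ge0_fin_numE// spacetime_outer_ge0.
(* As [g] is at least [A + 1] on [E], the set [E] fills at most the fraction [A / (A + 1)] of each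
   box; summing over a cover and taking the infimum over covers gives the claim. *)
have key : (((A + 1) / A)%:E * mu E <= mu E)%E.
  rewrite [leRHS]/spacetime_lebesgue; apply: le_ereal_inf_tmp => _ [u Eu <-].
  pose F k := E `&` box (u k).1 (u k).2.
  have mF k : measurable (F k) by apply: measurableI => //; exact: measurable_box.
  have EF : (mu E <= \sum_(k <oo) mu (F k))%E.
    apply: le_trans (spacetime_outer_sigma_subadditive F).
    by apply: le_spacetime_outer => z Ez; have [k _ zk] := Eu z Ez; exists k.
  have FV k : ((A + 1)%:E * mu (F k) <= A%:E * (box_volume (u k).1 (u k).2)%:E)%E.
    apply: le_trans (box_bound (u k).1 (u k).2).
    have <- : (\int[mu]_(z in F k) (cst (A + 1)%:E z) = (A + 1)%:E * mu (F k))%E.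
      by rewrite integral_cst.
    apply: ge0_le_integral => //.
    - by move=> z _; rewrite lee_fin ltW.
    - exact: measurable_funS mg.
    - by move=> z [Ez _]; exact: gE.
  have V0 k : (0 <= (box_volume (u k).1 (u k).2)%:E)%E by rewrite lee_fin box_volume_ge0.
  rewrite mulrC EFinM -muleA.
  apply: (@le_trans _ _ (A^-1%:E * (A%:E * \sum_(k <oo) (box_volume (u k).1 (u k).2)%:E))%E).
    rewrite lee_wpmul2l ?lee_fin ?invr_ge0 ?(ltW A0)//.
    apply: (@le_trans _ _ ((A + 1)%:E * \sum_(k <oo) mu (F k))%E).
      by rewrite lee_wpmul2l// lee_fin ltW.
    rewrite -!nneseriesZl//.
    by apply: lee_nneseries => k _ //; rewrite mule_ge0// ?lee_fin ?(ltW A1)//; exact: spacetime_outer_ge0.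
  by rewrite muleA -EFinM mulVf ?gt_eqF// mul1e.
have m0 : (0 <= mu E)%E by exact: spacetime_outer_ge0.
move: key m0; rewrite -(fineK Ef) -EFinM !lee_fin => key m0.
congr EFin; apply/eqP; rewrite eq_le m0 andbT.
have e1 : (A + 1) / A = 1 + A^-1 by field; rewrite gt_eqF.
rewrite e1 in key; have : 0 < A^-1 by rewrite invr_gt0.
rewrite leNgt => Ai; apply/negP => mpos; have := mulr_gt0 Ai mpos; lra.
Qed.

End differentiation.

(** * Stopped cells inside a fixed cell *)

Section stopped.
Variables (Q : cell_index) (a : R).

Definition stopped P : Prop :=
  [/\ (gen Q < gen P)%N, cell P `<=` cell Q, cell_cst Q + a < cell_cst P &
    forall P', (gen Q < gen P' < gen P)%N -> cell P `<=` cell P' ->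
      cell_cst P' <= cell_cst Q + a].

Lemma stopped_inj P P' z : stopped P -> stopped P' -> cell P z -> cell P' z -> P = P'.
Proof.
wlog PP' : P P' / (gen P <= gen P')%N.
  move=> W sP sP' Pz P'z; case: (leqP (gen P) (gen P')) => [h|/ltnW h]; first exact: W.
  by apply/esym; exact: W.
move=> [QP PQ cP mP] [QP' P'Q cP' mP'] Pz P'z.
move: PP'; rewrite leq_eqVlt => /predU1P[e|PP'].
  exact: cell_inj Pz P'z.
have := mP' P; rewrite QP PP' => /(_ isT) h.
have : cell_cst P <= cell_cst Q + a.
  by apply: h; exact: (cell_subset _ _ _ (ltnW PP') P'z Pz).
by rewrite leNgt cP.
Qed.

Lemma unstopped_cst z : cell Q z -> (forall P, stopped P -> ~ cell P z) ->
  forall P, (gen Q < gen P)%N -> cell P z -> cell_cst P <= cell_cst Q + a.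
Proof.
move=> Qz ns P; have [m] := ubnP (gen P); elim: m P => // m IH P; rewrite ltnS => Pm QP Pz.
rewrite leNgt; apply/negP => cP; apply: (ns P) => //; split => //.
  exact: (cell_subset _ _ _ (ltnW QP) Pz Qz).
move=> P' /andP[QP' P'P] PP'; apply: IH => //; first exact: leq_trans Pm.
exact: PP'.
Qed.

Hypothesis a_ge0 : 0 <= a.

(** The parent of [P] is [Q] itself or an ancestor at which the threshold was not exceeded, and one
    generation adds at most [D * N]. *)
Lemma stopped_cst_le P : stopped P -> cell_cst P <= cell_cst Q + a + D * N.
Proof.
move=> [QP PQ cP mP]; have zP := cell_corner P.
have [P' gP' zP'] := cell_exists (gen P).-1 (corner P, cell_bottom P).
have gP : gen P = (gen P').+1 by rewrite gP' prednK// (leq_ltn_trans _ QP).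
apply: (le_trans (child_cst_le _ _ _ gP zP zP')); rewrite lerD2r.
move: QP; rewrite gP ltnS leq_eqVlt => /predU1P[e|QP'].
  by rewrite (cell_inj _ _ _ (esym e) zP' (PQ _ zP)) lerDl.
apply: mP; first by rewrite QP' gP ltnS leqnn.
by apply: (cell_subset _ _ _ _ zP zP'); rewrite gP.
Qed.

(** The mean of [f] over [cell_upper P] is [cell_cst P] by definition. *)
Lemma stopped_excess P : stopped P ->
  ((a * (l (gen P) ^+ n * H (gen P)))%:E <= \int[mu]_(z in cell_upper P) excess Q z)%E.
Proof.
move=> [QP PQ cP _]; have V := grid_volume_gt0 (gen P).
have mU : measurable (cell_upper P) by exact: measurable_box.
have fI : mu.-integrable (cell_upper P) (EFin \o f) by exact: integrable_box.
have cI : mu.-integrable (cell_upper P) (EFin \o cst (cell_cst Q)) by exact: integrable_cst_box.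
have eI : mu.-integrable (cell_upper P) (excess Q) by exact: integrable_positive_part.
have -> : (\int[mu]_(z in cell_upper P) excess Q z =
    (\int[mu]_(z in cell_upper P) positive_part (f z - cell_cst Q))%R%:E)%E.
  by rewrite /Rintegral fineK// integrable_fin_num.
rewrite lee_fin.
apply: (le_trans (y := \int[mu]_(z in cell_upper P) (f z - cst (cell_cst Q) z))); last first.
  apply: le_Rintegral => //; first exact: (integrableB mU fI cI).
  by move=> z _; rewrite /positive_part le_max lexx.
rewrite RintegralB// Rintegral_cst//.
have -> : fine ((mu : {measure set _ -> \bar R}) (cell_upper P)) = l (gen P) ^+ n * H (gen P).
  exact: (congr1 fine (cell_upper_measure P)).
have -> : \int[mu]_(z in cell_upper P) f z = cell_cst P * (l (gen P) ^+ n * H (gen P)).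
  by rewrite /cell_cst /upper_average divfK// gt_eqF.
by rewrite -mulrBl ler_pM2r//; lra.
Qed.

Lemma sum_disjoint_cells (s : seq cell_index) (X : set (spacetime R n)) :
  measurable X -> uniq s -> (forall P, P \in s -> stopped P) ->
  (forall P, P \in s -> cell P `<=` X) ->
  ((\sum_(P <- s) cell_vol P)%:E <= mu X)%E.
Proof.
move=> + + + +; elim: s X => [|P s IH] X mX; first by rewrite big_nil.
move=> /= /andP[Ps us] sP PX; have mP : measurable (cell P) by exact: measurable_box.
have PsubX : cell P `<=` X by apply: PX; rewrite mem_head.
rewrite big_cons -(setDUK PsubX).
have -> : mu (cell P `|` X `\` cell P) = (mu (cell P) + mu (X `\` cell P))%E.
  apply: (measureU (mu : {measure set _ -> \bar R})) => //; first exact: measurableD.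
  by rewrite setDIK.
rewrite EFinD cell_measure leeD2l//; apply: IH => //.
- exact: measurableD.
- by move=> P' P's; apply: sP; rewrite inE P's orbT.
- move=> P' P's z P'z; split; first by apply: (PX P') => //; rewrite inE P's orbT.
  move=> Pz; move: Ps; rewrite (_ : P = P') ?P's//.
  by apply: (stopped_inj _ _ z) => //; apply: sP; rewrite ?mem_head// inE P's orbT.
Qed.

Lemma seq_min_gen (s : seq cell_index) : s != [::] ->
  exists2 P, P \in s & forall P', P' \in s -> (gen P <= gen P')%N.
Proof.
elim: s => // P s IH _; have [->|/IH[P0 P0s P0P]] := eqVneq s [::].
  by exists P; [exact: mem_head|move=> P'; rewrite inE => /eqP ->].
have [h|/ltnW h] := leqP (gen P) (gen P0).
  exists P; first exact: mem_head.
  move=> P'; rewrite inE => /predU1P[->//|/P0P]; exact: leq_trans.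
exists P0; first by rewrite inE P0s orbT.
by move=> P'; rewrite inE => /predU1P[->//|/P0P].
Qed.

(* Vitali's selection, by induction on the number of cells: a largest cell [P1]
   is kept, and the cells whose upper part meets that of [P1] are discarded. *)
Lemma stopped_weak_type (s : seq cell_index) (W : set (spacetime R n)) :
  measurable W -> uniq s -> (forall P, P \in s -> stopped P) ->
  (forall P, P \in s -> cell_upper P `<=` W) ->
  ((a * \sum_(P <- s) cell_vol P)%:E <=
     (2 * kappa + 3)%:E * \int[mu]_(z in W) excess Q z)%E.
Proof.
have kp := kappa_gt1.
have k30 : (0 <= (2 * kappa + 3)%:E)%E by rewrite lee_fin; lra.
have [m] := ubnP (size s); elim: m s W => // m IH s W; rewrite ltnS => sm mW us sP sW.
have [->|s0] := eqVneq s [::].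
  rewrite big_nil mulr0 mule_ge0//; apply: integral_ge0 => z _; exact: excess_ge0.
have [P1 P1s P1min] := seq_min_gen _ s0.
pose conf P := `[< cell_upper P `&` cell_upper P1 !=set0 >].
have confP1 : conf P1.
  apply/asboolP; exists (corner P1, cell_bottom P1 + kappa * H (gen P1)).
  have h : cell_upper P1 (corner P1, cell_bottom P1 + kappa * H (gen P1)).
    by split=> /= [i|]; rewrite lexx/= ?ltrDl ?grid_H_gt0// /top_corner !mxE ltrDl.
  by split.
have V1 := grid_volume_gt0 (gen P1).
have mU : measurable (cell_upper P1) by exact: measurable_box.
have UW : cell_upper P1 `<=` W by exact: sW.
rewrite (bigID conf)/= mulrDr EFinD -(setDUK UW) ge0_integral_setU//; last 4 first.
- exact: measurableD.
- exact: measurable_excess.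
- by move=> z _; exact: excess_ge0.
- by rewrite disj_set2E setDIK.
rewrite ge0_muleDr; last 2 first.
- by apply: integral_ge0 => z _; exact: excess_ge0.
- by apply: integral_ge0 => z _; exact: excess_ge0.
apply: leeD.
  rewrite -big_filter.
  have hs := stopped_excess P1 (sP _ P1s).
  (* The discarded cells are disjoint and fit into a box [2 * kappa + 3] times as large as the upper
     part of [P1], where the mean excess is at least [a]. The remaining cells are charged to the
     rest of [W]. *)
  have hd : ((\sum_(P <- [seq P <- s | conf P]) cell_vol P)%:E <=
      mu (box (corner P1, cell_bottom P1 - (kappa + 1) * H (gen P1))%R
        (top_corner P1, cell_bottom P1 + (kappa + 2) * H (gen P1))%R))%E.
    apply: sum_disjoint_cells.
    - exact: measurable_box.
    - exact: filter_uniq.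
    - by move=> P; rewrite mem_filter => /andP[_ /sP].
    move=> P; rewrite mem_filter => /andP[/asboolP[z [Pz P1z]] Ps].
    exact: (cell_upper_meet _ _ z (P1min _ Ps)).
  have H1 := grid_H_gt0 (gen P1).
  have kH : 0 < kappa * H (gen P1) by rewrite mulr_gt0// (lt_trans ltr01).
  rewrite mu_box box_volume_edge ?(ltW (l_gt0 _))// in hd; last by lra.
  rewrite lee_fin in hd; apply: le_trans (lee_wpmul2l k30 hs).
  rewrite -EFinM lee_fin; have := ler_wpM2l a_ge0 hd; lra.
rewrite -big_filter; apply: IH.
- rewrite size_filter (leq_trans _ sm)// -(count_predC conf s).
  by rewrite -[ltnLHS]add0n ltn_add2r -has_count; apply/hasP; exists P1.
- exact: measurableD.
- exact: filter_uniq.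
- by move=> P; rewrite mem_filter => /andP[_ /sP].
move=> P; rewrite mem_filter => /andP[/negP nc Ps] z Pz; split; first exact: (sW P).
by move=> P1z; apply: nc; apply/asboolP; exists z.
Qed.

Definition stopped_cell (k : nat) : set (spacetime R n) :=
  if (pickle_inv k : option cell_index) is Some P then
    if `[< stopped P >] then cell P else set0 else set0.

Lemma stopped_cellP k z : stopped_cell k z ->
  exists2 P, stopped P & stopped_cell k = cell P.
Proof.
rewrite /stopped_cell; case: (pickle_inv k) => [P|//].
by case: asboolP => // sP _; exists P.
Qed.

Lemma stopped_cell_exists P : stopped P -> exists k, stopped_cell k = cell P.
Proof.
by move=> sP; exists (pickle P); rewrite /stopped_cell pickleK_inv asboolT.
Qed.

Lemma measurable_stopped_cell k : measurable (stopped_cell k).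
Proof.
have [->//|/set0P[z /stopped_cellP[P _ ->]]] := eqVneq (stopped_cell k) set0.
exact: measurable_box.
Qed.

(** [a] times the sum is at most [(2 * kappa + 3) * N] times the volume of [cell_lower Q], which by
    [tau_ge] is at most 4 times that of the cell; the 8 in [a] leaves one half. *)
Lemma sum_stopped_le : a = 8 * N * (2 * kappa + 3) ->
  (\sum_(k <oo) mu (stopped_cell k) <= (2^-1 * cell_vol Q)%:E)%E.
Proof.
move=> aE; have kp := kappa_gt1; have N0 := N_gt0.
have a0 : 0 < a by rewrite aE !mulr_gt0//; lra.
apply: lime_le.
  by apply: is_cvg_nneseries => k _ _; exact: spacetime_outer_ge0.
apply: nearW => K.
pose pick (k : nat) : option cell_index :=
  if (pickle_inv k : option cell_index) is Some P then
    if `[< stopped P >] then Some P else None else None.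
have pickK : ocancel pick pickle.
  move=> k; rewrite /pick; have := pickle_invK (T := cell_index) k.
  by case: (pickle_inv k) => [P /= Pk|//]; case: ifP.
pose s := pmap pick (index_iota 0 K).
have sE : (\sum_(0 <= k < K) mu (stopped_cell k) = (\sum_(P <- s) cell_vol P)%:E)%E.
  rewrite /s big_pmap -sumEFin; apply: eq_bigr => k _.
  rewrite /stopped_cell /pick; case: (pickle_inv k) => [P|]; last exact: spacetime_outer0.
  by case: ifP => _; [exact: cell_measure|exact: spacetime_outer0].
have us : uniq s by apply: (pmap_uniq pickK); exact: iota_uniq.
have sP P : P \in s -> stopped P.
  rewrite mem_pmap => /mapP[k _]; rewrite /pick.
  by case: (pickle_inv k) => // P'; case: asboolP => // sP' [->].
have mL : measurable (cell_lower Q) by exact: measurable_box.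
have := stopped_weak_type s (cell_lower Q) mL us sP.
have sub P : P \in s -> cell_upper P `<=` cell_lower Q.
  move=> /sP[QP PQ _ _]; have zP := cell_corner P.
  exact: (cell_upper_subset _ _ _ QP zP (PQ _ zP)).
move=> /(_ sub) h; rewrite sE lee_fin.
have k30 : (0 <= (2 * kappa + 3)%:E)%E by rewrite lee_fin; lra.
have := le_trans h (lee_wpmul2l k30 (excess_le Q _ mL (@subset_refl _ _))).
rewrite -EFinM lee_fin => h2; rewrite -(ler_pM2l a0); apply: (le_trans h2).
have := tau_ge (gen Q); have ln : 0 < l (gen Q) ^+ n by rewrite exprn_gt0.
move=> /(ler_wpM2l (ltW ln)) h3.
have c0 : 0 <= (2 * kappa + 3) * N by rewrite mulr_ge0; lra.
have := ler_wpM2l c0 h3; rewrite aE /cell_vol; lra.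
Qed.

End stopped.

(* With this threshold the stopping cells fill at most half of [Q], and their
   constants exceed that of [Q] by at most [increment]. *)
Definition threshold : R := 8 * N * (2 * kappa + 3).
Definition increment : R := 4 * N + threshold + 1 + `|D| * N.

Lemma threshold_gt0 : 0 < threshold.
Proof. by have kp := kappa_gt1; have N0 := N_gt0; rewrite /threshold !mulr_gt0//; lra. Qed.

Lemma increment_gt0 : 0 < increment.
Proof.
have := threshold_gt0; have := mulr_ge0 (normr_ge0 D) (ltW N_gt0).
by have := N_gt0; rewrite /increment; lra.
Qed.

(** A cell of later generation than [Q] that meets the set has constant at most
    [cell_cst Q + threshold], so the mean of the excess over it is at most [A = 4 * N + threshold],
    with 4 from [tau_ge]. On the set itself the excess is at least [A + 1]; this is the 1 in
    [increment]. *)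
Lemma unstopped_null Q : mu (cell Q `&` [set z | increment - `|D| * N <= f z - cell_cst Q] `\`
   \bigcup_k stopped_cell Q threshold k) = 0%E.
Proof.
have N0 := N_gt0; have T0 := threshold_gt0.
set E := _ `\` _.
have mE : measurable E.
  apply: measurableD; last by apply: bigcup_measurable => k _; exact: measurable_stopped_cell.
  apply: measurableI; first exact: measurable_box.
  have := f_L1loc.1 measurableT `[increment - `|D| * N + cell_cst Q, +oo[%classic.
  rewrite setTI => /(_ (measurable_itv _)); congr measurable.
  by apply/seteqP; split => z /=; rewrite in_itv/= andbT lerBrDr.
apply: (@cell_differentiation E (excess Q) (4 * N + threshold) (gen Q).+1) => //.
- exact: measurable_excess.
- exact: excess_ge0.
- lra.
- move=> P z QP Pz [[Qz _] ns].
  have cP : cell_cst P <= cell_cst Q + threshold.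
    apply: (unstopped_cst Q threshold z) => // P' sP' P'z; apply: ns.
    by have [k kP] := stopped_cell_exists _ _ _ sP'; exists k => //; rewrite kP.
  have mP : measurable (cell P) by exact: measurable_box.
  apply: (@le_trans _ _ (\int[mu]_(z in cell P) (excess P z + cst threshold%:E z))%E).
    apply: ge0_le_integral.
    - exact: mP.
    - by move=> y _; exact: excess_ge0.
    - exact: measurable_excess.
    - by apply: emeasurable_funD; [exact: measurable_excess|exact: measurable_cst].
    move=> y _; rewrite /excess /= -EFinD lee_fin /positive_part ge_max.
    have h1 : f y - cell_cst P <= Num.max (f y - cell_cst P) 0 by rewrite le_max lexx.
    have h2 : 0 <= Num.max (f y - cell_cst P) 0 by rewrite le_max lexx orbT.
    by apply/andP; split; lra.
  rewrite ge0_integralD//; last 3 first.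
  - by move=> y _; exact: excess_ge0.
  - exact: measurable_excess.
  - by move=> y _; rewrite lee_fin ltW.
  rewrite integral_cst//.
  have -> : (threshold%:E * (mu : {measure set _ -> \bar R}) (cell P) = (threshold * cell_vol P)%:E)%E.
    by rewrite [RHS]EFinM; congr (_ * _)%E; exact: cell_measure.
  rewrite mulrDl EFinD leeD2r//.
  apply: (le_trans (excess_le P _ mP (@cell_sub_lower P))).
  rewrite lee_fin /cell_vol; have ln : 0 < l (gen P) ^+ n by rewrite exprn_gt0.
  have := ler_wpM2l (ltW ln) (tau_ge (gen P)) => h3.
  have := ler_wpM2l (ltW N0) h3; lra.
- move=> z [[_ /=]]; rewrite /increment => h _; rewrite lee_fin /positive_part le_max.
  by apply/orP; left; lra.
have EQ : E `<=` cell Q by move=> z [[]].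
apply: (le_lt_trans (le_spacetime_outer EQ)).
by rewrite [X in (X < _)%E](cell_measure Q) ltry.
Qed.

(** Induction on [k] for all cells at once. Outside of the stopped cells only a null set is
    concerned; inside a stopped cell [P], replacing the constant of [Q] by that of [P] uses up at
    most one [increment], and the stopped cells have half the volume. *)
Lemma cell_john_nirenberg k Q :
  (mu (cell Q `&` [set z | (k%:R * increment < f z - cell_cst Q)%R]) <=
    (2^-1 ^+ k * cell_vol Q)%:E)%E.
Proof.
have I0 := increment_gt0; have T0 := threshold_gt0.
elim: k Q => [|k IH] Q.
  rewrite expr0 mul1r -cell_measure; apply: le_spacetime_outer; exact: subIsetl.
pose F := stopped_cell Q threshold.
set X := _ `&` _; pose E := cell Q `&` [set z | increment - `|D| * N <= f z - cell_cst Q] `\`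
   \bigcup_k F k.
have XE : X `<=` E `|` \bigcup_k (F k `&` X).
  move=> z [Qz /= Xz]; have [[j _ Fz]|nF] := pselect ((\bigcup_k F k) z).
    by right; exists j.
  left; split=> //; split=> //=.
  have := mulr_ge0 (normr_ge0 D) (ltW N_gt0).
  have : 0 <= k%:R * increment by rewrite mulr_ge0// ltW.
  have e : k.+1%:R * increment = k%:R * increment + increment by rewrite -natr1; lra.
  rewrite e in Xz; lra.
apply: (le_trans (le_spacetime_outer XE)).
apply: (le_trans (outer_measureU2 _ _ _)).
rewrite [X in (X + _)%E](_ : _ = 0%E) ?add0e; last exact: unstopped_null.
apply: (le_trans (spacetime_outer_sigma_subadditive _)).
apply: (@le_trans _ _ (\sum_(j <oo) ((2^-1 ^+ k)%:E * mu (F j)))%E).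
  apply: lee_nneseries => [j _ _|j _]; first exact: spacetime_outer_ge0.
  have [F0|/set0P[z Fz]] := eqVneq (F j) set0.
    by rewrite F0 set0I spacetime_outer0 mule_ge0// ?spacetime_outer_ge0// lee_fin exprn_ge0.
  have [P sP FP] := stopped_cellP _ _ _ _ Fz.
  have {}FP : F j = cell P := FP.
  rewrite FP cell_measure -EFinM; apply: le_trans (IH P).
  apply: le_spacetime_outer => y [Py [Qy /= Xy]]; split => //=.
  have := stopped_cst_le Q threshold (ltW T0) P sP.
  have : D * N <= `|D| * N by rewrite ler_wpM2r ?(ltW N_gt0)// ler_norm.
  have e : k.+1%:R * increment = k%:R * increment + increment by rewrite -natr1; lra.
  rewrite e in Xy; have := N_gt0; move: Xy; rewrite {2}/increment; lra.
rewrite nneseriesZl; last by move=> j _; exact: spacetime_outer_ge0.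
apply: le_trans (lee_wpmul2l _ (sum_stopped_le Q threshold _ erefl)) _.
- by rewrite lee_fin exprn_ge0.
- exact: ltW.
by rewrite -EFinM lee_fin exprSr mulrA.
Qed.

End grid.

(* Edges are divided by a fixed power of 2; since l ^ p is then divided by a
   number which need not be an integer, the number of subdivisions in time
   is the largest power of 2 below it. *)
Lemma parabolic_grid_exists (R : realType) (n : nat) (p gamma : R) : 1 < p -> 0 < gamma -> gamma < 1 ->
  exists D : R, forall L : R, 0 < L ->
  exists l tau : nat -> R, l 0%N = L /\ [/\ forall i, 0 < l i,
    forall i j, (i <= j)%N -> exists2 m : nat, (0 < m)%N & l i = m%:R * l j,
    forall i j, (i <= j)%N -> exists2 m : nat, (0 < m)%N & tau i = m%:R * tau j,
    forall i, 2 * tau i <= height p gamma (l i) &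
    forall i, height p gamma (l i) <= 4 * tau i] /\
  [/\ forall i j, (i < j)%N ->
      2 * ((lag gamma + 1) * height p gamma (l j)) <= height p gamma (l i),
    forall i, l i ^+ n * height p gamma (l i) <=
      D * (l i.+1 ^+ n * height p gamma (l i.+1)) &
    forall eps, 0 < eps -> exists i0, forall i, (i0 <= i)%N -> l i <= eps /\ tau i <= eps].
Proof.
move=> p1 g0 g1.
have [q qE] : exists q : R, q = 2 `^ p by exists (2 `^ p).
have q2 : 2 < q by rewrite qE; exact: two_lt_powR.
have q0 : 0 < q by lra.
have g10 : 0 < 1 - gamma by lra.
have [kap kE] : exists kap, kap = lag gamma by exists (lag gamma).
have kap1 : 1 <= kap by rewrite kE /lag ler_pdivlMr//; lra.
(* Edges are divided by [2 ^ s], hence heights by [q ^ s], which has to be at least [2 * (kap + 1)]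
   for lag and height of a finer cell to fit. *)
pose s := (Num.truncn (2 * (kap + 1))).+1.
have sP : 2 * (kap + 1) <= q ^+ s.
  apply: (le_trans (ltW (truncnS_gt _))); apply: (@le_trans _ _ (2 ^+ s)).
    by rewrite -natrX ler_nat ltnW// ltn_expl.
  by rewrite lerXn2r ?nnegrE ?(ltW q0)// ltW.
exists (2 ^+ (s * n) * q ^+ s) => L L0.
pose l i : R := L / 2 ^+ (s * i).
(* Rounding the exponent loses a factor of at most 2; with the factor [1 / 4] in [tau] this becomes
   [2 * tau <= H <= 4 * tau]. Monotonicity of [e] yields the nesting in time. *)
pose e i := Num.truncn (p * (s * i)%:R).
pose tau i : R := (1 - gamma) / 4 * L `^ p / 2 ^+ (e i).
have p0 : 0 <= p by lra.
have eP i : 2 ^+ e i <= q ^+ (s * i) /\ q ^+ (s * i) <= 2 * 2 ^+ e i.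
  have psi0 : 0 <= p * (s * i)%:R by rewrite mulr_ge0.
  have qpow : q ^+ (s * i) = 2 `^ (p * (s * i)%:R).
    by rewrite powRrM -qE powR_mulrn// ltW.
  have mono : {homo (fun y : R => 2 `^ y) : x y / x <= y}.
    by apply: ler_powR; rewrite ler1n.
  rewrite qpow; split.
    by rewrite -powR_mulrn//; apply: mono; rewrite /e truncn_le.
  by rewrite -exprS -powR_mulrn//; apply: mono; rewrite ltW// truncnS_gt.
have e_mono i j : (i <= j)%N -> (e i <= e j)%N.
  by move=> ij; rewrite /e le_truncn// ler_wpM2l// ler_nat leq_mul2l ij orbT.
have hE i : height p gamma (l i) = (1 - gamma) * L `^ p / q ^+ (s * i).
  by rewrite /height /l powR_div_pow2// -qE mulrA.
have Lp0 : 0 < L `^ p by rewrite powR_gt0.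
have l0 i : 0 < l i by rewrite divr_gt0// exprn_gt0.
have h0 i : 0 < height p gamma (l i) by exact: height_gt0.
have e0 i : (0 : R) < 2 ^+ e i by rewrite exprn_gt0.
have qs0 i : 0 < q ^+ (s * i) by rewrite exprn_gt0.
have c0 : 0 < (1 - gamma) * L `^ p by rewrite mulr_gt0.
have hstep i : height p gamma (l i) = q ^+ s * height p gamma (l i.+1).
  by rewrite !hE mulnS exprD; field; rewrite !gt_eqF// ?exprn_gt0.
exists l, tau; split; first by rewrite /l muln0 expr0 divr1.
split; split => //.
- move=> i j ij; exists (2 ^ (s * (j - i)))%N; first by rewrite expn_gt0.
  rewrite /l natrX -[in RHS](subnKC ij) mulnDr addKn exprD; field.
  by rewrite !gt_eqF// exprn_gt0.
- move=> i j ij; exists (2 ^ (e j - e i))%N; first by rewrite expn_gt0.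
  rewrite /tau natrX -{2}(subnKC (e_mono _ _ ij)) exprD; field.
  by rewrite !gt_eqF// exprn_gt0.
- move=> i; have [_ h] := eP i; rewrite hE /tau ler_pdivlMr//.
  have -> : 2 * ((1 - gamma) / 4 * L `^ p / 2 ^+ e i) * q ^+ (s * i) =
    (1 - gamma) * L `^ p * (q ^+ (s * i) / (2 * 2 ^+ e i)) by field; rewrite gt_eqF.
  by rewrite ger_pMr// ler_pdivrMr ?mulr_gt0// mul1r.
- move=> i; have [h _] := eP i; rewrite hE /tau ler_pdivrMr//.
  have -> : 4 * ((1 - gamma) / 4 * L `^ p / 2 ^+ e i) * q ^+ (s * i) =
    (1 - gamma) * L `^ p * (q ^+ (s * i) / 2 ^+ e i) by field; rewrite gt_eqF.
  by rewrite ler_peMr ?(ltW c0)// ler_pdivlMr// mul1r.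
- move=> i j ij; rewrite -kE.
  have : height p gamma (l j) <= height p gamma (l i.+1).
    rewrite !hE ler_wpM2l ?(ltW c0)// lef_pV2 ?posrE//.
    by rewrite ler_weXn2l ?leq_mul2l ?ij ?orbT//; lra.
  move=> hij; rewrite [leRHS](hstep i) mulrA.
  have k0 : 0 <= 2 * (kap + 1) by lra.
  apply: (le_trans (ler_wpM2l k0 hij)).
  by rewrite ler_wpM2r ?(ltW (h0 _)).
- move=> i; rewrite (hstep i).
  have -> : l i = 2 ^+ s * l i.+1.
    by rewrite /l mulnS exprD; field; rewrite !gt_eqF// exprn_gt0.
  by rewrite exprMn -exprM le_eqVlt; apply/orP; left; apply/eqP; ring.
- move=> eps eps0; pose M := Num.max L ((1 - gamma) * L `^ p).
  exists (Num.truncn (M / eps)).+1 => i ii.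
  have Mi : M / eps <= 2 ^+ i.
    apply: (le_trans (ltW (truncnS_gt _))); rewrite -natrX ler_nat.
    by rewrite (leq_trans ii)// ltnW// ltn_expl.
  rewrite ler_pdivrMr// in Mi.
  have i20 : (0 : R) < 2 ^+ i by rewrite exprn_gt0.
  have M1 : L <= M by rewrite le_max lexx.
  have M2 : (1 - gamma) * L `^ p <= M by rewrite le_max lexx orbT.
  have ie : (2 : R) ^+ i <= 2 ^+ e i.
    rewrite ler_weXn2l ?ler1n// /e truncn_ge_nat; last by rewrite mulr_ge0.
    apply: (@le_trans _ _ (1 * (s * i)%:R)); last by rewrite ler_wpM2r// ltW.
    by rewrite mul1r ler_nat leq_pmull.
  have is' : (2 : R) ^+ i <= 2 ^+ (s * i) by rewrite ler_weXn2l ?ler1n// leq_pmull.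
  split.
    rewrite /l ler_pdivrMr ?exprn_gt0//; apply: (le_trans M1); apply: (le_trans Mi).
    by rewrite mulrC ler_wpM2l// ltW.
  rewrite /tau ler_pdivrMr//.
  apply: (@le_trans _ _ (2 ^+ i * eps)); first by lra.
  by rewrite mulrC ler_wpM2l// ltW.
Qed.

(** * Equivalence of the three conditions *)

Section equivalence.
Context {R : realType} {n : nat}.
Local Notation mu := (@spacetime_lebesgue R n).
Implicit Types (f : spacetime R n -> R) (P : parabolic_rectangle R n).

Lemma half_expn_le (k : nat) (y : R) : y <= k.+1%:R -> 2^-1 ^+ k <= 2 * expR (- (ln 2 * y)).
Proof.
move=> yk; have l2 : 0 <= ln 2 :> R by rewrite ln_ge0// ler1n.
have h : expR (ln 2 * y) <= 2 ^+ k.+1.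
  rewrite -[X in X ^+ _](@lnK R 2) ?posrE// -expRM_natl ler_expR mulrC.
  by rewrite ler_wpM2r.
have e0 : 0 < expR (ln 2 * y) by exact: expR_gt0.
rewrite exprVn expRN -[leLHS]mul1r ler_pdivrMr ?exprn_gt0//.
by rewrite mulrAC ler_pdivlMr// mul1r -exprS.
Qed.

Lemma measurable_lower_part p gamma P : measurable (lower_part p gamma P : set (spacetime R n)).
Proof. by case: P => x t L L0; rewrite /lower_part cube_itvE; exact: measurable_box. Qed.

Lemma measurable_superlevel f (X : set (spacetime R n)) (c y : R) :
  measurable_fun setT f -> measurable X -> measurable (X `&` [set z | y < f z - c]).
Proof.
move=> mf mX; apply: measurableI => //.
have := mf measurableT `]y + c, +oo[%classic.
rewrite setTI => /(_ (measurable_itv _)); congr measurable.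
by apply/seteqP; split => z /=; rewrite in_itv/= andbT ltrBrDr.
Qed.

Lemma lower_partE p gamma (x : 'rV[R]_n) t L (L0 : 0 < L) :
  lower_part p gamma (ParabolicRectangle x t L0) =
  box (x - const_mx (L / 2), t - L `^ p)
    (x - const_mx (L / 2) + const_mx L, t - L `^ p + height p gamma L) :> set (spacetime R n).
Proof.
rewrite /lower_part cube_itvE; congr (box _ (_, _)).
by rewrite /height; lra.
Qed.

(** The grid starts with cells of edge [L / 2 ^ k0], anchored at the bottom corner of [R^-]. Their
    constants exceed that of [R] by at most [C * N], and inside of them the tails already decay. *)
Lemma john_nirenberg (p gamma N : R) f : 1 < p -> 0 < gamma -> gamma < 1 ->
  L1loc f -> 0 < N -> oscillation_bound p gamma f N ->
  exists A B : R, 0 < A /\ 0 < B /\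
    forall P (lambda : R), 0 < lambda ->
      (mu (lower_part p gamma P `&`
         [set z | (lambda < f z - average (upper_part p gamma P) f)%R]) <=
       (A * expR (- (B * lambda)))%:E * mu (lower_part p gamma P))%E.
Proof.
move=> p1 g0 g1 fL N0 osc.
have [D grid] := @parabolic_grid_exists R n p gamma p1 g0 g1.
have [k0 [C [C0 upper]]] := @lag_upper_average_le R n p gamma p1 g0 g1.
pose K := increment gamma N D.
have K0 : 0 < K by exact: increment_gt0.
have ln2 : 0 < ln 2 :> R by rewrite ln_gt0// ltr1n.
have [B BE] : exists B : R, B = ln 2 / K by exists (ln 2 / K).
have B0 : 0 < B by rewrite BE divr_gt0.
have CN0 : 0 <= C * N by rewrite mulr_ge0// ltW.
(* One factor 2 accounts for rounding [k] down, the other for cells that stick out of [R^-] at the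
   top; the exponential accounts for the shift of [lam] by [C * N]. *)
exists (4 * expR (B * (C * N))), B; split; first by rewrite mulr_gt0 ?expR_gt0.
split=> // -[x t L L0] lam lam0.
rewrite lower_partE average_upper_part//.
set xl := x - const_mx (L / 2); set tl := t - L `^ p.
set c := upper_average p gamma f xl tl L.
set low := box _ _; pose HL := height p gamma L.
have HL0 : 0 < HL by exact: height_gt0.
have Ln0 : 0 < L ^+ n by rewrite exprn_gt0.
have LH : 0 <= L ^+ n * HL := ltW (mulr_gt0 Ln0 HL0).
have mulow : mu low = (L ^+ n * HL)%:E.
  by rewrite mu_box box_volume_edge ?(ltW L0)// ?lerDl ?(ltW HL0)// addrAC subrr add0r.
have mlow : measurable low by exact: measurable_box.
set X := low `&` _.
have mX : measurable X by apply: measurable_superlevel => //; exact: fL.1.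
have Xlow : X `<=` low by exact: subIsetl.
rewrite -mulrA -expRD mulow -EFinM.
have [lamCN|CNlam] := ltP lam (C * N).
  apply: (le_trans (le_spacetime_outer Xlow)); rewrite [X in (X <= _)%E]mulow lee_fin.
  rewrite (ler_peMl LH)//.
  have : 1 <= expR (B * (C * N) - B * lam).
    by rewrite -[leLHS]expR0 ler_expR -mulrBr; apply: mulr_ge0; [exact: ltW|rewrite subr_ge0 ltW].
  lra.
pose l0 := L / (2 ^ k0)%:R.
have l00 : 0 < l0 by rewrite divr_gt0// ltr0n expn_gt0.
have [l [tau [l0E [[l_gt0 l_nest tau_nest tau_le tau_ge] [H_shrink vratio shrink]]]]] := grid l0 l00.
pose k := Num.truncn ((lam - C * N) / K).
have y0 : 0 <= (lam - C * N) / K by apply: divr_ge0; [rewrite subr_ge0|exact: ltW].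
have ky : k%:R * K <= lam - C * N by rewrite -ler_pdivlMr// truncn_le.
have yk : (lam - C * N) / K <= k.+1%:R by rewrite ltW// truncnS_gt.
have JN := cell_john_nirenberg p gamma f g0 g1 l tau xl tl l_gt0 l_nest tau_nest
  tau_le tau_ge H_shrink N D N0 fL osc vratio shrink k.
have tau0 : 0 < tau 0%N by have := tau_ge 0%N; have := height_gt0 p gamma _ g1 (l_gt0 0%N); lra.
have tauH : tau 0%N <= HL.
  have := tau_le 0%N; rewrite l0E /height.
  have : l0 `^ p <= L `^ p.
    rewrite ge0_ler_powR ?nnegrE ?(ltW l00) ?(ltW L0)//; first by lra.
    by rewrite ler_pdivrMr ?ltr0n ?expn_gt0// ler_peMr ?(ltW L0)// ler1n expn_gt0.
  have g10 : 0 <= 1 - gamma by lra.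
  by move=> /(ler_wpM2l g10); rewrite -/(height p gamma L) -/HL; lra.
(* A cell meeting [low] starts below its top and has height [tau 0 <= HL], so doubling the height
   suffices; in space the cells subdivide the base cube exactly. *)
pose big := box (xl, tl) (xl + const_mx L, tl + 2 * HL).
pose g z : \bar R := (\1_X z)%:E.
have mg : measurable_fun setT g by apply/measurable_EFinP; exact: measurable_indic.
have cover := integral_le_cells p gamma g1 l tau xl tl l_gt0 l_nest tau_nest tau_ge X big g
  (2^-1 ^+ k) 0 mX _ mg _ _.
have cst_le Q z : gen Q = 0%N -> cell l tau xl tl Q z -> low z ->
    cell_cst p gamma f l tau xl tl Q <= c + C * N /\ cell l tau xl tl Q `<=` big.
  case: Q => [[i0 j] q]; rewrite /gen /= => -> [zx /= /andP[zt1 zt2]] [lx /= /andP[lt1 lt2]].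
  have int_ge0 (w : int) (d y o : R) : 0 < d -> o <= y -> y < o + w%:~R * d + d -> 0 <= w.
    move=> d0 oy yw; rewrite -ltzD1 -(ltr_int R) -(ltr_pM2r d0) rmorphD/=; clear -oy yw; lra.
  have q0 : 0 <= q by exact: (int_ge0 _ _ _ _ tau0 lt1 zt2).
  have j0 i : 0 <= j 0 i.
    have /andP[_ h1] := zx i; have /andP[h2 _] := lx i.
    by apply: (int_ge0 _ _ _ _ (l_gt0 0%N) h2); move: h1; rewrite !mxE.
  have l0M : (2 ^ k0)%:R * l0 = L by rewrite mulrC divfK// pnatr_eq0 expn_eq0.
  pose jn i := absz (j 0 i).
  have jnE i : (j 0 i)%:~R = (jn i)%:R :> R.
    by rewrite /jn -[in LHS](gez0_abs (j0 i)).
  have jM i : (jn i < 2 ^ k0)%N.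
    have /andP[h1 _] := zx i; have /andP[_ h2] := lx i.
    rewrite -(ltr_nat R) -(ltr_pM2r l00) l0M -jnE -l0E.
    by move: h1 h2; rewrite /corner !mxE/=; clear; lra.
  have qt : 0 <= q%:~R * tau 0%N by apply: mulr_ge0; [rewrite ler0z|exact: ltW].
  pose s := tl + q%:~R * tau 0%N.
  have sP : t - L `^ p <= s <= t - gamma * L `^ p.
    apply/andP; split; first by rewrite /s lerDl.
    apply: (le_trans zt1); apply: ltW; apply: (lt_le_trans lt2).
    by rewrite /HL /height /tl; clear; lra.
  have contr := oscillation_lag_controlled p gamma f N fL g1 osc.
  split.
    have := upper N (box_integral f) (ltW N0) contr L xl t s jn L0 jM sP l0
      (height p gamma l0) erefl erefl.
    rewrite /cell_cst /upper_average /gen /cell_bottom /= -/s l0E.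
    have -> : corner l xl ((0%N, j, q) : cell_index) = \row_i (xl 0 i + (jn i)%:R * l0).
      by apply/rowP => i; rewrite !mxE jnE l0E.
    have -> : \row_i (xl 0 i + (jn i)%:R * l0) + const_mx l0 =
      \row_i (xl 0 i + (jn i)%:R * l0 + l0) by apply/rowP => i; rewrite !mxE.
    rewrite /c /upper_average /tl (lag_height p gamma L)//.
    have -> : t - L `^ p + (1 + gamma) * L `^ p = t + gamma * L `^ p by ring.
    by have -> : t + gamma * L `^ p + height p gamma L = t + L `^ p by rewrite /height; ring.
  move=> y [yx /= /andP[yt1 yt2]]; split=> [i|] /=.
    have /andP[h1 h2] := yx i; move: h1 h2; rewrite /top_corner /corner !mxE/= l0E jnE => h1 h2.
    have h3 : (jn i)%:R * l0 + l0 <= L.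
      rewrite -l0M -[X in _ + X]mul1r -mulrDl ler_pM2r// natr1 ler_nat; exact: jM.
    have h4 : 0 <= (jn i)%:R * l0 by rewrite mulr_ge0// ltW.
    have xE : (xl + const_mx L) 0 i = xl 0 i + L by rewrite !mxE.
    by rewrite /=; clear -h1 h2 h3 h4 xE; apply/andP; split; lra.
  move: yt1 yt2 zt1 lt2; rewrite /cell_bottom /gen /= -/HL.
  move=> yt1 yt2 zt1 lt2; clear -yt1 yt2 zt1 lt2 qt tauH; apply/andP; split; lra.
have : (mu X <= (2^-1 ^+ k)%:E * mu big)%E.
  have -> : mu X = (\int[mu]_(z in X) g z)%E.
    by rewrite /g integral_indic// setIid.
  apply: cover.
  - exact: measurable_box.
  - by move=> z; rewrite /g lee_fin.
  - by rewrite exprn_ge0.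
  - by move=> Q z gQ Qz /Xlow lz; have [] := cst_le Q z gQ Qz lz.
  - move=> Q z gQ Qz /Xlow lz; have [cQ _] := cst_le Q z gQ Qz lz.
    have mQ : measurable (cell l tau xl tl Q) by exact: measurable_box.
    rewrite /g integral_indic//; apply: le_trans (JN Q).
    apply: le_spacetime_outer => y [[_ /= Xy] Qy]; split => //=.
    by rewrite -/K; clear -Xy cQ ky; lra.
have -> : mu big = (L ^+ n * (2 * HL))%:E.
  have tH : tl <= tl + 2 * HL by clear -HL0; lra.
  by rewrite mu_box box_volume_edge ?(ltW L0)// addrAC subrr add0r.
move=> h; apply: (le_trans h).
rewrite -EFinM lee_fin.
have hk := half_expn_le k _ yk.
have e1 : ln 2 * ((lam - C * N) / K) = - (B * (C * N) - B * lam).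
  by rewrite BE; field; rewrite gt_eqF.
rewrite e1 opprK in hk.
have := ler_wpM2r LH hk; clear; lra.
Qed.

(** * Exponential integrability from tail bounds *)

Lemma lower_part_measure (p gamma : R) P : gamma < 1 ->
  exists2 V, 0 < V & mu (lower_part p gamma P) = V%:E.
Proof.
case: P => x t L L0 g1; have H0 := height_gt0 p gamma L g1 L0.
exists (L ^+ n * height p gamma L); first by rewrite mulr_gt0// exprn_gt0.
rewrite lower_partE mu_box box_volume_edge ?(ltW L0)// ?lerDl ?(ltW H0)//.
by rewrite addrAC subrr add0r.
Qed.

Lemma measurable_positive_part f (X : set (spacetime R n)) (c : R) :
  measurable_fun setT f -> measurable_fun X (fun z => positive_part (f z - c)).
Proof.
move=> mf; apply: measurable_funrpos.
by apply: measurable_funB => //; apply: measurable_funS mf.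
Qed.

Lemma geometric_sum_le (q : R) (k : nat) : 0 <= q -> q < 1 ->
  \sum_(i < k) q ^+ i <= (1 - q)^-1.
Proof.
move=> q0 q1; rewrite -[leRHS]mul1r ler_pdivlMr ?subr_gt0//.
have -> : (\sum_(i < k) q ^+ i) * (1 - q) = 1 - q ^+ k.
  rewrite -[in RHS](expr1n R k) subrXX mulrC; congr (_ * _).
  by apply: eq_bigr => i _; rewrite expr1n mul1r.
by rewrite gerBl exprn_ge0.
Qed.

(** Half of the decay rate is spent on the exponential, [d = B / 2]; the other half makes the layers
    sum like a geometric series of ratio [expR (- d)]. *)
Lemma expR_integral_le (f : spacetime R n -> R) (X : set (spacetime R n)) (c A B V : R) :
  measurable_fun setT f -> measurable X -> 0 < A -> 0 < B -> mu X = V%:E ->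
  (forall lambda, 0 < lambda -> (mu (X `&` [set z | (lambda < f z - c)%R]) <=
     (A * expR (- (B * lambda)))%:E * mu X)%E) ->
  (\int[mu]_(z in X) (expR (B / 2 * positive_part (f z - c)))%:E <=
   ((expR (B / 2) + A * expR B / (1 - expR (- (B / 2)))) * V)%:E)%E.
Proof.
move=> mf mX A0 B0 XV tail; pose d := B / 2; have d0 : 0 < d by rewrite divr_gt0.
have V0 : 0 <= V by rewrite -lee_fin -XV spacetime_outer_ge0.
(* The offset [1 / 2] keeps the level positive at [k = 0], as the tail bound demands. A point with
   [t <= y < t.+1] and [1 < y] lies in [S t.-1], whose weight is [expR (d * t.+1)]. *)
pose S (k : nat) := X `&` [set z | (k%:R + 1 / 2 < f z - c)%R].
have mS k : measurable (S k) by exact: measurable_superlevel.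
pose w (k : nat) : R := expR (d * k.+2%:R).
have w0 k : 0 <= w k by exact: expR_ge0.
have pointwise z : X z -> ((expR (d * positive_part (f z - c)))%:E <=
    (expR d)%:E + \sum_(k <oo) (w k * \1_(S k) z)%:E)%E.
  move=> Xz; set y := f z - c.
  have sum0 k : (0 <= (w k * \1_(S k) z)%:E)%E by rewrite lee_fin mulr_ge0.
  have [y1|y1] := leP y 1.
    rewrite -[X in (X <= _)%E]adde0 leeD ?nneseries_ge0// lee_fin ler_expR.
    by rewrite -[leRHS]mulr1 ler_pM2l// /positive_part ge_max y1 ler01.
  pose t := Num.truncn y.
  have t1 : (1 <= t)%N by rewrite truncn_ge_nat// ltW// (lt_trans ltr01).
  have ty : t%:R <= y by rewrite truncn_le ltW// (lt_trans ltr01).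
  have yt : y < t.+1%:R by exact: truncnS_gt.
  have tE : t%:R = t.-1%:R + 1 :> R by rewrite natr1 prednK.
  rewrite -[X in (X <= _)%E]add0e leeD ?lee_fin ?expR_ge0//.
  rewrite (nneseries_split 0 t)//.
  rewrite -[X in (X <= _)%E]adde0 leeD//; last by apply: nneseries_ge0 => k _ _; exact: sum0.
  rewrite add0n -[X in index_iota 0 X](prednK t1) big_nat_recr//=.
  rewrite -[X in (X <= _)%E]add0e leeD//; first by apply: sume_ge0 => k _; exact: sum0.
  have St : S t.-1 z by split => //=; rewrite -/y; lra.
  rewrite lee_fin indicE mem_set// mulr1 ler_expR ler_pM2l// /positive_part.
  by rewrite ge_max ler0n andbT prednK// ltW.
have msum : measurable_fun X (fun z => (\sum_(k <oo) (w k * \1_(S k) z)%:E)%E).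
  apply: ge0_emeasurable_sum => [k z _ _|k _]; first by rewrite lee_fin mulr_ge0.
  by apply/measurable_EFinP; apply: measurable_funM => //; exact: measurable_indic.
apply: (@le_trans _ _ (\int[mu]_(z in X) (cst (expR d)%:E z +
   \sum_(k <oo) (w k * \1_(S k) z)%:E))%E).
  apply: ge0_le_integral.
  - exact: mX.
  - by move=> z _; rewrite lee_fin expR_ge0.
  - apply/measurable_EFinP; apply: measurableT_comp; first exact: measurable_expR.
    apply: measurable_funM; first exact: measurable_cst.
    exact: measurable_positive_part.
  - by apply: emeasurable_funD => //; exact: measurable_cst.
  - by move=> z Xz; exact: pointwise.
rewrite ge0_integralD//; last 2 first.
- by move=> z _; rewrite lee_fin expR_ge0.
- by move=> z _; apply: nneseries_ge0 => k _ _; rewrite lee_fin mulr_ge0.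
rewrite mulrDl EFinD integral_cst//; apply: leeD.
  by rewrite [X in (_ * X <= _)%E]XV -EFinM.
rewrite integral_nneseries//; last 2 first.
- move=> k; apply/measurable_EFinP; apply: measurable_funM => //; exact: measurable_indic.
- by move=> k z _; rewrite lee_fin mulr_ge0.
pose q := expR (- d); have q0 : 0 <= q by exact: expR_ge0.
have q1 : q < 1 by rewrite /q expR_lt1 oppr_lt0.
have C0 : 0 <= A * expR B * V by rewrite mulr_ge0// mulr_ge0 ?expR_ge0// ltW.
apply: (@le_trans _ _ (\sum_(k <oo) (A * expR B * V * q ^+ k)%:E)%E).
  apply: lee_nneseries => [k _ _|k _].
    by apply: integral_ge0 => z _; rewrite lee_fin mulr_ge0.
  under eq_integral => z _ do rewrite EFinM.
  rewrite ge0_integralZl_EFin//; last first.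
    by apply/measurable_EFinP; exact: measurable_indic.
  rewrite integral_indic// (_ : S k `&` X = S k); last first.
    by apply/setIidl => z [].
  have k0 : 0 < k%:R + 1 / 2 :> R by rewrite ltr_wpDl//; lra.
  apply: (@le_trans _ _ ((w k)%:E * ((A * expR (- (B * (k%:R + 1 / 2))))%:E * V%:E))%E).
    by rewrite lee_wpmul2l ?lee_fin// -XV; exact: tail.
  rewrite -!EFinM lee_fin /w /q -expRM_natl.
  have -> : expR (d * k.+2%:R) * (A * expR (- (B * (k%:R + 1 / 2))) * V) =
    A * V * (expR (d * k.+2%:R) * expR (- (B * (k%:R + 1 / 2)))) by ring.
  have -> : A * expR B * V * expR (k%:R * - d) = A * V * (expR B * expR (k%:R * - d)) by ring.
  rewrite -!expRD ler_wpM2l ?mulr_ge0 ?(ltW A0)// ler_expR.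
  have -> : k.+2%:R = k%:R + 2 :> R by rewrite -addn2 natrD.
  have k00 : 0 <= k%:R :> R by [].
  have := mulr_ge0 (ltW B0) k00; rewrite /d; lra.
apply: lime_le.
  by apply: is_cvg_nneseries => k _ _; rewrite lee_fin mulr_ge0// exprn_ge0.
apply: nearW => k; rewrite sumEFin lee_fin big_mkord -mulr_sumr.
have := ler_wpM2l C0 (geometric_sum_le q k q0 q1); rewrite /q /d.
by rewrite [A * expR B / _ * V]mulrAC.
Qed.

End equivalence.

Theorem corollary3p5 (R : realType) (n : nat) (p : R) (hp : 1 < p)
    (gamma : R) (hgamma0 : 0 < gamma) (hgamma1 : gamma < 1)
    (f : spacetime R n -> R) (hf : measurable_fun [set: spacetime R n] f) :
  [<-> (* (i) *) BMO_plus p gamma f ;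
       (* (ii) *) L1loc f /\
         exists A B : R, 0 < A /\ 0 < B /\
           forall (P : parabolic_rectangle R n) (lambda : R), 0 < lambda ->
             (spacetime_lebesgue (lower_part p gamma P `&`
                [set z | (lambda < f z - average (upper_part p gamma P) f)%R])
              <= (A * expR (- (B * lambda)))%:E *
                 spacetime_lebesgue (lower_part p gamma P))%E ;
       (* (iii) *) L1loc f /\
         exists delta D : R, 0 < delta /\ 0 < D /\
           (ereal_sup [set eaverage (lower_part p gamma P)
               (fun z => (expR (delta * positive_part
                  (f z - average (upper_part p gamma P) f)))%R%:E)
             | P in [set: parabolic_rectangle R n]] <= D%:E)%E ].
Proof.
tfae.
- move=> fB; split; first exact: fB.1.
  have [N N0 osc] := BMO_plus_oscillation p gamma f hgamma1 fB.
  exact: (john_nirenberg p gamma N f hp hgamma0 hgamma1 fB.1 N0 osc).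
- move=> [fL [A [B [A0 [B0 tail]]]]]; split => //.
  pose D := expR (B / 2) + A * expR B / (1 - expR (- (B / 2))).
  have q1 : expR (- (B / 2)) < 1 by rewrite expR_lt1 oppr_lt0 divr_gt0.
  have D0 : 0 < D.
    rewrite ltr_pwDl ?expR_gt0// divr_ge0 ?subr_ge0 ?(ltW q1)//.
    by rewrite mulr_ge0 ?expR_ge0// ltW.
  exists (B / 2), D; split; first by rewrite divr_gt0.
  split=> //; apply: ge_ereal_sup => _ [P _ <-].
  have [V V0 VE] := lower_part_measure p gamma P hgamma1.
  have := expR_integral_le f (lower_part p gamma P) (average (upper_part p gamma P) f)
    A B V hf (measurable_lower_part p gamma P) A0 B0 VE (tail P).
  rewrite /eaverage VE /= => h.
  have Vi : (0 <= V^-1%:E)%E by rewrite lee_fin invr_ge0 ltW.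
  apply: (le_trans (lee_wpmul2l Vi h)).
  by rewrite -EFinM mulrC mulfK// gt_eqF.
- move=> [fL [d [D [d0 [D0 supD]]]]]; split => //.
  apply: (@le_lt_trans _ _ (d^-1 * D)%:E); last by rewrite ltry.
  apply: ge_ereal_sup => _ [P _ <-].
  set c := average _ f; set X := lower_part p gamma P.
  have mX : measurable X := measurable_lower_part p gamma P.
  have mpos := measurable_positive_part f X c hf.
  have mexp : measurable_fun X (EFin \o (fun z => expR (d * positive_part (f z - c)))).
    apply/measurable_EFinP; apply: measurableT_comp; first exact: measurable_expR.
    by apply: measurable_funM; first exact: measurable_cst.
  have [V V0 VE] := lower_part_measure p gamma P hgamma1.
  have Vi : (0 <= V^-1%:E)%E by rewrite lee_fin invr_ge0 ltW.
  have di : 0 <= d^-1 by rewrite invr_ge0 ltW.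
  have : (eaverage X (fun z => (expR (d * positive_part (f z - c)))%:E) <= D%:E)%E.
    by apply: le_trans supD; apply: ereal_sup_ubound; exists P.
  rewrite /eaverage VE /= => h.
  (* Pointwise, [1 + x <= expR x] at [x = d * positive_part (f z - c)] bounds the positive part by
     [d^-1] times the exponential. *)
  have hi : (\int[spacetime_lebesgue]_(z in X) (positive_part (f z - c))%:E <=
      d^-1%:E * \int[spacetime_lebesgue]_(z in X) (expR (d * positive_part (f z - c)))%:E)%E.
    rewrite -ge0_integralZl_EFin//.
    apply: ge0_le_integral.
    - exact: mX.
    - by move=> z _; rewrite lee_fin /positive_part le_max lexx orbT.
    - exact/measurable_EFinP.
    - exact: measurable_funeM.
    move=> z _; rewrite -EFinM lee_fin mulrC ler_pdivlMr// mulrC.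
    by apply: le_trans (expR_ge1Dx _); rewrite lerDr.
  apply: (le_trans (lee_wpmul2l Vi hi)); rewrite muleCA EFinM.
  by rewrite lee_wpmul2l.
Qed.
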